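(* Let $\Gamma$ be an $\widetilde A_2$ group acting on an $\widetilde A_2$ building $\Delta$ of order $q$ with minimal boundary $\mathcal P$. Then the module of coinvariants $C(\mathcal P,\mathbb Z)_\Gamma$ is a finite group, and the class $[\mathbf 1]$ of the constant function $\mathbf 1$ in $C(\mathcal P,\mathbb Z)_\Gamma$ has order bounded by $q^2-1$. Moreover, if $\Gamma$ has an S-invariant triangle presentation, then $(q-1)[\mathbf 1]=0$.
   Context: **$\widetilde A_2$ groups.** Let $\Delta$ be a locally finite (thick) affine building of type $\widetilde A_2$, of order $q$ (the link of each vertex is the incidence graph of a projective plane of order $q$). Each vertex $v$ has a type $\tau(v)\in\mathbb Z/3\mathbb Z$, each chamber has one vertex of each type, and each edge $e$ is directed from its initial vertex $o(e)$ to its final vertex $t(e)$, with $\tau(t(e))=\tau(o(e))+1$; $E_+$ is the set of directed edges. An automorphism $\alpha$ of $\Delta$ is type rotating if for some $i$, $\tau(\alpha(v))=\tau(v)+i$ for all $v$. An $\widetilde A_2$ group is a group of type rotating automorphisms of $\Delta$ acting freely and transitively on the vertices of $\Delta$. **Minimal boundary.** Points of the building at infinity $\Delta^\infty$ are parallelism classes of rays (isometric copies of $[0,\infty)$ in $\Delta$; parallel means at finite Hausdorff distance). For each vertex $x$ and $\xi\in\Delta^\infty$ there is a unique ray $[x,\xi)$ from $x$ in the class $\xi$. A sector is a $\frac{\pi}{3}$-angled sector made up of chambers in some apartment. If $[x,\xi)$ is a wall of a sector and its initial edge $[x,y]$ has $\tau(y)=\tau(x)+i$, then $\xi$ is called a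 vertex of $\Delta^\infty$ of type $i-1$ (independent of $x$). The minimal boundary $\mathcal P$ is the set of vertices of $\Delta^\infty$ of type $0$, with the compact totally disconnected topology having as basis the clopen sets $\Omega(e)=\{\xi\in\mathcal P : e\subset[o(e),\xi)\}$, $e\in E_+$. (If $\Delta$ is the Bruhat-Tits building of $\mathrm{PGL}_3(\mathbb K)$, $\mathbb K$ a nonarchimedean local field, then $\mathcal P$ is the projective plane $\mathbb P^2_{\mathbb K}$ as a topological $\mathrm{PGL}_3(\mathbb K)$-space.) **Coinvariants.** $C(\mathcal P,\mathbb Z)$ is the group of continuous integer-valued functions, a $\Gamma$-module via $(g\cdot f)(\xi)=f(g^{-1}\xi)$; $C(\mathcal P,\mathbb Z)_\Gamma$ is its quotient by the submodule generated by all $g\cdot f-f$. **Triangle presentations.** Let $(P,L)$ be a projective plane of order $q$ with point set $P$ and line set $L$, and $\lambda:P\to L$ a bijection. A triangle presentation compatible with $\lambda$ is a set $\mathcal T\subset P^3$ such that: (i) for $x,y\in P$, $(x,y,z)\in\mathcal T$ for some $z\in P$ iff $y\in\lambda(x)$; (ii) $(x,y,z)\in\mathcal T\Rightarrow(y,z,x)\in\mathcal T$; (iii) for $x,y\in P$ there is at most one $z$ with $(x,y,z)\in\mathcal T$. The group $\Gamma_{\mathcal T}=\langle P\mid xyz=1,\ (x,y,z)\in\mathcal T\rangle$ is an $\widetilde A_2$ group: its Cayley graph with respect to $P$ is the 1-skeleton of an $\widetilde A_2$ building $\Delta_{\mathcal T}$, with directed edges $(a,ax)$ and chambers $\{a,ax,axy\}$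 ($a\in\Gamma_{\mathcal T}$, $(x,y,z)\in\mathcal T$), on which $\Gamma_{\mathcal T}$ acts by left multiplication. Every $\widetilde A_2$ group arises in this way. ''$\Gamma$ has an S-invariant triangle presentation'' means that $\Gamma=\Gamma_{\mathcal T}$, $\Delta=\Delta_{\mathcal T}$ for some triangle presentation $\mathcal T$, over the Desarguesian plane $(P,L)=PG(2,q)$, which is S-invariant, i.e. invariant under a Singer group: a cyclic group of collineations of $(P,L)$ of order $q^2+q+1$ acting regularly on $P$ and on $L$, where a collineation $g$ acts on triples by $(x,y,z)\mapsto(gx,gy,gz)$. *)

(* Defs.v *)
From HB Require Import structures.
From mathcomp Require Import all_boot all_order all_algebra.
From mathcomp Require Import finmap.
From mathcomp Require Import all_classical all_reals all_analysis.
From mathcomp Require Import ring_quotient.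

Set Implicit Arguments.
Unset Strict Implicit.
Unset Printing Implicit Defensive.

Import Order.TTheory GRing.Theory Num.Theory.

Local Open Scope classical_set_scope.
Local Open Scope card_scope.
Local Open Scope ring_scope.

Definition projective_plane (P L : Type) (inc : P -> L -> Prop) (q : nat) :=
  [/\ (forall p p' : P, p <> p' -> exists! l, inc p l /\ inc p' l),
      (forall l l' : L, l <> l' -> exists! p, inc p l /\ inc p l'),
      (exists2 p : 'I_4 -> P, injective p &
        forall l i j k, uniq [:: i; j; k] ->
          ~ [/\ inc (p i) l, inc (p j) l & inc (p k) l]) &
      (forall l, [set p | inc p l] #= `I_q.+1)].

Definition pg_point (F : finFieldType) :=
  {U : {vspace 'rV[F]_3} | \dim U == 1%N}.
Definition pg_line (F : finFieldType) :=
  {W : {vspace 'rV[F]_3} | \dim W == 2%N}.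
Definition pg_inc (F : finFieldType) (p : pg_point F) (l : pg_line F) : Prop :=
  (val p <= val l)%VS.

Definition collineation (P L : Type) (inc : P -> L -> Prop)
    (sP : P -> P) (sL : L -> L) :=
  [/\ bijective sP, bijective sL & forall p l, inc p l <-> inc (sP p) (sL l)].

(* The group generated by the collineation (sP, sL) is cyclic of order n    *)
(* and regular both on points and on lines.                                 *)
Definition regular_cyclic (P L : Type) (n : nat) (sP : P -> P) (sL : L -> L) :=
  [/\ (iter n sP =1 id) /\ (iter n sL =1 id),
      (forall k, (0 < k < n)%N -> ~ (iter k sP =1 id /\ iter k sL =1 id)),
      (forall p p' : P, exists! k, (k < n)%N /\ iter k sP p = p') &
      (forall l l' : L, exists! k, (k < n)%N /\ iter k sL l = l')].

Definition singer_generator (P L : Type) (inc : P -> L -> Prop) (q : nat)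
    (sP : P -> P) (sL : L -> L) :=
  collineation inc sP sL /\ regular_cyclic (q ^ 2 + q + 1)%N sP sL.

(* The vertices are the points i e1 + j e2 of the triangular lattice, where *)
(* e1, e2 are unit vectors at an angle of 2pi/3; hence e1 + e2 is a unit    *)
(* vector too and |x e1 + y e2|^2 = x^2 + y^2 - x y.                        *)
Definition cox_vertex := (int * int)%type.

Definition cox_chamber : set (set cox_vertex) :=
  [set c | exists z : cox_vertex,
     c = [set z; z + (1, 0); z + (1, 1)] \/ c = [set z; z + (0, 1); z + (1, 1)]].

Definition cox_simplex : set (set cox_vertex) :=
  [set s | s !=set0 /\ exists2 c, cox_chamber c & s `<=` c].

(* A subcomplex is a set of simplices, a simplex being a nonempty set of    *)
(* vertices. A chart of A is a simplicial isomorphism from the Coxeter      *)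
(* complex onto A, given by its action on vertices.                         *)
Definition is_chart (V : Type) (A : set (set V)) (phi : cox_vertex -> V) :=
  injective phi /\ A = [set phi @` s | s in cox_simplex].

(* In the last axiom, the isomorphism A -> A' fixing s and t pointwise is   *)
(* phi' \o phi^-1.                                                          *)
Definition apartment_system (V : Type) (simplex : set (set V))
    (Sys : set (set (set V))) :=
  [/\ (forall A, Sys A -> A `<=` simplex /\ exists phi, is_chart A phi),
      (forall s t, simplex s -> simplex t ->
         exists A, [/\ Sys A, A s & A t]) &
      (forall A A' s t, Sys A -> Sys A' -> A s -> A t -> A' s -> A' t ->
         exists phi phi', [/\ is_chart A phi, is_chart A' phi' &
           forall z, (s `|` t) (phi z) -> phi' z = phi z])].

Definition is_complex (V : Type) (simplex : set (set V)) :=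
  [/\ (forall v, simplex [set v]),
      (forall s, simplex s -> finite_set s /\ s !=set0) &
      (forall s t, simplex s -> t `<=` s -> t !=set0 -> simplex t)].

Definition is_chamber (V : Type) (simplex : set (set V)) (c : set V) :=
  simplex c /\ forall s, simplex s -> c `<=` s -> s = c.

Definition edge_of (V : Type) (simplex : set (set V)) (tau : V -> 'Z_3)
    (x y : V) :=
  simplex [set x; y] /\ tau y = tau x + 1.

(* Locally finite thick buildings of type A~2 and order q, with a           *)
(* labelling tau of the vertices. The link of x is a bipartite graph on the *)
(* neighbours y with tau y = tau x + 1 and the neighbours z with            *)
(* tau x = tau z + 1; thickness and local finiteness follow from            *)
(* [bld_link], as a projective plane of order q has 2 <= q.                 *)
Record A2_building (q : nat) := A2Building {
  vertex :> choiceType;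
  simplex : set (set vertex);
  tau : vertex -> 'Z_3;
  bld_nonempty : exists x : vertex, True;
  bld_complex : is_complex simplex;
  bld_apartments : exists Sys, apartment_system simplex Sys;
  bld_type : forall c, is_chamber simplex c ->
    forall i, exists! v, c v /\ tau v = i;
  bld_link : forall x,
    projective_plane
      (fun (y : {y | edge_of simplex tau x y})
           (z : {z | edge_of simplex tau z x}) =>
         simplex [set x; sval y; sval z]) q
}.

Section Building.
Variables (q : nat) (Delta : A2_building q).
Local Notation V := (vertex Delta).

Definition chamber : set (set V) := is_chamber (@simplex q Delta).

Definition directed_edge (x y : V) :=
  edge_of (@simplex q Delta) (@tau q Delta) x y.

(* Apartments of the complete system, the union of all apartment systems.   *)
Definition apartment (A : set (set V)) :=
  exists2 Sys, apartment_system (@simplex q Delta) Sys & Sys A.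

Definition automorphism (alpha : V -> V) :=
  bijective alpha /\ forall s, simplex s <-> simplex (alpha @` s).

Definition type_rotating (alpha : V -> V) :=
  exists i, forall v, tau (alpha v) = tau v + i.

End Building.

Section Boundary.
Variables (R : realType) (q : nat) (Delta : A2_building q).
Local Notation V := (vertex Delta).

(* Points are given by their barycentric coordinates.                       *)
Definition supp (p : V -> R) : set V := [set v | p v != 0].

Definition realization : set (V -> R) :=
  [set p | [/\ forall v, 0 <= p v, simplex (supp p) &
              \sum_(v \in [set: V]) p v = 1]].

Definition vertex_pt (x : V) : V -> R := fun v => (v == x)%:R.

Definition segment (x y : V) : set (V -> R) :=
  [set p | realization p /\ supp p `<=` [set x; y]].

(* The coordinates in the basis (e1, e2) of the point of the Euclidean      *)
(* plane sent to p by the realization of the chart phi.                     *)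
Definition coord1 (phi : cox_vertex -> V) (p : V -> R) : R :=
  \sum_(z \in [set: cox_vertex]) p (phi z) * z.1%:~R.
Definition coord2 (phi : cox_vertex -> V) (p : V -> R) : R :=
  \sum_(z \in [set: cox_vertex]) p (phi z) * z.2%:~R.

Definition flat_dist (phi : cox_vertex -> V) (p p' : V -> R) : R :=
  let x := coord1 phi p - coord1 phi p' in
  let y := coord2 phi p - coord2 phi p' in
  Num.sqrt (x ^+ 2 + y ^+ 2 - x * y).

(* The value is the same for all apartments A containing p and p' and for   *)
(* all charts phi of A.                                                     *)
Definition dist (p p' : V -> R) : R :=
  xget 0 [set d | exists A phi, [/\ apartment A, is_chart A phi,
                    A (supp p), A (supp p') & d = flat_dist phi p p']].

Definition ray_from (p : V -> R) (A : set (V -> R)) :=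
  exists rho : R -> V -> R,
    [/\ (forall t, 0 <= t -> realization (rho t)), rho 0 = p,
        (forall s t, 0 <= s -> 0 <= t -> dist (rho s) (rho t) = `|s - t|) &
        A = rho @` [set t | 0 <= t]].

Definition ray (A : set (V -> R)) := exists p, ray_from p A.

Definition parallel (A B : set (V -> R)) := exists C : R,
  (forall a, A a -> exists2 b, B b & dist a b <= C) /\
  (forall b, B b -> exists2 a, A a & dist a b <= C).

(* The points of the building at infinity, as parallelism classes of rays.  *)
Definition at_infinity : set (set (set (V -> R))) :=
  [set xi | exists2 A, ray A & xi = [set B | ray B /\ parallel A B]].

(* The part of the apartment charted by phi carried by the set D of         *)
(* vertices of the Coxeter complex.                                         *)
Definition carrier (phi : cox_vertex -> V) (D : set cox_vertex) :
    set (V -> R) :=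
  [set p | realization p /\
     exists s, [/\ cox_simplex s, s `<=` D & supp p = phi @` s]].

(* All simplicial isomorphisms being charts, every sector is of this form.  *)
Definition sector (phi : cox_vertex -> V) : set (V -> R) :=
  carrier phi [set z | 0 <= z.2 <= z.1].
Definition sector_wall1 (phi : cox_vertex -> V) : set (V -> R) :=
  carrier phi [set z | z.2 = 0 /\ 0 <= z.1].
Definition sector_wall2 (phi : cox_vertex -> V) : set (V -> R) :=
  carrier phi [set z | z.2 = z.1 /\ 0 <= z.1].

Definition is_sector_wall (W : set (V -> R)) :=
  exists A phi, [/\ apartment A, is_chart A phi &
                    W = sector_wall1 phi \/ W = sector_wall2 phi].

(* xi is a vertex of type j of the building at infinity: for some vertex x  *)
(* the ray [x, xi) is a wall W of a sector and its initial edge [x, y]      *)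
(* satisfies tau y = tau x + i with j = i - 1.                              *)
Definition infinity_vertex (j : 'Z_3) (xi : set (set (V -> R))) :=
  at_infinity xi /\
  exists x y W,
    [/\ xi W, ray_from (vertex_pt x) W & is_sector_wall W] /\
    [/\ x <> y, simplex [set x; y], segment x y `<=` W &
        exists2 i, tau y = tau x + i & j = i - 1].

Record minimal_boundary := MinimalBoundary {
  mb_class :> set (set (V -> R));
  mb_vertex : `[< infinity_vertex 0 mb_class >]
}.
HB.instance Definition _ := [isSub for mb_class].
HB.instance Definition _ := [Choice of minimal_boundary by <:].

(* Omega (x, y) = {xi | [x, y] is contained in [x, xi)} *)
Definition Omega (x y : V) : set minimal_boundary :=
  [set xi | exists2 A, mb_class xi A &
              ray_from (vertex_pt x) A /\ segment x y `<=` A].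

Definition Omega_sets : set (set minimal_boundary) :=
  [set O | exists x y, directed_edge x y /\ O = Omega x y].

(* The sets Omega e form a basis, so the topology they generate as a        *)
(* subbasis is the one they generate as a basis.                            *)
HB.instance Definition _ :=
  isSubBaseTopological.Build minimal_boundary Omega_sets id.

Definition continuousZ : {pred (minimal_boundary -> int)} :=
  fun f => `[< continuous (f : minimal_boundary -> discrete_topology int) >].

Record CZ := CZof { CZ_fun :> minimal_boundary -> int;
                    CZ_cont : CZ_fun \in continuousZ }.
HB.instance Definition _ := [isSub for CZ_fun].
HB.instance Definition _ := [Choice of CZ by <:].

Lemma continuousZP (f : minimal_boundary -> int) :
  reflect (forall xi, \forall eta \near xi, f eta = f xi) (f \in continuousZ).
Proof.
apply: (iffP (asboolP _)) => cf xi.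
  have := cf xi [set f xi] (@discrete_set1 (discrete_topology int) _).
  by rewrite nbhs_simpl.
apply/(@discrete_cvg (discrete_topology int) (f @ nbhs xi) (f xi)).
exact: (cf xi).
Qed.

Lemma continuousZ_zmod : zmod_closed continuousZ.
Proof.
split; first by apply/continuousZP => xi; apply: filterE.
move=> f g /continuousZP cf /continuousZP cg; apply/continuousZP => xi.
near=> eta.
have fE : f eta = f xi by near: eta; exact: cf.
have gE : g eta = g xi by near: eta; exact: cg.
by rewrite !fctE fE gE.
Unshelve. all: by end_near. Qed.

HB.instance Definition _ :=
  GRing.isZmodClosed.Build (minimal_boundary -> int) continuousZ continuousZ_zmod.
HB.instance Definition _ := [SubChoice_isSubZmodule of CZ by <:].

Lemma cst1_cont : (fun _ : minimal_boundary => 1 : int) \in continuousZ.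
Proof. by apply/continuousZP => xi; exact: filterE. Qed.

Definition CZ_one : CZ := CZof cst1_cont.

Lemma open_Omega x y : directed_edge x y -> open (Omega x y).
Proof.
move=> xy; exists [set Omega x y]; last by rewrite bigcup_set1.
move=> _ ->; exists [fset (Omega x y)]%fset.
  by move=> O /fset1P ->; rewrite inE; exists x, y.
by rewrite set_fset1 bigcap_set1.
Qed.

Lemma cvg_mb (F : set_system minimal_boundary) xi : Filter F ->
  (forall x y, directed_edge x y -> Omega x y xi -> F (Omega x y)) -> F --> xi.
Proof.
move=> FF H A /=; rewrite nbhsE => -[_ [[B sB <-] [C BC Cxi] sUBA]].
rewrite nbhs_filterE; apply: filterS sUBA _; apply: (@filterS _ _ _ C).
  by move=> eta Ceta; exists C.
have /sB [D sD IDeC] := BC; rewrite -IDeC; apply: filter_bigI => E DE.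
have := sD _ DE; rewrite inE => -[x [y [xy EE]]]; rewrite EE.
by apply: H => //; rewrite -EE; move: Cxi; rewrite -IDeC; apply.
Qed.

End Boundary.

Arguments vertex_pt R {q Delta} x.
Arguments segment R {q Delta} x y.
Arguments carrier R {q Delta} phi D.
Arguments Omega R {q Delta} x y.

(* As the action is free, G is identified with a group of automorphisms.    *)
Record A2_group (q : nat) (Delta : A2_building q) (G : groupType) := A2Group {
  gact : G -> vertex Delta -> vertex Delta;
  gact1 : forall x, gact 1%g x = x;
  gactM : forall g h x, gact (g * h)%g x = gact g (gact h x);
  gact_auto : forall g, automorphism (gact g);
  gact_rot : forall g, type_rotating (gact g);
  gact_free : forall g x, gact g x = x -> g = 1%g;
  gact_trans : forall x y, exists g, gact g x = y
}.

Section Action.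
Variables (R : realType) (q : nat) (Delta : A2_building q) (G : groupType).
Variable Gamma : A2_group Delta G.
Local Notation V := (vertex Delta).
Local Notation act := (gact Gamma).

Lemma gactK g : cancel (act g) (act g^-1%g).
Proof. by move=> x; rewrite -gactM mulVg gact1. Qed.

Lemma gactVK g : cancel (act g^-1%g) (act g).
Proof. by move=> x; rewrite -gactM mulgV gact1. Qed.

Definition act_set (g : G) (s : set V) : set V := act g @` s.

Definition act_pt (g : G) (p : V -> R) : V -> R := fun v => p (act g^-1%g v).

Definition act_pts (g : G) (A : set (V -> R)) : set (V -> R) := act_pt g @` A.

Definition act_class (g : G) (xi : set (set (V -> R))) : set (set (V -> R)) :=
  act_pts g @` xi.

Lemma act_setK g : cancel (act_set g) (act_set g^-1%g).
Proof.
move=> s; rewrite /act_set image_comp; apply/seteqP; split=> [x|x sx].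
  by move=> [y sy <-] /=; rewrite gactK.
by exists x => //=; rewrite gactK.
Qed.

Lemma act_setVK g : cancel (act_set g^-1%g) (act_set g).
Proof. by move=> s; rewrite -{1}(invgK g) act_setK. Qed.

Lemma act_ptK g : cancel (act_pt g) (act_pt g^-1%g).
Proof. by move=> p; apply/funext => v; rewrite /act_pt invgK gactK. Qed.

Lemma act_ptVK g : cancel (act_pt g^-1%g) (act_pt g).
Proof. by move=> p; rewrite -{1}(invgK g) act_ptK. Qed.

Lemma act_ptsK g : cancel (act_pts g) (act_pts g^-1%g).
Proof.
move=> A; rewrite /act_pts image_comp; apply/seteqP; split=> [x|x sx].
  by move=> [y sy <-] /=; rewrite act_ptK.
by exists x => //=; rewrite act_ptK.
Qed.

Lemma act_ptsVK g : cancel (act_pts g^-1%g) (act_pts g).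
Proof. by move=> s; rewrite -{1}(invgK g) act_ptsK. Qed.

Lemma act_classK g : cancel (act_class g) (act_class g^-1%g).
Proof.
move=> A; rewrite /act_class image_comp; apply/seteqP; split=> [x|x sx].
  by move=> [y sy <-] /=; rewrite act_ptsK.
by exists x => //=; rewrite act_ptsK.
Qed.

Lemma simplex_act g s : simplex (act_set g s) <-> simplex s.
Proof. by have [_ /(_ s) []] := gact_auto Gamma g; split. Qed.

Lemma supp_act g p : supp (act_pt g p) = act_set g (supp p).
Proof.
apply/seteqP; split=> [v /= pv|_ [v pv <-]].
  by exists (act g^-1%g v) => //; rewrite gactVK.
by rewrite /supp /= /act_pt gactK.
Qed.

Lemma realization_act g p : realization p -> realization (act_pt g p).
Proof.
move=> [p0 sp p1]; split=> [v||]; first exact: p0.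
  by rewrite supp_act; apply/simplex_act.
rewrite -p1 [RHS](reindex_fsbigT (act g^-1%g)) //.
by exists (act g); [exact: gactVK|exact: gactK].
Qed.

Lemma act_pt_vertex g x : act_pt g (vertex_pt R x) = vertex_pt R (act g x).
Proof.
apply/funext => v; rewrite /act_pt /vertex_pt; congr (_%:R); congr nat_of_bool.
by apply/eqP/eqP => [<-|->]; rewrite ?gactVK ?gactK.
Qed.

Lemma act_segment g x y :
  act_pts g (segment R x y) `<=` segment R (act g x) (act g y).
Proof.
move=> _ [p [rp sp] <-]; split; first exact: realization_act.
rewrite supp_act => _ [v /sp pv <-].
by case: pv => ->; [left|right].
Qed.

Lemma segment_act g x y :
  segment R (act g x) (act g y) `<=` act_pts g (segment R x y).
Proof.
move=> p pxy; exists (act_pt g^-1%g p); last by rewrite act_ptVK.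
have := @act_segment g^-1%g (act g x) (act g y) (act_pt g^-1%g p).
by rewrite !gactK; apply; exists p.
Qed.

Lemma chart_act g A phi :
  is_chart A phi -> is_chart (act_set g @` A) (act g \o phi).
Proof.
move=> [iphi ->]; split; first exact: inj_comp (can_inj (gactK g)) iphi.
rewrite image_comp; apply: eq_imagel => s _.
by rewrite /= /act_set image_comp.
Qed.

Lemma mem_act_set g (A : set (set V)) s :
  (act_set g @` A) s <-> A (act_set g^-1%g s).
Proof.
split=> [[t At <-]|As]; first by rewrite act_setK.
by exists (act_set g^-1%g s) => //; rewrite act_setVK.
Qed.

Lemma apartment_act g A : apartment A -> apartment (act_set g @` A).
Proof.
move=> [Sys [S0 S1 S2] SA].
exists [set act_set g @` B | B in Sys]; last by exists A.
split=> [_ [B SB <-]|s t ss st|_ _ s t [B SB <-] [C SC <-]].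
- have [Bs [phi chphi]] := S0 _ SB; split; last first.
    by exists (act g \o phi); apply: chart_act.
  by move=> _ [s /Bs ss <-]; apply/simplex_act.
- have [||B [SB Bs Bt]] := S1 (act_set g^-1%g s) (act_set g^-1%g t).
  + exact/simplex_act.
  + exact/simplex_act.
  by exists (act_set g @` B); split; [exists B|apply/mem_act_set..].
- move=> /mem_act_set Bs /mem_act_set Bt /mem_act_set Cs /mem_act_set Ct.
  have [phi [phi' [ch ch' E]]] := S2 _ _ _ _ SB SC Bs Bt Cs Ct.
  exists (act g \o phi), (act g \o phi'); split; [exact: chart_act..|].
  move=> z /= stz; congr act; apply: E.
  by case: stz => ?; [left|right]; exists (act g (phi z)) => //; rewrite gactK.
Qed.

Lemma flat_dist_act g phi p p' :
  flat_dist (act g \o phi) (act_pt g p) (act_pt g p') = flat_dist phi p p'.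
Proof.
suff E (u : V -> R) : act_pt g u \o (act g \o phi) = u \o phi.
  rewrite /flat_dist /coord1 /coord2.
  have E' (u : V -> R) (c : cox_vertex -> R) :
      \sum_(z \in [set: cox_vertex]) act_pt g u ((act g \o phi) z) * c z =
      \sum_(z \in [set: cox_vertex]) u (phi z) * c z.
    by apply: eq_fsbigr => z _; rewrite /act_pt /= gactK.
  by rewrite !E'.
by apply/funext => z; rewrite /= /act_pt gactK.
Qed.

Lemma dist_act g p p' : dist (act_pt g p) (act_pt g p') = dist p p'.
Proof.
pose S (p p' : V -> R) := [set d | exists A phi,
  [/\ apartment A, is_chart A phi, A (supp p), A (supp p') &
      d = flat_dist phi p p']].
have sub h u u' : S u u' `<=` S (act_pt h u) (act_pt h u').
  move=> d [A [phi [aA ch Au Au' ->]]].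
  exists (act_set h @` A), (act h \o phi); split.
  - exact: apartment_act.
  - exact: chart_act.
  - by rewrite supp_act; exists (supp u).
  - by rewrite supp_act; exists (supp u').
  - by rewrite flat_dist_act.
congr xget; apply/seteqP; split; last exact: sub.
by move=> d /(sub g^-1%g); rewrite !act_ptK.
Qed.

Lemma ray_from_act g p A : ray_from p A -> ray_from (act_pt g p) (act_pts g A).
Proof.
move=> [rho [r0 r1 r2 ->]]; exists (act_pt g \o rho); split.
- by move=> t t0; apply/realization_act/r0.
- by rewrite /= r1.
- by move=> s t s0 t0; rewrite /= dist_act r2.
- by rewrite /act_pts image_comp.
Qed.

Lemma ray_act g A : ray A -> ray (act_pts g A).
Proof. by move=> [p rA]; exists (act_pt g p); apply: ray_from_act. Qed.

Lemma parallel_act g A B : parallel A B -> parallel (act_pts g A) (act_pts g B).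
Proof.
move=> [C [AB BA]]; exists C; split=> _ [a Aa <-].
  have [b Bb ab] := AB _ Aa; exists (act_pt g b); first by exists b.
  by rewrite dist_act.
have [b Bb ab] := BA _ Aa; exists (act_pt g b); first by exists b.
by rewrite dist_act.
Qed.

Lemma at_infinity_act g xi : at_infinity xi -> at_infinity (act_class g xi).
Proof.
move=> [A rA ->]; exists (act_pts g A); first exact: ray_act.
apply/seteqP; split=> [_ [B [rB AB] <-]|B [rB AB]].
  by split; [exact: ray_act|exact: parallel_act].
exists (act_pts g^-1%g B); last by rewrite act_ptsVK.
split; first exact: ray_act.
by have := parallel_act g^-1%g AB; rewrite act_ptsK.
Qed.

Lemma carrier_act g phi D :
  act_pts g (carrier R phi D) = carrier R (act g \o phi) D.
Proof.
apply/seteqP; split=> [_ [p [rp [s [cs sD ps]]] <-]|p [rp [s [cs sD ps]]]].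
  split; first exact: realization_act.
  by exists s; split=> //; rewrite supp_act ps /act_set image_comp.
exists (act_pt g^-1%g p); last by rewrite act_ptVK.
split; first exact: realization_act.
exists s; split=> //; rewrite supp_act ps /act_set image_comp.
by apply: eq_imagel => z _; rewrite /= gactK.
Qed.

Lemma sector_wall_act g W :
  is_sector_wall W -> is_sector_wall (act_pts g W).
Proof.
move=> [A [phi [aA ch WE]]]; exists (act_set g @` A), (act g \o phi); split.
- exact: apartment_act.
- exact: chart_act.
- by case: WE => ->; [left|right]; apply: carrier_act.
Qed.

Lemma infinity_vertex_act g j xi :
  infinity_vertex j xi -> infinity_vertex j (act_class g xi).
Proof.
move=> [ixi [x [y [W [[xW rW sW] [xy sxy xyW [i tau_xy jE]]]]]]].
split; first exact: at_infinity_act.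
exists (act g x), (act g y), (act_pts g W); split; split.
- by exists W.
- by rewrite -act_pt_vertex; apply: ray_from_act.
- exact: sector_wall_act.
- by move/(can_inj (gactK g)).
- have := (simplex_act g [set x; y]).2 sxy.
  by rewrite /act_set image_setU !image_set1.
- apply: subset_trans (@segment_act g x y) _.
  exact: image_subset.
- have [k tauE] := gact_rot Gamma g.
  by exists i => //; rewrite !tauE tau_xy addrAC.
Qed.

Lemma mb_act_subproof g (xi : minimal_boundary R Delta) :
  `[< infinity_vertex 0 (act_class g (mb_class xi)) >].
Proof. exact/asboolP/infinity_vertex_act/asboolP/mb_vertex. Qed.

Definition act_mb (g : G) (xi : minimal_boundary R Delta) :
    minimal_boundary R Delta :=
  MinimalBoundary (mb_act_subproof g xi).

Lemma act_mbK g : cancel (act_mb g) (act_mb g^-1%g).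
Proof. by move=> xi; apply/val_inj; apply: act_classK. Qed.

Lemma act_mb_Omega g x y xi :
  Omega R x y xi -> Omega R (act g x) (act g y) (act_mb g xi).
Proof.
move=> [A xiA [rA xyA]]; exists (act_pts g A); first by exists A.
rewrite -act_pt_vertex; split; first exact: ray_from_act.
by apply: subset_trans (@segment_act g x y) _; exact: image_subset.
Qed.

Lemma directed_edge_act g x y :
  directed_edge x y -> directed_edge (act g x) (act g y).
Proof.
move=> [sxy txy]; split.
  have := (simplex_act g [set x; y]).2 sxy.
  by rewrite /act_set image_setU !image_set1.
by have [k tauE] := gact_rot Gamma g; rewrite !tauE txy addrAC.
Qed.

Lemma act_mb_cont g : continuous (act_mb g).
Proof.
move=> xi; apply/(@cvg_mb R q Delta (act_mb g @ nbhs xi)) => x y xy Oxi.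
have /(directed_edge_act g^-1%g)/(open_Omega R) := xy.
have := act_mb_Omega g^-1%g Oxi; rewrite act_mbK => Oxi' oO.
have : nbhs xi (Omega R (act g^-1%g x) (act g^-1%g y)) by apply: open_nbhs_nbhs.
by apply: filterS => eta /(act_mb_Omega g); rewrite !gactVK.
Qed.

Lemma act_CZ_subproof g (f : CZ R Delta) :
  (f \o act_mb g^-1%g) \in continuousZ (R := R) (Delta := Delta).
Proof.
apply/asboolP => xi; apply: continuous_comp; first exact: act_mb_cont.
by have /asboolP := CZ_cont f; apply.
Qed.

Definition act_CZ (g : G) (f : CZ R Delta) : CZ R Delta :=
  CZof (act_CZ_subproof g f).

Definition CZ_submodule (S : set (CZ R Delta)) :=
  [/\ S 0, (forall f h, S f -> S h -> S (f - h)) &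
      (forall g f, S f -> S (act_CZ g f))].

Definition coinv_submodule : set (CZ R Delta) :=
  [set f | forall S, CZ_submodule S -> (forall g h, S (act_CZ g h - h)) -> S f].

Definition coinv_pred : {pred (CZ R Delta)} := fun f => `[< coinv_submodule f >].

Lemma coinv_pred_zmod : zmod_closed coinv_pred.
Proof.
split; first by apply/asboolP => S [].
move=> f h /asboolP cf /asboolP ch; apply/asboolP => S SS Sg.
by have [_ SB _] := SS; apply: SB; [exact: cf|exact: ch].
Qed.
HB.instance Definition _ :=
  GRing.isZmodClosed.Build (CZ R Delta) coinv_pred coinv_pred_zmod.

Definition coinvariants : zmodType := Quotient.quot coinv_pred.

Definition coinv_class (f : CZ R Delta) : coinvariants := \pi_coinvariants%qT f.

End Action.

Definition has_order (M : zmodType) (a : M) (n : nat) :=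
  [/\ (0 < n)%N, a *+ n = 0 & forall m, (0 < m < n)%N -> a *+ m <> 0].

Definition triangle_presentation (P L : Type) (inc : P -> L -> Prop)
    (lam : P -> L) (T : P -> P -> P -> Prop) :=
  [/\ bijective lam,
      (forall x y, (exists z, T x y z) <-> inc y (lam x)),
      (forall x y z, T x y z -> T y z x) &
      (forall x y z z', T x y z -> T x y z' -> z = z')].

(* Words in the letters (x, true) = x and (x, false) = x^-1.                *)
Definition word (P : Type) := seq (P * bool).

(* Equality of words in < P | x y z = 1, (x, y, z) \in T >.                 *)
Inductive word_eq (P : Type) (T : P -> P -> P -> Prop) :
    word P -> word P -> Prop :=
| word_eq_refl u : word_eq T u u
| word_eq_sym u v : word_eq T u v -> word_eq T v u
| word_eq_trans u v w : word_eq T u v -> word_eq T v w -> word_eq T u w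
| word_eq_cat u u' v v' :
    word_eq T u u' -> word_eq T v v' -> word_eq T (u ++ v) (u' ++ v')
| word_eq_inv x b : word_eq T [:: (x, b); (x, ~~ b)] [::]
| word_eq_rel x y z : T x y z ->
    word_eq T [:: (x, true); (y, true); (z, true)] [::].

Definition word_val (P : Type) (G : groupType) (gen : P -> G) (w : word P) : G :=
  (\prod_(l <- w) (if l.2 then gen l.1 else (gen l.1)^-1))%g.

(* gen induces an isomorphism from < P | x y z = 1, (x, y, z) \in T > to G. *)
Definition presents (P : Type) (T : P -> P -> P -> Prop) (G : groupType)
    (gen : P -> G) :=
  (forall a, exists w, word_val gen w = a) /\
  (forall u v, word_val gen u = word_val gen v <-> word_eq T u v).

Section Presentation.
Variables (q : nat) (Delta : A2_building q) (G : groupType).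
Variable Gamma : A2_group Delta G.
Local Notation V := (vertex Delta).
Local Notation act := (gact Gamma).

(* a |-> a o is an isomorphism from Delta_T to Delta; it is Gamma-          *)
(* equivariant for the action of Gamma on Delta_T by left multiplication.   *)
Definition presents_building (P : Type) (T : P -> P -> P -> Prop)
    (gen : P -> G) (o : V) :=
  (forall u v, directed_edge u v <->
     exists a x, u = act a o /\ v = act (a * gen x)%g o) /\
  (forall c, chamber c <->
     exists a x y z, T x y z /\
       c = [set act a o; act (a * gen x)%g o; act (a * gen x * gen y)%g o]).

Definition has_presentation (P : Type) (T : P -> P -> P -> Prop) :=
  exists gen o, presents T gen /\ presents_building T gen o.

Definition S_invariant (P L : Type) (inc : P -> L -> Prop)
    (T : P -> P -> P -> Prop) :=
  exists sP sL, singer_generator inc q sP sL /\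
    forall x y z, T x y z <-> T (sP x) (sP y) (sP z).

Definition has_S_invariant_presentation :=
  exists (F : finFieldType) (lam : pg_point F -> pg_line F) T,
    [/\ #|F| = q, triangle_presentation (@pg_inc F) lam T,
        S_invariant (@pg_inc F) T & has_presentation T].

End Presentation.

(* Main.v *)
(* For an edge from x to y of positive type let [x y] be the class of the    *)

(* The geometry is reduced to the directed length [dlen]. Folding the building onto an apartment
   ([ochart_retraction]) shows that charts are isometric for it ([dlen_ochart]) and that a locally
   straight path lies on a lattice line in every chart through its ends ([spath_chart]). Euclidean
   distances are functions of directed lengths ([flat_dist_formula]), so rays and parallelism can be
   replaced by straight sequences of vertices at bounded directed length; [sray_directs] and
   [directs_ex] match these sequences with the points of the boundary.

   Sliding a straight path across a strip of triangles ([transport]) changes its Busemann function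
   only by a constant. Hence every vertex is the origin of a straight path with the given end, and
   exactly one outgoing edge descends there ([blim_horo]). [Omega_horo] identifies the sets Omega
   with these descents, and the behaviour of descents around chambers gives [sum_chi], [chi_refine]
   and [chi_triangle].

   The group moves every edge to one leaving a base vertex [o], so that [chi_refine] becomes the
   linear system [gen_class_refine], whose matrix is an incidence matrix of the link of [o]. Its sum
   bounds the order of [1] ([inc_total]), and its adjugate makes the finitely many generators
   torsion ([inc_torsion]). The translates of one chamber relation under a Singer group run three
   times through all generators ([singer_torsion]). *)
(* characteristic function of Omega (x, y) in the coinvariants. It depends   *)
(* only on the orbit of the edge, and these classes generate: a function not *)
(* in their span would stay so when restricted to smaller and smaller sets   *)
(* Omega along a ray, but it is constant near the end of the ray. Three      *)
(* facts about the sets Omega give all the relations needed.                 *)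
(* - For each x, the sets Omega (x, y) partition the boundary.               *)
(* - Omega (x, y) is the disjoint union of the Omega (y, y') with y' not     *)
(*   adjacent to x.                                                          *)
(* - For a chamber with cyclically directed edges xy, yz, zx, the sets       *)
(*   Omega (x, y), Omega (y, z), Omega (z, x) partition the boundary.        *)
(* By the first two, the vector c of the q^2 + q + 1 generating classes      *)
(* satisfies c + A c = [1] J where A is the incidence matrix of a plane of   *)
(* order q and J the all-one vector. Summing gives (q^2 - 1) [1] = 0, and    *)
(* det (1 + A) is not 0 as A A^T = q + J, so the coinvariants are finite.    *)
(* With a triangle presentation, the third fact reads [x] + [y] + [z] = [1]  *)
(* for (x, y, z) in T.                                                       *)
(*                                                                           *)
(* A point xi of the boundary is the end of a straight path w. The Busemann  *)
(* function b x = lim (d (w n, x) - 2 n), for the length d of directed       *)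
(* paths, increases by 1 or -2 along each edge from x to y, and xi is in     *)
(* Omega (x, y) exactly when it decreases; the three facts follow, since b   *)
(* decreases on exactly one edge of each chamber. Conversely each straight   *)
(* path converges to a point of the boundary, since it lies on a wall of an  *)
(* apartment that is a limit of apartments of the given system.              *)
From HB Require Import structures.
Require Import Defs.
From mathcomp Require Import all_boot all_order all_algebra.
From mathcomp Require Import finmap ring_quotient.
From mathcomp Require Import zify ring lra.
From mathcomp Require Import all_classical all_reals all_analysis.
Set Implicit Arguments.
Unset Strict Implicit.
Unset Printing Implicit Defensive.
Import Order.TTheory GRing.Theory Num.Theory.
Local Open Scope classical_set_scope.
Local Open Scope card_scope.
Local Open Scope ring_scope.

(** * The triangular lattice *)

(** Equality or adjacency: the inequalities cut out the hexagon formed by 0 and the six unit vectors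
    of the lattice. *)
Definition cadj (z w : cox_vertex) : bool :=
  [&& -1 <= w.1 - z.1 <= 1, -1 <= w.2 - z.2 <= 1 &
      -1 <= (w.1 - z.1) - (w.2 - z.2) <= 1].

Lemma cadjC z w : cadj z w = cadj w z.
Proof. rewrite /cadj; lia. Qed.

Lemma cadj_refl z : cadj z z.
Proof. rewrite /cadj; lia. Qed.

Lemma pair_int_eq (z w : cox_vertex) : z.1 = w.1 -> z.2 = w.2 -> z = w.
Proof. by case: z w => [a b] [c d] /= -> ->. Qed.

Lemma cox_chamber_cadj c z w : cox_chamber c -> c z -> c w -> cadj z w.
Proof.
move=> [[a b]] [] -> [[]->|->] [[]->|->]; rewrite /cadj /=; lia.
Qed.

(** The Coxeter complex is a flag complex. Pairwise adjacency confines [s] to a unit square with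
    least corner (m1, m2), and the corners (m1, m2 + 1) and (m1 + 1, m2) are not adjacent, so one of
    the two chambers of the square contains [s]. *)
Lemma cox_simplexP s :
  cox_simplex s <-> s !=set0 /\ forall z w, s z -> s w -> cadj z w.
Proof.
split=> [[s0 [c cc sc]]|[[z0 sz0] sadj]].
  by split=> // z w /sc cz /sc cw; apply: cox_chamber_cadj cz cw.
split; first by exists z0.
have [m1 [m1P [w1 sw1 w1E]]] : exists m1 : int,
    (forall z, s z -> m1 <= z.1 <= m1 + 1) /\ exists2 w, s w & w.1 = m1.
  have [[w [sw wE]]|nw] := pselect (exists w, s w /\ w.1 = z0.1 - 1).
    exists w.1; split; last by exists w.
    by move=> z sz; move: (sadj _ _ sw sz) (sadj _ _ sz0 sz); rewrite /cadj; lia.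
  exists z0.1; split; last by exists z0.
  move=> z sz; have : z.1 <> z0.1 - 1 by move=> ?; apply: nw; exists z.
  by move: (sadj _ _ sz0 sz); rewrite /cadj; lia.
have [m2 [m2P [w2 sw2 w2E]]] : exists m2 : int,
    (forall z, s z -> m2 <= z.2 <= m2 + 1) /\ exists2 w, s w & w.2 = m2.
  have [[w [sw wE]]|nw] := pselect (exists w, s w /\ w.2 = z0.2 - 1).
    exists w.2; split; last by exists w.
    by move=> z sz; move: (sadj _ _ sw sz) (sadj _ _ sz0 sz); rewrite /cadj; lia.
  exists z0.2; split; last by exists z0.
  move=> z sz; have : z.2 <> z0.2 - 1 by move=> ?; apply: nw; exists z.
  by move: (sadj _ _ sz0 sz); rewrite /cadj; lia.
have [su|nsu] := pselect (s (m1, m2 + 1)).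
  exists [set (m1, m2); (m1, m2) + (0, 1); (m1, m2) + (1, 1)].
    by exists (m1, m2); right.
  move=> z sz; have := sadj _ _ su sz; have := m1P _ sz; have := m2P _ sz.
  rewrite /cadj /= => h1 h2 h3.
  have [e2|e2] : z.2 = m2 \/ z.2 = m2 + 1 by lia.
    by left; left; apply: pair_int_eq => /=; lia.
  have [e1|e1] : z.1 = m1 \/ z.1 = m1 + 1 by lia.
    by left; right; apply: pair_int_eq => /=; lia.
  by right; apply: pair_int_eq => /=; lia.
exists [set (m1, m2); (m1, m2) + (1, 0); (m1, m2) + (1, 1)].
  by exists (m1, m2); left.
move=> z sz; have := m1P _ sz; have := m2P _ sz => h1 h2.
have nz : z <> (m1, m2 + 1) by move=> zE; apply: nsu; rewrite -zE.
have [e1|e1] : z.1 = m1 \/ z.1 = m1 + 1 by lia.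
  have [e2|e2] : z.2 = m2 \/ z.2 = m2 + 1 by lia.
    by left; left; apply: pair_int_eq => /=; lia.
  by case: nz; apply: pair_int_eq.
have [e2|e2] : z.2 = m2 \/ z.2 = m2 + 1 by lia.
  by left; right; apply: pair_int_eq => /=; lia.
by right; apply: pair_int_eq => /=; lia.
Qed.

Lemma cox_chamber_simplex c : cox_chamber c -> cox_simplex c.
Proof.
move=> cc; split; last by exists c.
by case: cc => z [] ->; exists z; left; left.
Qed.

Lemma cox_simplex1 z : cox_simplex [set z].
Proof.
by apply/cox_simplexP; split=> [|_ _ -> ->]; [exists z|exact: cadj_refl].
Qed.

Lemma cox_simplex2 z w : cadj z w -> cox_simplex [set z; w].
Proof.
move=> zw; apply/cox_simplexP; split=> [|_ _ [] -> [] ->] //;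
  rewrite ?cadj_refl // 1?cadjC //.
by exists z; left.
Qed.

Lemma cox_simplex3 u v w : cadj u v -> cadj v w -> cadj u w ->
  cox_simplex [set u; v; w].
Proof.
move=> uv vw uw; apply/cox_simplexP; split=> [|_ _ [[]->|->] [[]->|->]] //;
  rewrite ?cadj_refl // 1?cadjC //.
by exists u; left; left.
Qed.

Definition cdirs : seq cox_vertex :=
  [:: (1, 0); (0, 1); (-1, -1); (-1, 0); (0, -1); (1, 1)].

Lemma cadj_dirs z w : cadj z w = (w == z) || (w - z \in cdirs).
Proof.
have [a [b E]] : exists a b, w - z = (a, b) by case: (w - z) => a b; exists a, b.
rewrite -subr_eq0 E.
have -> : cadj z w = [&& -1 <= a <= 1, -1 <= b <= 1 & -1 <= a - b <= 1].
  have Ea : w.1 - z.1 = a by rewrite -[RHS]/((a, b).1) -E.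
  have Eb : w.2 - z.2 = b by rewrite -[RHS]/((a, b).2) -E.
  by rewrite /cadj Ea Eb.
rewrite !inE !xpair_eqE /=.
have [|na] := boolP (a \in [:: -1; 0; 1]); last first.
  have -> : (-1 <= a <= 1) = false by apply/negP => h; move: na; rewrite !inE; lia.
  by move: na; rewrite !inE !negb_or => /and3P[/negbTE -> /negbTE -> /negbTE ->].
have [|nb] := boolP (b \in [:: -1; 0; 1]); last first.
  have -> : (-1 <= b <= 1) = false by apply/negP => h; move: nb; rewrite !inE; lia.
  rewrite !inE andbF => _; move: nb; rewrite !inE !negb_or.
  by move=> /and3P[/negbTE -> /negbTE -> /negbTE ->]; rewrite !andbF.
by rewrite !inE => /or3P[]/eqP -> /or3P[]/eqP ->.
Qed.

(** An edge lies in exactly two triangles, which form a rhombus; its diagonals bisect each other.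
    After translation to the origin this is a finite check over the six directions. *)
Lemma cadj_rhombus a b p r : a != b -> cadj a b -> p != r ->
  p != a -> p != b -> r != a -> r != b ->
  cadj p a -> cadj p b -> cadj r a -> cadj r b -> p + r = a + b.
Proof.
move=> ab ab' pr pa pb ra rb.
rewrite ![cadj _ a]cadjC ![cadj _ b]cadjC; move: ab'.
rewrite !cadj_dirs (negbTE pa) (negbTE pb) (negbTE ra) (negbTE rb) /=.
rewrite eq_sym (negbTE ab) /=.
have -> : p - b = (p - a) - (b - a) by rewrite opprB subrKA.
have -> : r - b = (r - a) - (b - a) by rewrite opprB subrKA.
have {}pr : p - a != r - a by rewrite (inj_eq (addIr _)).
suff : forall u x y : cox_vertex, u \in cdirs -> x \in cdirs -> x - u \in cdirs ->
    y \in cdirs -> y - u \in cdirs -> x != y -> x + y = u.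
  move=> H h1 h2 h3 h4 h5; have h := H _ _ _ h1 h2 h3 h4 h5 pr.
  by rewrite -(subrK a p) -(subrK a r) addrACA h addrA subrK addrC.
suff : all (fun u => all (fun x => all (fun y => (x - u \in cdirs) ==>
    (y - u \in cdirs) ==> (x != y) ==> (x + y == u)) cdirs) cdirs) cdirs.
  move=> /allP H u x y /H /allP H' /H' /allP H'' xu /H'' + yu xy.
  by rewrite xu yu xy => /eqP.
by vm_compute.
Qed.

Definition cmorph (f : cox_vertex -> cox_vertex) :=
  injective f /\ forall z w, cadj z w -> cadj (f z) (f w).

Lemma cmorph_rhombus f a b p r : cmorph f -> a != b -> cadj a b -> p != r ->
  p != a -> p != b -> r != a -> r != b ->
  cadj p a -> cadj p b -> cadj r a -> cadj r b -> f p + f r = f a + f b.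
Proof.
move=> [fi fa] *; apply: cadj_rhombus; rewrite ?(inj_eq fi) //; exact: fa.
Qed.

Lemma int_const_ind (T : Type) (g : int -> T) :
  (forall n, g (n + 1) = g n) -> forall n, g n = g 0.
Proof.
move=> gS; elim/int_ind => // n IH; first by rewrite -IH -[RHS]gS; congr g; lia.
by rewrite -IH -[LHS]gS; congr g; lia.
Qed.

Lemma int_arith_progression (U : zmodType) (h : int -> U) c :
  (forall n, h (n + 1) = h n + c) -> forall n, h n = h 0 + c *~ n.
Proof.
move=> hS n; apply/eqP; rewrite -subr_eq; apply/eqP.
rewrite (int_const_ind (g := fun n => h n - c *~ n)) ?mulr0z ?subr0 // => m.
by rewrite hS mulrzDr mulr1z opprD addrACA subrr addr0.
Qed.

Lemma addr_eq_subr (U : zmodType) (x y z t : U) : x + y = z + t -> t - x = y - z.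
Proof. move=> h; have -> : t = x + y - z by rewrite h addrC addKr.
by rewrite addrAC [x + y]addrC addrK. Qed.

(** A morphism carries rhombi to rhombi. The rhombus identities for the three directions of edges
    ([R1], [R2], [R3]) say that the first differences of [f] are constant. *)
Lemma cmorph_affine f : cmorph f -> exists u v : cox_vertex,
  forall z, f z = f 0 + u *~ z.1 + v *~ z.2.
Proof.
move=> fm.
have R1 a b : f (a + 1, b) + f (a, b + 1) = f (a, b) + f (a + 1, b + 1).
  by apply: (cmorph_rhombus fm); do [by rewrite /cadj /=; lia|by apply/eqP => -[]; lia].
have R2 a b : f (a + 1, b + 1) + f (a, b - 1) = f (a, b) + f (a + 1, b).
  by apply: (cmorph_rhombus fm); do [by rewrite /cadj /=; lia|by apply/eqP => -[]; lia].
have R3 a b : f (a + 1, b + 1) + f (a - 1, b) = f (a, b) + f (a, b + 1).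
  by apply: (cmorph_rhombus fm); do [by rewrite /cadj /=; lia|by apply/eqP => -[]; lia].
pose d1 a b := f (a + 1, b) - f (a, b); pose d2 a b := f (a, b + 1) - f (a, b).
have d2a a b : d2 (a + 1) b = d2 a b by exact: addr_eq_subr (R1 a b).
have d1b a b : d1 a (b + 1) = d1 a b.
  by apply: addr_eq_subr; rewrite addrC; exact: R1.
have d2b a b : d2 a (b + 1) = d2 a b.
  have := R2 a (b + 1); rewrite addrK => h.
  by rewrite -[LHS]d2a; apply: addr_eq_subr; rewrite addrC -h addrC.
have d1a a b : d1 (a + 1) b = d1 a b.
  have := R3 (a + 1) b; rewrite addrK => h.
  by rewrite -[LHS]d1b; apply: addr_eq_subr; rewrite addrC -h addrC.
have d1E a b : d1 a b = d1 0 0.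
  rewrite (int_const_ind (g := d1^~ b)) => [|n]; last exact: d1a.
  by rewrite (int_const_ind (g := d1 0)).
have d2E a b : d2 a b = d2 0 0.
  rewrite (int_const_ind (g := d2^~ b)) => [|n]; last exact: d2a.
  by rewrite (int_const_ind (g := d2 0)).
exists (d1 0 0), (d2 0 0) => -[a b] /=.
have fa1 x y : f (x + 1, y) = f (x, y) + d1 0 0 by rewrite -(d1E x y) subrKC.
have fb1 x y : f (x, y + 1) = f (x, y) + d2 0 0 by rewrite -(d2E x y) subrKC.
have Eb : f (a, b) = f (a, 0) + d2 0 0 *~ b.
  exact: (@int_arith_progression _ (fun b => f (a, b)) _ (fb1 a) b).
have Ea : f (a, 0) = f (0, 0) + d1 0 0 *~ a.
  exact: (@int_arith_progression _ (fun a => f (a, 0)) _ (fa1^~ 0) a).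
by rewrite Eb Ea.
Qed.

Lemma cmorph_step f : cmorph f -> exists u v : cox_vertex,
  [/\ forall z, f z = f 0 + u *~ z.1 + v *~ z.2,
      forall z, f (z + (1, 0)) = f z + u &
      forall z, f (z + (0, 1)) = f z + v].
Proof.
move=> /cmorph_affine[u [v fE]]; exists u, v; split=> // z.
  by rewrite [LHS]fE [f z]fE /= addr0 mulrzDr mulr1z !addrA [RHS]addrAC.
by rewrite [LHS]fE [f z]fE /= addr0 mulrzDr mulr1z !addrA.
Qed.

(** Rigidity: an affine map of the plane is determined by its values on one triangle. *)
Lemma cmorph_eq f g c : cmorph f -> cmorph g -> cox_chamber c ->
  (forall z, c z -> f z = g z) -> f =1 g.
Proof.
move=> /cmorph_step[u [v [fE fu fv]]] /cmorph_step[u' [v' [gE gu gv]]] [z cz] E.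
suff [Ez [E1 E2]] : f z = g z /\ u = u' /\ v = v'.
  move=> w; rewrite [LHS]fE [RHS]gE E1 E2; congr (_ + _ + _).
  by move: Ez; rewrite [LHS]fE [RHS]gE E1 E2 => /addIr/addIr.
have z11 : z + (1, 1) = z + (1, 0) + (0, 1).
  by rewrite -addrA; congr (_ + _); apply: pair_int_eq.
have z11' : z + (1, 1) = z + (0, 1) + (1, 0).
  by rewrite -addrA; congr (_ + _); apply: pair_int_eq.
case: cz => cE; rewrite cE in E.
  have h0 := E z (or_introl (or_introl erefl)).
  have := E _ (or_introl (or_intror erefl)); rewrite fu gu h0 => /addrI h1.
  have := E _ (or_intror erefl); rewrite z11 fv gv fu gu h0 h1 => /addrI h2.
  by [].
have h0 := E z (or_introl (or_introl erefl)).
have := E _ (or_introl (or_intror erefl)); rewrite fv gv h0 => /addrI h1.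
have := E _ (or_intror erefl); rewrite z11' fu gu fv gv h0 h1 => /addrI h2.
by [].
Qed.

Definition caut (f : cox_vertex -> cox_vertex) :=
  exists g, [/\ cancel f g, cancel g f & cmorph f /\ cmorph g].

Lemma caut_morph f : caut f -> cmorph f.
Proof. by move=> [g [_ _ []]]. Qed.

Lemma caut_comp f g : caut f -> caut g -> caut (f \o g).
Proof.
move=> [f' [fK f'K [[fi fa] [f'i f'a]]]] [g' [gK g'K [[gi ga] [g'i g'a]]]].
exists (g' \o f'); split; [exact: can_comp|exact: can_comp|split; split].
- exact: inj_comp.
- by move=> z w /ga /fa.
- exact: inj_comp.
- by move=> z w /f'a /g'a.
Qed.

Lemma cmorph_simplex f s : cmorph f -> cox_simplex s -> cox_simplex (f @` s).
Proof.
move=> [_ fa] /cox_simplexP[[z sz] sadj]; apply/cox_simplexP; split.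
  by exists (f z); exists z.
by move=> _ _ [u su <-] [v sv <-]; apply/fa/sadj.
Qed.

(** Negation reverses the direction [cstep] of every edge, whereas [crot], the rotation by 2pi/3,
    permutes e1, e2, -e1-e2 cyclically and so preserves it. *)
Definition cneg (z : cox_vertex) : cox_vertex := (- z.1, - z.2).
Definition crot (z : cox_vertex) : cox_vertex := (- z.2, z.1 - z.2).
Definition ctrans (t z : cox_vertex) : cox_vertex := (z.1 + t.1, z.2 + t.2).

Lemma caut_cneg : caut cneg.
Proof.
have K : cancel cneg cneg by move=> z; apply: pair_int_eq; rewrite /= opprK.
have m : cmorph cneg.
  by split; [exact: can_inj K|move=> z w; rewrite /cadj /=; lia].
by exists cneg.
Qed.

Lemma caut_crot : caut crot.
Proof.
exists (fun z : cox_vertex => (z.2 - z.1, - z.1)).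
have K1 : cancel crot (fun z : cox_vertex => (z.2 - z.1, - z.1)).
  by move=> z; apply: pair_int_eq => /=; lia.
have K2 : cancel (fun z : cox_vertex => (z.2 - z.1, - z.1)) crot.
  by move=> z; apply: pair_int_eq => /=; lia.
split=> //; split; split.
- exact: can_inj K1.
- by move=> z w; rewrite /cadj /=; lia.
- exact: can_inj K2.
- by move=> z w; rewrite /cadj /=; lia.
Qed.

Lemma caut_ctrans t : caut (ctrans t).
Proof.
have K u : cancel (ctrans u) (ctrans (- u)).
  by move=> z; apply: pair_int_eq => /=; rewrite addrK.
have m u : cmorph (ctrans u).
  by split; [exact: can_inj (K u)|move=> z w; rewrite /cadj /=; lia].
exists (ctrans (- t)); split=> //.
by rewrite -{2}(opprK t); exact: K.
Qed.

Lemma cmorph_id : cmorph id.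
Proof. by split. Qed.

(** Two rhombus identities for a fourth common neighbour would give 2a = 2d. *)
Lemma cadj4 a b d w : cadj a b -> cadj b d -> cadj a d ->
  a != b -> b != d -> a != d -> cadj a w -> cadj b w -> cadj d w ->
  [\/ w = a, w = b | w = d].
Proof.
move=> ab bd ad nab nbd nad aw bw dw.
have [->|nwa] := eqVneq w a; first by constructor.
have [->|nwb] := eqVneq w b; first by constructor.
have [->|nwd] := eqVneq w d; first by constructor.
have h1 : d + w = a + b.
  by apply: cadj_rhombus; rewrite // 1?eq_sym // cadjC.
have h2 : a + w = b + d.
  by apply: cadj_rhombus; rewrite // 1?eq_sym // cadjC.
case/eqP: nad; apply: pair_int_eq.
  by move: (congr1 fst h1) (congr1 fst h2) => /=; lia.
by move: (congr1 snd h1) (congr1 snd h2) => /=; lia.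
Qed.

(** The unit vectors along which z.1 + z.2 grows by 1 modulo 3: in an oriented chart these are the
    directed edges ([ochart_edge]). *)
Definition cstep (z w : cox_vertex) :=
  w - z \in [:: (1, 0); (0, 1); (-1, -1) : cox_vertex].

Lemma cstepP z w : cstep z w ->
  [\/ w.1 = z.1 + 1 /\ w.2 = z.2, w.1 = z.1 /\ w.2 = z.2 + 1
    | w.1 = z.1 - 1 /\ w.2 = z.2 - 1].
Proof.
rewrite /cstep !inE => /or3P[]/eqP h; move: (congr1 fst h) (congr1 snd h) => /=;
  [constructor 1|constructor 2|constructor 3]; lia.
Qed.

Lemma cstep_cadj z w : cstep z w -> cadj z w.
Proof. by case/cstepP; rewrite /cadj; lia. Qed.

(* A step changes each of these three linear forms by 1, 1 or -2, so their   *)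
(* maximum is at most the number of steps.                                   *)
Definition cdist (z w : cox_vertex) : int :=
  let a := w.1 - z.1 in let b := w.2 - z.2 in
  Num.max (a + b) (Num.max (b - 2 * a) (a - 2 * b)).

Lemma cdist_step z w x : cstep z w -> cdist z x <= cdist w x + 1.
Proof. by case/cstepP => -[]; rewrite /cdist => -> ->; lia. Qed.

Lemma cdist_refl z : cdist z z = 0.
Proof. rewrite /cdist; lia. Qed.

Lemma cdist_ge0 z w : 0 <= cdist z w.
Proof. rewrite /cdist; lia. Qed.

Lemma cdist_eq0 z w : cdist z w = 0 -> z = w.
Proof. by rewrite /cdist => ?; apply: pair_int_eq; lia. Qed.

Lemma cdist_descend z w (n : nat) : cdist z w = n.+1%:Z ->
  exists2 x, cstep z x & cdist x w = n%:Z.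
Proof.
move=> h.
have s1 : cstep z (z.1 + 1, z.2).
  by rewrite /cstep (_ : _ - _ = (1, 0)) ?inE //; apply: pair_int_eq => /=; lia.
have s2 : cstep z (z.1, z.2 + 1).
  by rewrite /cstep (_ : _ - _ = (0, 1)) ?inE //; apply: pair_int_eq => /=; lia.
have s3 : cstep z (z.1 - 1, z.2 - 1).
  by rewrite /cstep (_ : _ - _ = (-1, -1)) ?inE //; apply: pair_int_eq => /=; lia.
have : [\/ cdist (z.1 + 1, z.2) w = n%:Z, cdist (z.1, z.2 + 1) w = n%:Z
   | cdist (z.1 - 1, z.2 - 1) w = n%:Z].
  move: h; rewrite /cdist /=.
  have [h|h] := leP (w.1 - z.1 + (w.2 - z.2)) n%:Z; first by constructor 3; lia.
  have [h'|h'] := leP (w.2 - z.2 - 2 * (w.1 - z.1)) n%:Z; first by constructor 1; lia.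
  by constructor 2; lia.
by case=> E; [exists (z.1 + 1, z.2)|exists (z.1, z.2 + 1)|exists (z.1 - 1, z.2 - 1)].
Qed.

Definition clin (z e : cox_vertex) (n : nat) : cox_vertex :=
  (z.1 + n%:Z * e.1, z.2 + n%:Z * e.2).

Lemma clin0 z e : clin z e 0 = z.
Proof. by apply: pair_int_eq => /=; lia. Qed.

Lemma clinD z e m n : clin z e (m + n) = clin (clin z e m) e n.
Proof. by apply: pair_int_eq; rewrite /= PoszD mulrDl addrA. Qed.

Definition pdirs : seq cox_vertex := [:: (1, 0); (0, 1); (-1, -1)].

Lemma clin_step z e : e \in pdirs -> cstep z (clin z e 1).
Proof.
move=> ep; rewrite /cstep (_ : _ - z = e) //.
by apply: pair_int_eq => /=; lia.
Qed.

(** The three forms in [cdist] sum to 0, so the way back is at most twice as long as the way there.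
    Equality forces two forms to be n and the third to be -2n, which is a displacement along one of
    the [pdirs]. *)
Lemma cdist_line z w (n : nat) : cdist z w = n%:Z -> cdist w z = (n + n)%N%:Z ->
  exists2 e, e \in pdirs & w = clin z e n.
Proof.
rewrite /cdist => h1 h2.
have : [\/ w.1 - z.1 = n%:Z /\ w.2 - z.2 = 0, w.1 - z.1 = 0 /\ w.2 - z.2 = n%:Z
         | w.1 - z.1 = - n%:Z /\ w.2 - z.2 = - n%:Z].
  have [h|h] := leP (w.1 - z.1) (-1); first by constructor 3; lia.
  have [h'|h'] := leP (w.2 - z.2) 0; first by constructor 1; lia.
  by constructor 2; lia.
case=> -[E1 E2]; [exists (1, 0)|exists (0, 1)|exists (-1, -1)] => //;
  by apply: pair_int_eq => /=; lia.
Qed.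

Lemma cdist_clin z e n : e \in pdirs ->
  cdist z (clin z e n) = n%:Z /\ cdist (clin z e n) z = (n + n)%N%:Z.
Proof. by rewrite !inE => /or3P[]/eqP ->; rewrite /cdist /=; split; lia. Qed.

Lemma cstep_line z x e (n : nat) : e \in pdirs -> cstep z x ->
  cdist x (clin z e n.+1) <= n%:Z -> x = clin z e 1.
Proof.
rewrite !inE => /or3P[]/eqP -> /cstepP[] [E1 E2]; rewrite /cdist /= E1 E2 => h;
  apply: pair_int_eq => /=; lia.
Qed.

Lemma Z3_third (a b c : 'Z_3) : a <> b -> b <> c -> a <> c -> c = b + (b - a).
Proof.
move=> /eqP + /eqP + /eqP.
by case: a b c => [[|[|[|//]]] ?] [[|[|[|//]]] ?] [[|[|[|//]]] ?] //= _ _ _;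
  apply/val_inj.
Qed.

Lemma Z3_unit (s : 'Z_3) : s <> 0 -> s = 1 \/ s = -1.
Proof.
by case: s => [[|[|[|//]]] ?] h; [case: h|left|right]; apply/val_inj.
Qed.

(** * Charts, retractions and types *)

Section Building.
Variables (q : nat) (Delta : A2_building q).
Local Notation V := (vertex Delta).
Implicit Types (phi psi : cox_vertex -> V) (s t : set V) (u v x y : V).

Lemma simplex_sub s t : simplex s -> t `<=` s -> t !=set0 -> simplex t.
Proof. by have [_ _] := bld_complex Delta; apply. Qed.

Lemma simplex1 x : simplex [set x].
Proof. by have [] := bld_complex Delta. Qed.

Lemma simplex2C x y : simplex [set x; y] -> simplex [set y; x].
Proof. by move=> h; rewrite setUC. Qed.

Lemma simplex3_12 x y z : simplex [set x; y; z] -> simplex [set x; y].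
Proof. by move=> h; apply: simplex_sub h _ _; [move=> w [] ->; left; [left|right]|exists x; left]. Qed.

Lemma simplex3C x y z : simplex [set x; y; z] -> simplex [set y; z; x].
Proof. by move=> h; rewrite setUC setUA. Qed.

Lemma simplex3_23 x y z : simplex [set x; y; z] -> simplex [set y; z].
Proof. by move/simplex3C/simplex3_12. Qed.

Lemma simplex3_31 x y z : simplex [set x; y; z] -> simplex [set z; x].
Proof. by move/simplex3C/simplex3C/simplex3_12. Qed.

Definition schart (Sys : set (set (set V))) phi := exists2 A, Sys A & is_chart A phi.

Lemma chartP A phi s : is_chart A phi ->
  A s <-> exists2 c, cox_simplex c & phi @` c = s.
Proof. by move=> [_ ->]. Qed.

Lemma chart_comp A phi g : is_chart A phi -> caut g -> is_chart A (phi \o g).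
Proof.
move=> [phi_inj ->] [h [gK hK [gm hm]]]; split; first exact: inj_comp phi_inj (can_inj gK).
apply/seteqP; split=> [_ [c cc <-]|_ [c cc <-]].
  exists (h @` c); first exact: cmorph_simplex.
  rewrite image_comp; apply: eq_imagel => z _ /=; by rewrite hK.
by exists (g @` c); [exact: cmorph_simplex|rewrite image_comp].
Qed.

Lemma chart_caut A phi psi : is_chart A phi -> is_chart A psi ->
  exists2 g, caut g & forall z, psi z = phi (g z).
Proof.
have half phi' psi' : is_chart A phi' -> is_chart A psi' ->
    exists g, cmorph g /\ forall z, psi' z = phi' (g z).
  move=> ch1 ch2.
  have /choice[g gE] : forall z, exists w, psi' z = phi' w.
    move=> z.
    have /(chartP _ ch1)[c cc E] : A [set psi' z].
      by apply/(chartP _ ch2); exists [set z]; [exact: cox_simplex1|rewrite image_set1].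
    have : [set psi' z] (psi' z) by [].
    by rewrite -E => -[w cw <-]; exists w.
  exists g; split=> //; split.
    by move=> z w E; apply: (proj1 ch2); rewrite !gE E.
  move=> z w zw.
  have /(chartP _ ch1)[c /cox_simplexP[_ cc] E] : A [set psi' z; psi' w].
    apply/(chartP _ ch2); exists [set z; w]; first exact: cox_simplex2.
    by rewrite image_setU !image_set1.
  have : [set psi' z; psi' w] (psi' z) by left.
  have : [set psi' z; psi' w] (psi' w) by right.
  rewrite -E => -[b cb bE] [a ca aE].
  have <- : a = g z by apply: (proj1 ch1); rewrite -gE.
  have <- : b = g w by apply: (proj1 ch1); rewrite -gE.
  exact: cc.
move=> ch1 ch2; have [g [gm gE]] := half _ _ ch1 ch2.
have [h [hm hE]] := half _ _ ch2 ch1; exists g => //; exists h; split=> // z.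
  by apply: (proj1 ch2); rewrite -hE gE.
by apply: (proj1 ch1); rewrite -gE hE.
Qed.

Section System.
Variable Sys : set (set (set V)).
Hypothesis HS : apartment_system (@simplex q Delta) Sys.

Lemma schart_inj phi : schart Sys phi -> injective phi.
Proof. by move=> [A _ []]. Qed.

Lemma schart_simplex phi c : schart Sys phi -> cox_simplex c -> simplex (phi @` c).
Proof.
move=> [A SA ch] cc; have [/(_ _ SA)[As _] _ _] := HS.
by apply/As/(chartP _ ch); exists c.
Qed.

Lemma schart_simplex2 phi z w : schart Sys phi -> cadj z w -> simplex [set phi z; phi w].
Proof.
by move=> ch zw; have := schart_simplex ch (cox_simplex2 zw); rewrite image_setU !image_set1.
Qed.

Lemma schart_simplex3 phi (u v w : cox_vertex) : schart Sys phi -> cadj u v -> cadj v w -> cadj u w ->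
  simplex [set phi u; phi v; phi w].
Proof.
move=> ch uv vw uw; have := schart_simplex ch (cox_simplex3 uv vw uw).
by rewrite !image_setU !image_set1.
Qed.

Lemma schart_comp phi g : schart Sys phi -> caut g -> schart Sys (phi \o g).
Proof. by move=> [A SA ch] cg; exists A => //; apply: chart_comp. Qed.

Lemma schart_ex s t : simplex s -> simplex t -> exists phi c d,
  [/\ schart Sys phi, cox_simplex c, cox_simplex d, phi @` c = s & phi @` d = t].
Proof.
move=> ss st; have [H0 H1 _] := HS; have [A [SA As At]] := H1 _ _ ss st.
have [_ [phi ch]] := H0 _ SA.
have [c cc cE] := (chartP _ ch).1 As; have [d dd dE] := (chartP _ ch).1 At.
by exists phi, c, d; split=> //; exists A.
Qed.

Lemma schart_compat phi psi c d c' d' : schart Sys phi -> schart Sys psi ->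
  cox_simplex c -> cox_simplex d -> cox_simplex c' -> cox_simplex d' ->
  phi @` c = psi @` c' -> phi @` d = psi @` d' ->
  exists2 g, caut g & forall z, (c `|` d) z -> psi (g z) = phi z.
Proof.
move=> [A SA ch] [A' SA' ch'] cc cd cc' cd' E1 E2; have [_ _ H2] := HS.
have [||||theta [theta' [t1 t2 tE]]] := H2 A A' (phi @` c) (phi @` d) SA SA'.
- by apply/(chartP _ ch); exists c.
- by apply/(chartP _ ch); exists d.
- by apply/(chartP _ ch'); exists c'.
- by apply/(chartP _ ch'); exists d'.
have [a ca aE] := chart_caut ch t1; have [b cb bE] := chart_caut ch' t2.
have [a' [aK a'K [am a'm]]] := ca.
exists (b \o a'); first by apply: caut_comp => //; exists a.
move=> z cdz /=; rewrite -bE tE aE a'K //.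
by case: cdz => ?; [left|right]; exists z.
Qed.

Definition based_chart phi (c : set cox_vertex) psi :=
  schart Sys psi /\ forall z, c z -> psi z = phi z.

(* Charts that agree with phi on the chamber c are unique on each vertex, by *)
(* the rigidity of the triangular lattice.                                   *)
Lemma retraction phi c : schart Sys phi -> cox_chamber c ->
  exists rho : V -> cox_vertex,
    (forall psi, based_chart phi c psi -> cancel psi rho) /\
    (forall s, simplex s -> exists psi d,
       [/\ based_chart phi c psi, cox_simplex d & psi @` d = s]).
Proof.
move=> ch cc; have sc := cox_chamber_simplex cc.
have ex s : simplex s -> exists psi d,
       [/\ based_chart phi c psi, cox_simplex d & psi @` d = s].
  move=> ss; have [psi [c' [d [ch' cc' dd E1 E2]]]] := schart_ex (schart_simplex ch sc) ss.
  have [g cg gE] := schart_compat ch ch' sc sc cc' cc' (esym E1) (esym E1).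
  have [h [gK hK [gm hm]]] := cg.
  exists (psi \o g), (h @` d); split.
  - split; first exact: schart_comp.
    by move=> z cz /=; apply: gE; left.
  - exact: cmorph_simplex.
  - by rewrite -E2 image_comp; apply: eq_imagel => z _ /=; rewrite hK.
exists (fun v => xget 0 [set z | exists psi, based_chart phi c psi /\ psi z = v]).
split=> // psi bp z; case: xgetP => [w _ [psi' [bp' E]]|/(_ z)]; last first.
  by case; exists psi.
have cc1 := cox_simplex1.
have [||g cg gE] := schart_compat (proj1 bp) (proj1 bp') sc (cc1 z) sc (cc1 w).
- by apply: eq_imagel => u cu; rewrite (proj2 bp) // (proj2 bp').
- by rewrite !image_set1 E.
have gid : g =1 id.
  apply: (cmorph_eq (caut_morph cg) cmorph_id cc) => u cu /=.
  apply: (schart_inj (proj1 bp')); rewrite gE; last by left.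
  by rewrite (proj2 bp) // (proj2 bp').
apply: (schart_inj (proj1 bp')); rewrite E -[in RHS](gid z) gE //.
by right.
Qed.

Lemma simplex_card s x y z w : simplex s -> s x -> s y -> s z -> s w ->
  x <> y -> y <> z -> x <> z -> [\/ w = x, w = y | w = z].
Proof.
move=> ss sx sy sz sw xy yz xz.
have [phi [c [_ [ch /cox_simplexP[_ cc] _ cE _]]]] := schart_ex ss ss.
move: sx sy sz sw; rewrite -cE => -[a ca aE] [b cb bE] [d cd dE] [e ce eE].
move: xy yz xz; rewrite -aE -bE -dE -eE => xy yz xz.
case: (@cadj4 a b d e); rewrite ?cc //.
- by apply/eqP => E; apply: xy; rewrite E.
- by apply/eqP => E; apply: yz; rewrite E.
- by apply/eqP => E; apply: xz; rewrite E.
- by move=> ->; constructor 1.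
- by move=> ->; constructor 2.
- by move=> ->; constructor 3.
Qed.

Lemma simplex3_chamber x y z : simplex [set x; y; z] ->
  x <> y -> y <> z -> x <> z -> chamber [set x; y; z].
Proof.
move=> ss xy yz xz; split=> // s sss sub; apply/seteqP; split=> // w sw.
have [->|->|->] := simplex_card sss (sub x (or_introl (or_introl erefl)))
  (sub y (or_introl (or_intror erefl))) (sub z (or_intror erefl)) sw xy yz xz.
- by left; left.
- by left; right.
- by right.
Qed.

Lemma chamber_tau_inj c x y : chamber c -> c x -> c y -> tau x = tau y -> x = y.
Proof.
move=> /bld_type/(_ (tau x))[v [_ uv]] cx cy xy.
by rewrite -(uv x) // -(uv y).
Qed.

(** A chamber carries all three types, so the types around a triangle are in arithmetic progression
    ([Z3_third]). The two triangles on a common edge have the same type at their opposite corners,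
    hence the first differences of the type are constant. *)
Lemma schart_type phi : schart Sys phi -> exists2 s : 'Z_3, s = 1 \/ s = -1 &
  forall z, tau (phi z) = tau (phi 0) + s *~ z.1 + s *~ z.2.
Proof.
move=> ch; have pi := schart_inj ch; pose t z := tau (phi z).
have tri (u v w : cox_vertex) : cadj u v -> cadj v w -> cadj u w -> u != v -> v != w -> u != w ->
    t u <> t v /\ t w = t v + (t v - t u).
  move=> uv vw uw nuv nvw nuw.
  have cham : chamber [set phi u; phi v; phi w].
    apply: simplex3_chamber; first exact: schart_simplex3.
    - by move/pi/eqP; exact/negP.
    - by move/pi/eqP; exact/negP.
    - by move/pi/eqP; exact/negP.
  have d1 : t u <> t v.
    move=> /(chamber_tau_inj cham (or_introl (or_introl erefl)) (or_introl (or_intror erefl))).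
    by move/pi/eqP; exact/negP.
  split=> //; apply: Z3_third => //.
    move=> /(chamber_tau_inj cham (or_introl (or_intror erefl)) (or_intror erefl)).
    by move/pi/eqP; exact/negP.
  move=> /(chamber_tau_inj cham (or_introl (or_introl erefl)) (or_intror erefl)).
  by move/pi/eqP; exact/negP.
have up a b : t (a, b) <> t (a + 1, b) /\
    t (a + 1, b + 1) = t (a + 1, b) + (t (a + 1, b) - t (a, b)).
  by apply: tri; do [by rewrite /cadj /=; lia|by apply/eqP => -[]; lia].
have dn a b : t (a + 1, b + 1) = t (a, b + 1) + (t (a, b + 1) - t (a, b)).
  by apply: (proj2 (tri (a, b) (a, b + 1) (a + 1, b + 1) _ _ _ _ _ _)); do [by rewrite /cadj /=; lia|by apply/eqP => -[]; lia].
have Z3double (a b c : 'Z_3) : a + (a - c) = b + (b - c) -> a = b.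
  by rewrite !addrA => /addIr; case: a b {c} => [[|[|[|//]]] ?] [[|[|[|//]]] ?] h;
    apply/val_inj; move: h => /(congr1 val).
have e12 a b : t (a + 1, b) = t (a, b + 1).
  by apply: (Z3double _ _ (t (a, b))); rewrite -(proj2 (up a b)) -dn.
pose d a b := t (a + 1, b) - t (a, b).
have da a b : d (a + 1) b = d a b.
  by rewrite /d e12 (proj2 (up a b)) addrAC subrr add0r.
have db a b : d a (b + 1) = d a b.
  by rewrite /d (proj2 (up a b)) -(e12 a b) addrAC subrr add0r.
have dE a b : d a b = d 0 0.
  rewrite (int_const_ind (g := d^~ b)) => [|n]; last exact: da.
  by rewrite (int_const_ind (g := d 0)).
exists (d 0 0).
  apply: Z3_unit => /eqP; rewrite subr_eq0 => /eqP/esym; exact: (proj1 (up 0 0)).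
move=> [a b] /=.
have fa (x y : int) : t (x + 1, y) = t (x, y) + d 0 0 by rewrite -(dE x y) subrKC.
have fb (x y : int) : t (x, y + 1) = t (x, y) + d 0 0 by rewrite -e12 fa.
have Eb : t (a, b) = t (a, 0) + d 0 0 *~ b.
  exact: (@int_arith_progression _ (fun b => t (a, b)) _ (fb a) b).
have Ea : t (a, 0) = t (0, 0) + d 0 0 *~ a.
  exact: (@int_arith_progression _ (fun a => t (a, 0)) _ (fa^~ 0) a).
by rewrite -/(t (a, b)) Eb Ea.
Qed.

End System.
End Building.

Lemma intr_Z3_eq1 (a b : int) : -1 <= a <= 1 -> -1 <= b <= 1 -> -1 <= a - b <= 1 ->
  (a%:~R + b%:~R : 'Z_3) = 1 -> (a, b) \in pdirs.
Proof.
move=> h1 h2 h3.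
have : a \in [:: -1; 0; 1] by rewrite !inE; lia.
have : b \in [:: -1; 0; 1] by rewrite !inE; lia.
by rewrite !inE => /or3P[]/eqP ? /or3P[]/eqP ?; subst a b.
Qed.

Lemma zmod_sub2 (U : zmodType) (t a b c d e : U) :
  t + a + b = t + c + d + e -> (a - c) + (b - d) = e.
Proof.
move=> h; have {}h : a + b = c + (d + e) by move: h; rewrite -!addrA => /addrI.
have -> : a = c + (d + e) - b by rewrite -h addrK.
have -> : c + (d + e) - b - c = d + e - b by rewrite addrAC [c + _]addrC addrK.
by rewrite subrKA addrAC subrr add0r.
Qed.

(** * Directed length and straight paths *)

Section Walks.
Variables (q : nat) (Delta : A2_building q).
Local Notation V := (vertex Delta).
Implicit Types (u v x y : V).

Fixpoint dwalk (n : nat) u v : Prop :=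
  if n is m.+1 then exists2 w, directed_edge u w & dwalk m w v else u = v.

Lemma dwalk_cat m n u v w : dwalk m u v -> dwalk n v w -> dwalk (m + n) u w.
Proof.
elim: m u => [|m IH] u /=; first by move=> ->.
by move=> [x ux xv] vw; exists x => //; apply: IH.
Qed.

Lemma dwalk1 u v : directed_edge u v -> dwalk 1 u v.
Proof. by move=> uv; exists v. Qed.

Lemma dwalk_tau n u v : dwalk n u v -> tau v = tau u + n%:R.
Proof.
elim: n u => [|n IH] u /=; first by move=> ->; rewrite addr0.
by move=> [w [_ tw] /IH ->]; rewrite tw -addrA -[1]/(1%:R) -natrD.
Qed.

Lemma dwalk_path n (p : nat -> V) i m : (i + m <= n)%N ->
  (forall j, (j < n)%N -> directed_edge (p j) (p j.+1)) -> dwalk m (p i) (p (i + m)%N).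
Proof.
move=> + E; elim: m i => [|m IH] i /=; first by rewrite addn0.
move=> h; exists (p i.+1); first by apply: E; lia.
by rewrite -addSnnS; apply: IH; rewrite addSnnS.
Qed.

Definition oriented (phi : cox_vertex -> V) :=
  forall z, tau (phi z) = tau (phi 0) + z.1%:~R + z.2%:~R.

Definition ochart Sys phi := schart Sys phi /\ oriented phi.

Section System.
Variable Sys : set (set (set V)).
Hypothesis HS : apartment_system (@simplex q Delta) Sys.

Lemma schart_orient phi : schart Sys phi ->
  ochart Sys phi \/ ochart Sys (phi \o cneg).
Proof.
move=> ch; have [s [->|->] tE] := schart_type HS ch; [left|right]; split=> //.
  exact: schart_comp ch caut_cneg.
have p0 : cneg 0 = 0 by [].
by move=> z; rewrite /= p0 tE /= !mulrNz !mulNrz !opprK.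
Qed.

(** Apartments are full subcomplexes: a based chart carries the edge, and its lattice preimage is
    computed by the retraction, which inverts [phi]. *)
Lemma schart_full phi z w : schart Sys phi -> simplex [set phi z; phi w] -> cadj z w.
Proof.
move=> ch szw; have [c cc cz] : exists2 c, cox_chamber c & c z.
  by have [_ [c cc sub]] := cox_simplex1 z; exists c => //; apply: sub.
have [rho [r1 r2]] := retraction HS ch cc.
have [psi [d [bp /cox_simplexP[_ dd] E]]] := r2 _ szw.
have pb : based_chart Sys phi c phi by [].
have : [set phi z; phi w] (phi z) by left.
have : [set phi z; phi w] (phi w) by right.
rewrite -E => -[b db bE] [a da aE].
have -> : w = b by rewrite -(r1 _ bp b) bE r1.
have -> : z = a by rewrite -(r1 _ bp a) aE r1.
exact: dd.
Qed.

Lemma chamber_edge c : cox_chamber c ->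
  exists z w, [/\ c z, c w & w = z + (1, 0) \/ w = z + (0, 1)].
Proof.
move=> [z [] ->]; first exists z, (z + (1, 0)).
  by split; [left; left|left; right|left].
by exists z, (z + (0, 1)); split; [left; left|left; right|right].
Qed.

Lemma based_oriented phi c psi : ochart Sys phi -> cox_chamber c ->
  based_chart Sys phi c psi ->
  forall z, tau (psi z) = tau (phi 0) + z.1%:~R + z.2%:~R.
Proof.
move=> [ch po] /chamber_edge[z [w [cz cw wE]]] [ch' E].
have [s _ tE] := schart_type HS ch'.
have s1 : s = 1.
  have h0 := E _ cz; have h1 := E _ cw.
  move: (tE z) (tE w); rewrite h0 h1 (po z) (po w) => e0 e1.
  have : tau (phi 0) + w.1%:~R + w.2%:~R = tau (phi 0) + z.1%:~R + z.2%:~R + 1.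
    by case: wE => -> /=; rewrite addr0 intrD addrA // [LHS]addrAC.
  rewrite e1 e0; case: wE => -> /=; rewrite addr0 mulrzDr mulr1z !addrA.
    by rewrite [LHS]addrAC => /addrI.
  by move=> /addrI.
move: (tE z); rewrite (E _ cz) po s1 => /addIr/addIr e0 x.
by rewrite tE s1 -e0.
Qed.

(** The folding in the form used below: it respects directed edges, hence does not lengthen directed
    walks, and a vertex folded into [c] is already in the chart. Based charts inherit the
    orientation of [phi] because they share an edge of [c] with it. *)
Lemma ochart_retraction phi c : ochart Sys phi -> cox_chamber c ->
  exists rho : V -> cox_vertex,
    [/\ cancel phi rho,
        (forall v, c (rho v) -> v = phi (rho v)) &
        (forall u v, directed_edge u v -> cstep (rho u) (rho v))].
Proof.
move=> och cc; have [ch po] := och; have [rho [r1 r2]] := retraction HS ch cc.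
have pb : based_chart Sys phi c phi by [].
exists rho; split; first exact: r1.
  move=> v; have [psi [d [bp _ E]]] := r2 _ (simplex1 v).
  have : [set v] v by []; rewrite -E => -[z _ <-]; rewrite r1 // => cz.
  exact: (proj2 bp).
move=> u v [suv tuv]; have [psi [d [bp /cox_simplexP[_ dd] E]]] := r2 _ suv.
have : [set u; v] u by left.
have : [set u; v] v by right.
rewrite -E => -[b db bE] [a da aE]; move: tuv; rewrite -bE -aE !r1 //.
rewrite !(based_oriented och cc bp) => tab.
have := dd _ _ da db; rewrite /cadj => /and3P[h1 h2 h3].
rewrite /cstep (_ : b - a = (b.1 - a.1, b.2 - a.2)) //; apply: intr_Z3_eq1 => //.
by rewrite !intrB; apply: zmod_sub2 tab.
Qed.

Lemma cox_chamber_ex z w : cadj z w -> exists c, [/\ cox_chamber c, c z & c w].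
Proof.
move=> /cox_simplex2[_ [c cc sub]]; exists c.
by split=> //; apply: sub; [left|right].
Qed.

Lemma ochart_edge phi z w : ochart Sys phi ->
  directed_edge (phi z) (phi w) <-> cstep z w.
Proof.
move=> och; split=> [zw|zw].
  have [c [cc _ _]] := cox_chamber_ex (cadj_refl z).
  by have [rho [r1 _ r3]] := ochart_retraction och cc; rewrite -(r1 z) -(r1 w); exact: r3.
have [ch po] := och; split; first exact: (schart_simplex2 HS ch (cstep_cadj zw)).
rewrite (po w) (po z); case/cstepP: zw => -[-> ->].
- by rewrite intrD addrA [RHS]addrAC.
- by rewrite intrD !addrA.
- have E : (1 : 'Z_3) = - 1 - 1 by apply/val_inj.
  by rewrite !intrB [X in _ = _ + X]E !addrA; congr (_ - _); exact: addrAC.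
Qed.

Lemma cdist_dwalk (rho : V -> cox_vertex) n u v :
  (forall x y, directed_edge x y -> cstep (rho x) (rho y)) ->
  dwalk n u v -> cdist (rho u) (rho v) <= n%:Z.
Proof.
move=> r3; elim: n u => [|n IH] u /=; first by move=> ->; rewrite cdist_refl.
move=> [x /r3 ux /IH xw]; have := cdist_step (rho v) ux; lia.
Qed.

Lemma ochart_dwalk_ge phi z w n : ochart Sys phi -> dwalk n (phi z) (phi w) ->
  cdist z w <= n%:Z.
Proof.
move=> och; have [c [cc _ _]] := cox_chamber_ex (cadj_refl z).
have [rho [r1 _ r3]] := ochart_retraction och cc.
by rewrite -{2}(r1 z) -{2}(r1 w); exact: cdist_dwalk.
Qed.

Lemma ochart_dwalk phi z w n : ochart Sys phi -> cdist z w = n%:Z ->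
  dwalk n (phi z) (phi w).
Proof.
move=> och; elim: n z => [|n IH] z /=; first by move/cdist_eq0 ->.
move=> /cdist_descend[x zx xw]; exists (phi x); last exact: IH.
exact/ochart_edge.
Qed.

Lemma ochart_ex s t : simplex s -> simplex t -> exists phi c d,
  [/\ ochart Sys phi, cox_simplex c, cox_simplex d, phi @` c = s & phi @` d = t].
Proof.
move=> ss st; have [phi [c [d [ch cc dd E1 E2]]]] := schart_ex HS ss st.
have [och|och] := schart_orient ch; first by exists phi, c, d.
have cnegK : cancel cneg cneg by move=> z; apply: pair_int_eq; rewrite /= opprK.
exists (phi \o cneg), (cneg @` c), (cneg @` d); split=> //.
- exact: cmorph_simplex (caut_morph caut_cneg) cc.
- exact: cmorph_simplex (caut_morph caut_cneg) dd.
- by rewrite -E1 image_comp; apply: eq_imagel => z _ /=; rewrite cnegK.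
- by rewrite -E2 image_comp; apply: eq_imagel => z _ /=; rewrite cnegK.
Qed.

End System.

Lemma dwalk_ex u v : exists n, `[< dwalk n u v >].
Proof.
have [Sys HS] := bld_apartments Delta.
have [phi [c [d [och _ _ cE dE]]]] := ochart_ex HS (simplex1 u) (simplex1 v).
have : [set u] u by []; rewrite -cE => -[z _ <-].
have : [set v] v by []; rewrite -dE => -[w _ <-].
exists `|cdist z w|%N; apply/asboolP/(ochart_dwalk HS) => //.
by rewrite gez0_abs // cdist_ge0.
Qed.

Definition dlen u v : nat := ex_minn (dwalk_ex u v).

Lemma dlen_walk u v : dwalk (dlen u v) u v.
Proof. by rewrite /dlen; case: ex_minnP => n /asboolP. Qed.

Lemma dlen_min u v n : dwalk n u v -> (dlen u v <= n)%N.
Proof. by move=> h; rewrite /dlen; case: ex_minnP => m _; apply; apply/asboolP. Qed.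

Lemma dlen_tri u v w : (dlen u w <= dlen u v + dlen v w)%N.
Proof. exact: dlen_min (dwalk_cat (dlen_walk u v) (dlen_walk v w)). Qed.

Lemma dlen0 u : dlen u u = 0%N.
Proof. by apply/eqP; rewrite -leqn0; apply: dlen_min. Qed.

Lemma dlen_edge u v : directed_edge u v -> (dlen u v <= 1)%N.
Proof. by move=> /dwalk1/dlen_min. Qed.

Lemma dlen_tau u v : tau v = tau u + (dlen u v)%:R.
Proof. exact: dwalk_tau (dlen_walk u v). Qed.

Section System2.
Variable Sys : set (set (set V)).
Hypothesis HS : apartment_system (@simplex q Delta) Sys.

(** Walks leaving the apartment fold back into it, so they are not shorter than those inside. *)
Lemma dlen_ochart phi z w : ochart Sys phi -> (dlen (phi z) (phi w))%:Z = cdist z w.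
Proof.
move=> och; apply/eqP; rewrite eq_le; apply/andP; split.
  have := cdist_ge0 z w; case E : (cdist z w) => [n|//] _.
  by rewrite lez_nat; apply/dlen_min/(ochart_dwalk HS och).
exact: (ochart_dwalk_ge HS och (dlen_walk _ _)).
Qed.

(* Fold onto the chart along a chamber containing its first edge z, z + e: a *)
(* shortest path must fold onto the line, and vertices of that chamber have  *)
(* no other preimage.                                                        *)
Lemma path_line phi n (x : nat -> V) z e : ochart Sys phi -> e \in pdirs ->
  (forall i, (i < n)%N -> directed_edge (x i) (x i.+1)) ->
  x 0%N = phi z -> x n = phi (clin z e n) ->
  forall i, (i <= n)%N -> x i = phi (clin z e i).
Proof.
move=> och ep; elim: n x z => [|n IH] x z xE x0 xn i.
  by rewrite leqn0 => /eqP ->.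
have [c [cc cz cz1]] := cox_chamber_ex (cstep_cadj (clin_step z ep)).
have [rho [r1 r2 r3]] := ochart_retraction HS och cc.
have x1 : x 1%N = phi (clin z e 1).
  have s1 : cstep z (rho (x 1%N)) by rewrite -(r1 z) -x0; apply/r3/xE.
  have E : rho (x 1%N) = clin z e 1.
    apply: (cstep_line ep s1 (n := n)); rewrite -(r1 (clin z e n.+1)) -xn.
    have : dwalk n (x 1%N) (x n.+1).
      by rewrite -(add1n n); apply: (dwalk_path (n := n.+1)); rewrite ?add1n.
    exact: cdist_dwalk.
  by rewrite -E; apply: r2; rewrite E.
case: i => [|i]; first by rewrite clin0.
rewrite ltnS => ilen; rewrite -add1n clinD.
apply: (IH (fun i => x i.+1) (clin z e 1)) => //.
  by move=> j jn; apply: xE.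
by rewrite xn -add1n clinD.
Qed.

End System2.

(** A path of directed edges is straight at a vertex when its predecessor and successor are opposite
    in the link of that vertex, that is, a line and a point that are not incident. *)
Definition spath n (x : nat -> V) :=
  (forall i, (i < n)%N -> directed_edge (x i) (x i.+1)) /\
  (forall i, (i.+1 < n)%N -> ~ simplex [set x i; x i.+1; x i.+2]).

Lemma spath_shift n k (x : nat -> V) : spath (k + n) x -> spath n (fun i => x (k + i)%N).
Proof.
move=> [h1 h2]; split=> i ni /=; rewrite !addnS; first by apply: h1; lia.
by apply: h2; lia.
Qed.

(* A chart through the two ends of a local geodesic contains all of it; the  *)
(* induction step looks at a chart through the first edge and the last       *)
(* vertex.                                                                   *)
Lemma spath_dlen n (x : nat -> V) : spath n x ->
  dlen (x 0%N) (x n) = n /\ dlen (x n) (x 0%N) = (n + n)%N.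
Proof.
have [Sys HS] := bld_apartments Delta.
elim: n x => [|n IH] x sx; first by rewrite dlen0.
have [E1 E2] : dlen (x 1%N) (x n.+1) = n /\ dlen (x n.+1) (x 1%N) = (n + n)%N.
  exact: IH _ (@spath_shift n 1 x sx).
have [h1 h2] := sx; have e01 := h1 0%N isT; have [s01 _] := e01.
have [phi [c [d [och _ _ cE dE]]]] := ochart_ex HS s01 (simplex1 (x n.+1)).
have : [set x 0%N; x 1%N] (x 0%N) by left.
rewrite -cE => -[z0 _ z0E].
have : [set x 0%N; x 1%N] (x 1%N) by right.
rewrite -cE => -[z1 _ z1E].
have : [set x n.+1] (x n.+1) by []; rewrite -dE => -[w _ wE].
move: E1 E2; rewrite -wE -z1E => /(congr1 Posz) + /(congr1 Posz).
rewrite !(dlen_ochart HS) // => E1 E2.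
have [e ep wl] := cdist_line E1 E2.
have xl : forall i, (i <= n)%N -> x i.+1 = phi (clin z1 e i).
  apply: (path_line HS och ep (x := fun i => x i.+1)) => //.
    by move=> i ni; apply: h1.
  by rewrite -wE wl.
have s0 : cstep z0 z1 by apply/(ochart_edge HS _ _ och); rewrite z0E z1E.
have [n0|n0] := posnP n.
  have wz1 : w = z1 by rewrite wl n0 clin0.
  have : forall w z, cstep w z -> cdist w z = 1 /\ cdist z w = 2.
    by move=> a b /cstepP[] [] ; rewrite /cdist => -> ->; split; lia.
  move=> /(_ _ _ s0) [c1 c2].
  by rewrite -z0E n0; split; apply/eqP; rewrite -eqz_nat (dlen_ochart HS) // wz1 ?c1 ?c2.
(* If the first step had a direction d other than [e], then d + e would be minus the third of the
   [pdirs], so [x 0], [x 1], [x 2] would span a chamber of the chart. *)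
have E0 : z1 = clin z0 e 1.
  have x2 := xl 1%N n0.
  apply: contrapT => nE; apply: (h2 0%N n0); rewrite x2 -z0E -z1E.
  apply: (schart_simplex3 HS (proj1 och)); [exact: cstep_cadj|exact: cstep_cadj (clin_step _ ep)|].
  move: ep nE; rewrite !inE; case/cstepP: s0 => -[a1 a2] /or3P[]/eqP -> nE;
    rewrite /cadj /= a1 a2; first [lia|case: nE; apply: pair_int_eq => /=; lia].
have wl' : w = clin z0 e n.+1 by rewrite wl E0 -clinD add1n.
have [c1 c2] := cdist_clin z0 n.+1 ep.
by rewrite -z0E; split; apply/eqP; rewrite -eqz_nat (dlen_ochart HS) // wl' ?c1 ?c2.
Qed.

Lemma spath_chart Sys phi n (x : nat -> V) i k z w : apartment_system (@simplex q Delta) Sys ->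
  ochart Sys phi -> spath n x -> (i <= k <= n)%N ->
  phi z = x i -> phi w = x k ->
  exists2 e, e \in pdirs & forall m, (i <= m <= k)%N -> x m = phi (clin z e (m - i)).
Proof.
move=> HS och sx /andP[ik kn] zE wE.
have sx' : spath (k - i) (fun j => x (i + j)%N).
  by apply: spath_shift; split=> j jn; apply sx; lia.
have [] := spath_dlen sx'; rewrite addn0 subnKC // -zE -wE.
move=> /(congr1 Posz) + /(congr1 Posz); rewrite !(dlen_ochart HS) // => E1 E2.
have [e ep wl] := cdist_line E1 E2; exists e => // m /andP[im mk].
rewrite -{1}(subnKC im); have [h1 _] := sx'.
apply: (path_line HS och ep h1); rewrite ?addn0 ?subnKC // -?wE ?wl //.
exact: leq_sub2r.
Qed.

End Walks.

Lemma nonincreasing_eventually_const (h : nat -> nat) :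
  (forall n, (h n.+1 <= h n)%N) -> exists N, forall n, (N <= n)%N -> h n = h N.
Proof.
move=> hS; have ex : exists m, `[< exists n, h n = m >].
  by exists (h 0%N); apply/asboolP; exists 0%N.
have [m /asboolP[N <-] mP] := ex_minnP ex; exists N => n Nn.
apply/eqP; rewrite eqn_leq; apply/andP; split; last by apply/mP/asboolP; exists n.
by rewrite -(subnKC Nn); elim: (n - N)%N => [|k IH]; rewrite ?addn0 // addnS; apply: leq_trans IH.
Qed.

Lemma Z3_tri (a b c : 'Z_3) : b = a + 1 -> a = c + 1 -> c = b + 1.
Proof.
by move=> -> ->; rewrite -!addrA -[LHS]addr0; congr (_ + _); apply/val_inj.
Qed.

Lemma sval_eq (T : Type) (P : T -> Prop) (a b : {x | P x}) : sval a = sval b -> a = b.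
Proof.
by case: a b => [x px] [y py] /= E; subst y; congr exist; exact: Prop_irrelevance.
Qed.

(** * Links and horofunctions *)

Section Links.
Variables (q : nat) (Delta : A2_building q).
Local Notation V := (vertex Delta).
Implicit Types (u v x y z : V) (w : nat -> V).

Lemma simplex3_swap x y z : simplex [set x; y; z] -> simplex [set y; x; z].
Proof. by move=> h; rewrite (setUC [set y]). Qed.

Lemma tri_edge x y z : directed_edge x y -> directed_edge z x ->
  simplex [set x; y; z] -> directed_edge y z.
Proof.
move=> [_ txy] [_ tzx] s; split; first exact: simplex3_23 s.
exact: Z3_tri txy tzx.
Qed.

Lemma link_line x y y' : directed_edge x y -> directed_edge x y' -> y <> y' ->
  exists z, [/\ directed_edge z x, simplex [set x; y; z] & simplex [set x; y'; z]].
Proof.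
move=> xy xy' ne; have [/(_ (exist _ y xy) (exist _ y' xy')) H _ _ _] := bld_link x.
have [|[z zx] [[h1 h2] _]] := H; first by move=> /(congr1 sval).
by exists z.
Qed.

Lemma link_line_uniq x y y' z z' : directed_edge x y -> directed_edge x y' ->
  y <> y' -> directed_edge z x -> directed_edge z' x ->
  simplex [set x; y; z] -> simplex [set x; y'; z] ->
  simplex [set x; y; z'] -> simplex [set x; y'; z'] -> z = z'.
Proof.
move=> xy xy' ne zx zx' h1 h2 h3 h4.
have [/(_ (exist _ y xy) (exist _ y' xy')) H _ _ _] := bld_link x.
have [|[t tx] [_ tu]] := H; first by move=> /(congr1 sval).
have := tu (exist _ z zx) (conj h1 h2); have := tu (exist _ z' zx') (conj h3 h4).
by move=> /(congr1 sval) /= <- /(congr1 sval) /= <-.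
Qed.

Lemma edge_triangle x y : directed_edge x y ->
  exists z, directed_edge z x /\ simplex [set x; y; z].
Proof.
move=> xy; have [_ _ [p pi _] _] := bld_link x.
have [i ne] : exists i, sval (p i) <> y.
  have [E|] := pselect (sval (p ord0) = y); last by exists ord0.
  exists (inord 1) => E'; have : p ord0 = p (inord 1).
    by apply: sval_eq; rewrite E E'.
  by move/pi/(congr1 val); rewrite /= inordK.
have [z [zx h _]] := link_line xy (svalP (p i)) (not_eq_sym ne).
by exists z.
Qed.

Lemma dlen_edge_rev u v : directed_edge u v -> (dlen v u <= 2)%N.
Proof.
move=> uv; have [z [zu s]] := edge_triangle uv.
apply: dlen_min; exists z; last by exists u.
exact: tri_edge uv zu s.
Qed.

Lemma dlen_rev u v : (dlen v u <= 2 * dlen u v)%N.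
Proof.
suff H n : forall x, dwalk n x v -> (dlen v x <= 2 * n)%N by apply/H/dlen_walk.
elim: n => [|n IH] {}u /=; first by move=> ->; rewrite dlen0.
move=> [x /dlen_edge_rev ux /IH xv]; have := dlen_tri v x u; lia.
Qed.

Definition sray w := (forall i, directed_edge (w i) (w i.+1)) /\
  (forall i, ~ simplex [set w i; w i.+1; w i.+2]).

Lemma sray_spath w n : sray w -> spath n w.
Proof. by move=> [h1 h2]; split=> i _; [exact: h1|exact: h2]. Qed.

Lemma sray_shift w k : sray w -> sray (fun i => w (k + i)%N).
Proof. by move=> [h1 h2]; split=> i; rewrite !addnS; [exact: h1|exact: h2]. Qed.

Lemma sray_dlen w i j : sray w -> (i <= j)%N ->
  dlen (w i) (w j) = (j - i)%N /\ dlen (w j) (w i) = (2 * (j - i))%N.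
Proof.
move=> sw ij; have := spath_dlen (sray_spath (j - i) (sray_shift i sw)).
by rewrite addn0 subnKC // mul2n addnn.
Qed.

Lemma sray_inj w : sray w -> injective w.
Proof.
move=> sw i j E; wlog ij : i j E / (i <= j)%N.
  by move=> H; have [/H->//|/ltnW/H->//] := leqP i j.
by have [+ _] := sray_dlen sw ij; rewrite E dlen0 => h; lia.
Qed.

(* Up to an additive constant, the Busemann function of w for the directed   *)
(* length.                                                                   *)
Definition blim w (b : V -> int) := forall x, exists N, forall n, (N <= n)%N ->
  (dlen (w n) x)%:Z - (2 * n)%N%:Z = b x.

(** Going back along an edge of [w] costs at most 2, so the sequence does not increase; going back
    from [w n] to [w 0] costs exactly 2n, so it is bounded below. The summand [dlen x (w 0)] in [h]
    keeps the natural subtraction exact. *)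
Lemma blim_ex w : sray w -> exists b, blim w b.
Proof.
move=> sw; suff /choice[b bP] : forall x, exists c : int, exists N, forall n,
    (N <= n)%N -> (dlen (w n) x)%:Z - (2 * n)%N%:Z = c by exists b.
move=> x.
pose h n := (dlen (w n) x + dlen x (w 0%N) - 2 * n)%N.
have h2 n : (2 * n <= dlen (w n) x + dlen x (w 0%N))%N.
  have [_ ] := sray_dlen sw (leq0n n); rewrite subn0 => <-; exact: dlen_tri.
have [|N hN] := @nonincreasing_eventually_const h.
  move=> n; have := dlen_tri (w n.+1) (w n) x.
  have := dlen_edge_rev (proj1 sw n); have := h2 n; have := h2 n.+1; rewrite /h; lia.
exists ((h N)%:Z - (dlen x (w 0%N))%:Z), N => n /hN <-.
have := h2 n; rewrite /h; lia.
Qed.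

Lemma line_step (w0 w1 w2 : V) y : directed_edge w0 w1 -> directed_edge w1 w2 ->
  ~ simplex [set w0; w1; w2] -> directed_edge w0 y -> y <> w1 ->
  exists y', [/\ directed_edge w1 y', directed_edge y y', directed_edge y' w0,
    simplex [set w0; y; y'] & simplex [set w0; w1; y']] /\ y' <> w2.
Proof.
move=> e01 e12 ns e0y ne; have [z [zw s1 s2]] := link_line e0y e01 ne.
exists z; split; first split=> //.
- exact: tri_edge e01 zw s2.
- exact: tri_edge e0y zw s1.
- by move=> E; apply: ns; rewrite -E.
Qed.

(* In the link of w i, the vertex w' i.+1 is the line through the points     *)
(* w' i and w i.+1.                                                          *)
Definition flanks w (w' : nat -> V) := forall i,
    [/\ directed_edge (w i) (w' i), directed_edge (w' i) (w' i.+1),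
        directed_edge (w' i.+1) (w i), simplex [set w i; w' i; w' i.+1] &
        simplex [set w i; w i.+1; w' i.+1]] /\ w' i <> w i.+1.

Lemma line_sequence w y : sray w -> directed_edge (w 0%N) y -> y <> w 1%N ->
  exists2 w', w' 0%N = y & flanks w w'.
Proof.
move=> [e ns] ey ne; pose inv i u := directed_edge (w i) u /\ u <> w i.+1.
pose rel (p : nat * V) u' := inv p.1 p.2 -> [/\ inv p.1.+1 u',
  directed_edge p.2 u', directed_edge u' (w p.1), simplex [set w p.1; p.2; u'] &
  simplex [set w p.1; w p.1.+1; u']].
have /choice[f fP] : forall p, exists u', rel p u'.
  move=> [i u]; have [[iu1 iu2]|ninv] := pselect (inv i u); last by exists y.
  have [u' [[h1 h2 h3 h4 h5] h6]] := line_step (e i) (e i.+1) (ns i) iu1 iu2.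
  by exists u'; move=> _; split.
pose w' := fix g n := if n is m.+1 then f (m, g m) else y.
have w'inv n : inv n (w' n).
  by elim: n => [//|n IH]; have [] := fP (n, w' n) IH.
exists w' => // i; have [iu1 iu2] := w'inv i.
by have [_ h1 h2 h3 h4] := fP (i, w' i) (w'inv i).
Qed.

(* If w' i and w' i.+2 were incident in the link of w' i.+1, then w i and    *)
(* w' i.+2 would both be the intersection of the lines w' i and w i.+1.      *)
Lemma flanks_sray w w' : sray w -> flanks w w' -> sray w'.
Proof.
move=> sw w'P; split=> i; first by have [[_ h _ _ _] _] := w'P i.
move=> s; have [[a1 a2 a3 a4 a5] a6] := w'P i; have [[b1 b2 b3 b4 b5] b6] := w'P i.+1.
have [[c1 c2 c3 c4 c5] c6] := w'P i.+2.
have [E|nE] := pselect (w i = w' i.+2).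
  by apply: (proj2 sw i); move: b5; rewrite -E => /simplex3C/simplex3C.
apply: a6; apply: (@link_line_uniq (w' i.+1) (w i) (w' i.+2)) => //.
+ exact/simplex3C/simplex3C/simplex3_swap/simplex3_swap.
+ exact/simplex3C.
+ exact/simplex3C/simplex3C.
+ exact/simplex3C.
Qed.

(** A straight ray can be restarted at any successor [y] of its origin with the same end: it is its
    own tail if [y] lies on it, and otherwise the sequence that flanks it. The last clause, a
    triangle on the edge from [w 0] to [y], serves in [blim_horo]. *)
Lemma transport w y : sray w -> directed_edge (w 0%N) y ->
  exists w', [/\ sray w', w' 0%N = y,
    (exists c, forall b, blim w b -> blim w' (fun x => b x + c)),
    (exists K, forall i, (dlen (w i) (w' i) <= K)%N) &
    (y <> w 1%N -> simplex [set w 0%N; y; w' 1%N] /\ directed_edge (w' 1%N) (w 0%N))].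
Proof.
move=> sw ey; have [->|ne] := pselect (y = w 1%N).
  exists (fun i => w (1 + i)%N); split=> //; first exact: sray_shift.
    exists 2 => b bw x; have [N NP] := bw x; exists N => n Nn.
    by rewrite -(NP (1 + n)%N); lia.
  by exists 1%N => i; apply/dlen_edge; apply sw.
have [w' w'0 w'P] := line_sequence sw ey ne; exists w'; split=> //.
- exact: flanks_sray sw w'P.
(* The edges from [w n.+1] to [w' n.+1] and from [w' n.+1] to [w n] bound the length from [w' n.+1]
   on both sides, with the same limit. *)
- exists (-1) => b bw x; have [N NP] := bw x; exists N.+1 => -[//|n] Nn.
  have := NP n Nn; have := NP n.+1 (leqW Nn).
  have [[_ _ /dlen_edge h _ _] _] := w'P n; have [[/dlen_edge h' _ _ _ _] _] := w'P n.+1.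
  have := dlen_tri (w' n.+1) (w n) x; have := dlen_tri (w n.+1) (w' n.+1) x; lia.
- by exists 1%N => i; have [[/dlen_edge]] := w'P i.
- by move=> _; have [[_ _ h1 h2 _] _] := w'P 0%N; rewrite w'0 in h2.
Qed.

Lemma transport_walk w n y : sray w -> dwalk n (w 0%N) y ->
  exists w', [/\ sray w', w' 0%N = y,
    (exists c, forall b, blim w b -> blim w' (fun x => b x + c)) &
    (exists K, forall i, (dlen (w i) (w' i) <= K)%N)].
Proof.
elim: n w => [|n IH] w sw /=.
  move=> <-; exists w; split=> //; last by exists 0%N => i; rewrite dlen0.
  by exists 0 => b bw x; have [N NP] := bw x; exists N => m /NP ->; rewrite addr0.
move=> [x e xy]; have [w1 [sw1 w10 [c1 c1P] [K1 K1P] _]] := transport sw e.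
rewrite -w10 in xy; have [w2 [sw2 w20 [c2 c2P] [K2 K2P]]] := IH _ sw1 xy.
exists w2; split=> //.
  exists (c1 + c2) => b /c1P/c2P bw z; have [N NP] := bw z; exists N => m /NP ->.
  by rewrite addrA.
exists (K1 + K2)%N => i; apply: leq_trans (dlen_tri _ (w1 i) _) _.
exact: leq_add.
Qed.

(** Along a directed edge [b] grows by at most 1, and by 1 modulo 3 because types count directed
    length. Each change is therefore 1 - 3k with k a natural number; the three changes around a
    triangle sum to 0, so exactly one k is 1 and the others are 0. *)
Lemma blim_incr w b x y : blim w b -> directed_edge x y ->
  b y = b x + 1 \/ b y = b x - 2.
Proof.
move=> bw.
have H x' y' : directed_edge x' y' -> exists k : nat, b y' = b x' + 1 - (3 * k)%N%:Z.
  move=> xy; have [N NP] := bw x'; have [M MP] := bw y'.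
  have := NP _ (leq_maxl N M); have := MP _ (leq_maxr N M).
  set n := maxn N M => E1 E2.
  have := dlen_tri (w n) x' y'; have := dlen_edge xy => h1 h2.
  have : tau y' = tau x' + 1 by case: xy.
  rewrite (dlen_tau (w n) x') (dlen_tau (w n) y') -addrA => /addrI.
  rewrite -[1]/(1%:R) -natrD => /(congr1 (@nat_of_ord _)).
  rewrite !val_Zp_nat // => /eqP h3.
  exists ((dlen (w n) x' + 1 - dlen (w n) y') %/ 3)%N.
  have : (3 %| dlen (w n) x' + 1 - dlen (w n) y')%N.
    by rewrite -eqn_mod_dvd //; [rewrite eq_sym|lia].
  move=> /divnK; lia.
move=> xy; have [z [zx s]] := edge_triangle xy.
have yz := tri_edge xy zx s.
have [k1 E1] := H _ _ xy; have [k2 E2] := H _ _ yz; have [k3 E3] := H _ _ zx.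
lia.
Qed.

(** The combinatorial trace of a boundary point: from each vertex exactly one outgoing edge points
    towards it. *)
Definition horo (b : V -> int) :=
  (forall x y, directed_edge x y -> b y = b x + 1 \/ b y = b x - 2) /\
  (forall x, exists2 y, directed_edge x y /\ b y = b x - 2 &
     forall y', directed_edge x y' -> b y' = b x - 2 -> y' = y).

Lemma blim_along w b i : sray w -> blim w b -> b (w i) = - (2 * i)%N%:Z.
Proof.
move=> sw bw; have [N NP] := bw (w i); rewrite -(NP _ (leq_maxl N i)).
have [_ ->] := sray_dlen sw (leq_maxr N i); have := leq_maxr N i; lia.
Qed.

(* If two edges leaving x both lowered the horofunction, the line through   *)
(* their ends would close a triangle with two descending edges.             *)
Lemma blim_horo w b : sray w -> blim w b -> horo b.
Proof.
move=> sw bw; split=> [x y|x]; first exact: blim_incr.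
have [w1 [sw1 w10 [c1 c1P] _]] := transport_walk sw (dlen_walk (w 0%N) x).
have bw1 := c1P _ bw; exists (w1 1%N).
  split; first by rewrite -w10; apply sw1.
  by have := blim_along 0 sw1 bw1; have := blim_along 1 sw1 bw1; rewrite w10; lia.
move=> y xy by2; apply: contrapT => ne; rewrite -w10 in xy by2.
have [w2 [sw2 w20 [c2 c2P] _ /(_ ne)[s zx]]] := transport sw1 xy.
have bw2 := c2P _ bw1.
have := blim_along 0 sw2 bw2; have := blim_along 1 sw2 bw2; rewrite w20.
by have := blim_incr bw zx; lia.
Qed.

Lemma horo_uniq b x y y' : horo b -> directed_edge x y -> directed_edge x y' ->
  b y = b x - 2 -> b y' = b x - 2 -> y = y'.
Proof. by move=> [_ /(_ x)[t _ tu]] xy xy' /(tu _ xy) -> /(tu _ xy') ->. Qed.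

Lemma horo_triangle b x y z : horo b -> directed_edge x y -> directed_edge z x ->
  simplex [set x; y; z] ->
  [\/ [/\ b y = b x - 2, b z = b y + 1 & b x = b z + 1],
      [/\ b y = b x + 1, b z = b y - 2 & b x = b z + 1] |
      [/\ b y = b x + 1, b z = b y + 1 & b x = b z - 2]].
Proof.
move=> [hb _] xy zx s; have yz := tri_edge xy zx s.
by case: (hb _ _ xy) => ?; case: (hb _ _ yz) => ?; case: (hb _ _ zx) => ?;
  first [exfalso; lia|constructor 1; split; lia|constructor 2; split; lia
        |constructor 3; split; lia].
Qed.

Lemma horo_next_straight b x y y' : horo b -> directed_edge x y -> directed_edge y y' ->
  b y = b x - 2 -> b y' = b y - 2 -> ~ simplex [set x; y; y'].
Proof.
move=> hb xy yy' h1 h2 s.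
have y'x : directed_edge y' x.
  split; first exact: simplex3_31 s.
  by case: xy yy' => _ e1 [_ e2]; apply: Z3_tri e1; exact: e2.
by have [[]|[]|[]] := horo_triangle hb xy y'x s; lia.
Qed.

(** Suppose [b] rises from [x] to [y], and let y0 be the descending successor of [x]. The line z
    through y and y0 in the link of [x] lies below [y] by the two triangles, so z is [y'] by
    uniqueness of descent, against straightness. *)
Lemma horo_straight b x y y' : horo b -> directed_edge x y -> directed_edge y y' ->
  ~ simplex [set x; y; y'] -> b y' = b y - 2 -> b y = b x - 2.
Proof.
move=> hb xy yy' ns h; have [h1 /(_ x)[y0 [xy0 by0] _]] := hb.
have [//|e] : b y = b x - 2 \/ b y = b x + 1 by case: (h1 _ _ xy); [right|left].
have ne : y <> y0 by move=> E; move: by0; rewrite -E; lia.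
have [z [zx s1 s2]] := link_line xy xy0 ne; case: ns.
have e1 := horo_triangle hb xy zx s1; have e2 := horo_triangle hb xy0 zx s2.
have bz : b z = b y - 2 by case: e1 e2 => -[? ? ?] [] [? ? ?]; lia.
have yz := tri_edge xy zx s1.
by rewrite (horo_uniq hb yy' yz h bz).
Qed.

End Links.

(** * The norm form of the triangular lattice *)

Definition eisen (R : pzRingType) (x y : R) : R := x ^+ 2 + y ^+ 2 - x * y.

(** For weights of total 0, the squared norm of a weighted sum of points depends only on their
    mutual squared distances: expand the square and drop the terms containing the total. *)
Lemma eisen_bary (R : comPzRingType) (T : Type) (s : seq T) (r a b : T -> R) :
  \sum_(u <- s) r u = 0 ->
  2 * eisen (\sum_(u <- s) r u * a u) (\sum_(u <- s) r u * b u) =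
  - \sum_(u <- s) \sum_(v <- s) r u * r v * eisen (a u - a v) (b u - b v).
Proof.
move=> r0; set A := \sum_(u <- s) r u * a u; set B := \sum_(u <- s) r u * b u.
pose Q := \sum_(u <- s) r u * eisen (a u) (b u).
have E u : \sum_(v <- s) r u * r v * eisen (a u - a v) (b u - b v) =
    r u * eisen (a u) (b u) * \sum_(v <- s) r v + r u * Q
    + r u * (b u - 2 * a u) * A + r u * (a u - 2 * b u) * B.
  rewrite /A /B /Q !mulr_sumr -!big_split /=; apply: eq_bigr => v _.
  by rewrite /eisen; ring.
under eq_bigr => u _ do rewrite E r0 mulr0 add0r.
have S1 : \sum_(u <- s) r u * (b u - 2 * a u) = B - 2 * A.
  by rewrite /A /B mulr_sumr -sumrB; apply: eq_bigr => u _; ring.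
have S2 : \sum_(u <- s) r u * (a u - 2 * b u) = A - 2 * B.
  by rewrite /A /B mulr_sumr -sumrB; apply: eq_bigr => u _; ring.
by rewrite !big_split /= -!mulr_suml S1 S2 r0 /eisen; ring.
Qed.

(** Euclidean length as a function of the two directed lengths. The pair of maxima takes one of six
    linear forms, according to the sector of the displacement. *)
Lemma cdist_eisen z w : 3 * eisen (z.1 - w.1) (z.2 - w.2) =
  eisen (cdist z w) (cdist w z).
Proof.
rewrite /cdist; set a := w.1 - z.1; set b := w.2 - z.2.
have -> : z.1 - w.1 = - a by rewrite opprB.
have -> : z.2 - w.2 = - b by rewrite opprB.
have [m1 m2] : (Num.max (a + b) (Num.max (b - 2 * a) (a - 2 * b)),
   Num.max (- a - b) (Num.max (- b - 2 * - a) (- a - 2 * - b))) \in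
   [:: (a + b, 2 * a - b); (a + b, 2 * b - a); (b - 2 * a, - a - b);
       (b - 2 * a, 2 * b - a); (a - 2 * b, - a - b); (a - 2 * b, 2 * a - b)] /\ true.
  by split=> //; rewrite !inE !xpair_eqE; lia.
by move: m1; rewrite !inE => /or3P[/eqP[-> ->]|/eqP[-> ->]|/or4P[]/eqP[-> ->]];
  rewrite /eisen; ring.
Qed.

(** * Distances *)

Section Distance.
Variables (R : realType) (q : nat) (Delta : A2_building q).
Local Notation V := (vertex Delta).
Implicit Types (p : V -> R) (u v : V) (phi psi : cox_vertex -> V).

Lemma fsum_seq (T : choiceType) (f : T -> R) (s : seq T) : uniq s ->
  (forall z, z \notin s -> f z = 0) -> \sum_(z \in [set: T]) f z = \sum_(z <- s) f z.
Proof.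
move=> us f0; rewrite (@fsbigE _ _ _ _ _ s) //; last by move=> i _; exact: f0.
by apply: eq_bigl => i; rewrite in_setT.
Qed.

Lemma simplex_seq (s : set V) : simplex s -> exists2 l, uniq l & forall v, s v <-> v \in l.
Proof.
move=> ss; have [_ /(_ _ ss)[fs _] _] := bld_complex Delta.
exists (fset_set s); first exact: fset_uniq.
by move=> v; rewrite in_fset_set // inE.
Qed.

Definition carried phi p := exists2 c, cox_simplex c & phi @` c = supp p.

Lemma carried_ex phi p v : carried phi p -> supp p v -> exists2 z, phi z = v &
  forall w, supp p (phi w) -> injective phi -> cadj z w.
Proof.
move=> [c /cox_simplexP[_ cc] <-] [z cz <-]; exists z => // w [w' cw' E] pi.
by rewrite -(pi _ _ E); exact: cc.
Qed.

Lemma coord_seq phi p (kap : V -> cox_vertex) (l : seq V) (g : cox_vertex -> R) :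
  injective phi -> uniq l -> {in l, forall v, phi (kap v) = v} ->
  (forall v, p v != 0 -> v \in l) ->
  \sum_(z \in [set: cox_vertex]) p (phi z) * g z = \sum_(v <- l) p v * g (kap v).
Proof.
move=> pi ul kE pl; rewrite (@fsum_seq _ _ (map kap l)).
- by rewrite big_map !big_seq; apply: eq_bigr => v vl; rewrite kE.
- rewrite map_inj_in_uniq // => u v ul' vl' E.
  by rewrite -(kE u) // E kE.
move=> z zn; have [->|pz] := eqVneq (p (phi z)) 0; first by rewrite mul0r.
case/negP: zn; apply/mapP; exists (phi z); first exact: pl.
by apply: pi; rewrite kE // pl.
Qed.

Lemma chart_eisen Sys phi z w : apartment_system (@simplex q Delta) Sys ->
  schart Sys phi -> 3 * eisen (z.1 - w.1) (z.2 - w.2) =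
  eisen (dlen (phi z) (phi w))%:Z (dlen (phi w) (phi z))%:Z.
Proof.
move=> HS ch; have [och|och] := schart_orient HS ch.
  by rewrite !(dlen_ochart HS) // cdist_eisen.
have cnegK : cancel cneg cneg by move=> t; apply: pair_int_eq; rewrite /= opprK.
rewrite -{1}(cnegK z) -{1}(cnegK w) -[in RHS](cnegK z) -[in RHS](cnegK w).
rewrite !(dlen_ochart HS (phi := phi \o cneg)) // -cdist_eisen /eisen /=; ring.
Qed.

Lemma carried_kap phi p p' : carried phi p -> carried phi p' -> exists kap,
  forall v, supp p v \/ supp p' v -> phi (kap v) = v.
Proof.
move=> [c _ cE] [c' _ cE'].
suff /choice[kap kE] : forall v, exists z, supp p v \/ supp p' v -> phi z = v by exists kap.
move=> v; have [[]|nv] := pselect (supp p v \/ supp p' v).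
- by rewrite -cE => -[z _ zv]; exists z.
- by rewrite -cE' => -[z _ zv]; exists z.
- by exists 0 => /nv.
Qed.

Lemma mass_seq p (l : seq V) : uniq l -> (forall v, p v != 0 -> v \in l) -> realization p ->
  \sum_(v <- l) p v = 1.
Proof.
move=> ul pl [_ _ <-]; rewrite (fsum_seq ul) // => v /negP nv.
by apply: contrapT => /eqP /pl.
Qed.

(* The right-hand side depends only on directed lengths, so that distances   *)
(* do not depend on the chart, nor on the apartment system.                  *)
Lemma flat_dist_formula Sys phi p p' (l : seq V) : apartment_system (@simplex q Delta) Sys ->
  schart Sys phi -> carried phi p -> carried phi p' ->
  realization p -> realization p' -> uniq l ->
  (forall v, v \in l <-> supp p v \/ supp p' v) ->
  flat_dist phi p p' = Num.sqrt (- (6%:R)^-1 * \sum_(u <- l) \sum_(v <- l)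
    (p u - p' u) * (p v - p' v) * (eisen (dlen u v)%:Z (dlen v u)%:Z)%:~R).
Proof.
move=> HS ch ca ca' rp rp' ul lE; have pi := schart_inj ch.
have [kap kE] := carried_kap ca ca'.
have kl : {in l, forall v, phi (kap v) = v} by move=> v /lE; exact: kE.
have pl v : p v != 0 -> v \in l by move=> pv; apply/lE; left.
have pl' v : p' v != 0 -> v \in l by move=> pv; apply/lE; right.
rewrite /flat_dist /coord1 /coord2 !(coord_seq _ pi ul kl pl) !(coord_seq _ pi ul kl pl').
have D (g : V -> R) : \sum_(v <- l) p v * g v - \sum_(v <- l) p' v * g v =
    \sum_(v <- l) (p v - p' v) * g v.
  by rewrite -sumrB; apply: eq_bigr => v _; rewrite mulrBl.
rewrite !D; congr Num.sqrt.
have r0 : \sum_(u <- l) (p u - p' u) = 0 by rewrite sumrB !mass_seq // subrr.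
have := eisen_bary (fun u => (kap u).1%:~R) (fun u => (kap u).2%:~R) r0.
move=> E; rewrite -[LHS]/(eisen _ _).
have half (x : R) : x = 2^-1 * (2 * x) by field.
rewrite [LHS]half E mulrN mulNr; congr (- _).
rewrite mulr_sumr mulr_sumr big_seq [RHS]big_seq; apply: eq_bigr => u ul'.
rewrite mulr_sumr mulr_sumr big_seq [RHS]big_seq; apply: eq_bigr => v vl'.
have := chart_eisen (kap u) (kap v) HS ch; rewrite !kl // => <-.
by rewrite /eisen !(intrM, intrB, intrD, rmorphXn) /=; field.
Qed.

Lemma flat_dist_indep Sys Sys' phi psi p p' :
  apartment_system (@simplex q Delta) Sys -> apartment_system (@simplex q Delta) Sys' ->
  schart Sys phi -> carried phi p -> carried phi p' ->
  schart Sys' psi -> carried psi p -> carried psi p' ->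
  realization p -> realization p' -> flat_dist phi p p' = flat_dist psi p p'.
Proof.
move=> HS HS' ch c1 c2 ch' c1' c2' rp rp'.
have [_ /simplex_seq[l1 _ l1E] _] := rp; have [_ /simplex_seq[l2 _ l2E] _] := rp'.
have ul := undup_uniq (l1 ++ l2).
have lE v : v \in undup (l1 ++ l2) <-> supp p v \/ supp p' v.
  rewrite mem_undup mem_cat l1E l2E; split; first by move/orP.
  by move=> h; apply/orP.
by rewrite (flat_dist_formula HS ch c1 c2 rp rp' ul lE) (flat_dist_formula HS' ch' c1' c2' rp rp' ul lE).
Qed.

Lemma dist_chart Sys phi p p' : apartment_system (@simplex q Delta) Sys ->
  schart Sys phi -> carried phi p -> carried phi p' ->
  realization p -> realization p' -> dist p p' = flat_dist phi p p'.
Proof.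
move=> HS ch c1 c2 rp rp'; rewrite /dist; case: xgetP => [d _|].
  move=> [A [psi [[Sys' HS' SA'] cA' /(chartP _ cA')[c cc cE] /(chartP _ cA')[c' cc' cE'] ->]]].
  apply: (flat_dist_indep HS' HS) => //; [by exists A|by exists c|by exists c'].
move=> /(_ (flat_dist phi p p')); case.
have [A SA cA] := ch; exists A, phi; split=> //; first by exists Sys.
  by apply/(chartP _ cA).
by apply/(chartP _ cA).
Qed.

Lemma dist_ochart_ex p p' : realization p -> realization p' ->
  exists Sys phi, [/\ apartment_system (@simplex q Delta) Sys, ochart Sys phi,
    carried phi p, carried phi p' & dist p p' = flat_dist phi p p'].
Proof.
move=> rp rp'; have [Sys HS] := bld_apartments Delta.
have [_ ss _] := rp; have [_ ss' _] := rp'.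
have [phi [c [d [och cc cd cE dE]]]] := ochart_ex HS ss ss'.
have c1 : carried phi p by exists c.
have c2 : carried phi p' by exists d.
by exists Sys, phi; split=> //; apply: (dist_chart HS) => //; case: och.
Qed.

Lemma flat_distC phi p p' : flat_dist phi p p' = flat_dist phi p' p.
Proof. by rewrite /flat_dist; congr Num.sqrt; ring. Qed.

Lemma distC p p' : realization p -> realization p' -> dist p p' = dist p' p.
Proof.
move=> rp rp'; have [Sys [phi [HS [ch _] c1 c2 ->]]] := dist_ochart_ex rp rp'.
by rewrite (dist_chart HS ch c2 c1) // flat_distC.
Qed.

(** The coordinates of [p] are weighted means over the vertices of a simplex containing [phi z],
    each within 1 of [z]. *)
Lemma coord_near phi p z : injective phi -> carried phi p -> realization p ->
  supp p (phi z) ->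
  `|coord1 phi p - z.1%:~R| <= 1 /\ `|coord2 phi p - z.2%:~R| <= 1.
Proof.
move=> pi ca rp pz; have [p0 /simplex_seq[l ul lE] _] := rp.
have [kap kE] := carried_kap ca ca.
have kl : {in l, forall v, phi (kap v) = v} by move=> v /lE vl; apply: kE; left.
have pl v : p v != 0 -> v \in l by move=> ?; apply/lE.
have m1 := mass_seq ul pl rp.
have adj v : v \in l -> cadj z (kap v).
  move=> vl; have [t tE] := carried_ex ca pz.
  by rewrite (pi _ _ tE); apply=> //; rewrite kl //; apply/lE.
rewrite /coord1 /coord2 !(coord_seq _ pi ul kl pl).
have bnd (f : cox_vertex -> int) : (forall v, v \in l -> -1 <= f (kap v) - f z <= 1) ->
    `|\sum_(v <- l) p v * (f (kap v))%:~R - (f z)%:~R| <= 1.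
  move=> fz; have -> : \sum_(v <- l) p v * (f (kap v))%:~R - (f z)%:~R =
      \sum_(v <- l) p v * (f (kap v) - f z)%:~R :> R.
    have -> : (f z)%:~R = \sum_(v <- l) p v * (f z)%:~R by rewrite -mulr_suml m1 mul1r.
    rewrite -sumrB; apply: eq_bigr => v _.
    by rewrite intrB mulrBr.
  apply: le_trans (ler_norm_sum _ _ _) _; rewrite -[leRHS]m1 big_seq [leRHS]big_seq.
  apply: ler_sum => v vl; rewrite normrM (ger0_norm (p0 v)) ler_piMr //.
  by rewrite -intr_norm -[1]/(1%:~R) ler_int; have := fz _ vl; lia.
split; [apply: (bnd fst)|apply: (bnd snd)] => v /adj; rewrite /cadj; lia.
Qed.

Lemma eisen_ge (x y : R) : x ^+ 2 <= 4 * eisen x y /\ y ^+ 2 <= 4 * eisen x y.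
Proof. by rewrite /eisen; split; nra. Qed.

(** Coordinates of points at distance at most C differ by at most 2C ([eisen_ge]), those of
    supporting vertices by 2C + 2, and [cdist] is at most three times that. With [dist_le_dlen], it
    turns parallelism into a statement on directed lengths. *)
Lemma dlen_le_dist p p' u v (C : nat) : realization p -> realization p' ->
  supp p u -> supp p' v -> dist p p' <= C%:R -> (dlen u v <= 6 * C + 6)%N.
Proof.
move=> rp rp' pu pv; have [Sys [phi [HS och c1 c2 ->]]] := dist_ochart_ex rp rp'.
have pi := schart_inj (proj1 och) => dC.
have [z zu _] := carried_ex c1 pu; have [w wv _] := carried_ex c2 pv.
rewrite -zu in pu *; rewrite -wv in pv *.
have [h1 h2] := coord_near pi c1 rp pu; have [h3 h4] := coord_near pi c2 rp' pv.
set x := coord1 phi p - coord1 phi p'; set y := coord2 phi p - coord2 phi p'.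
have eC : eisen x y <= C%:R ^+ 2.
  have e0 : 0 <= eisen x y by rewrite /eisen; nra.
  by rewrite -(sqr_sqrtr e0) ler_sqr ?nnegrE ?sqrtr_ge0 // ler0n.
have [g1 g2] := eisen_ge x y.
have C0 : 0 <= C%:R :> R by rewrite ler0n.
have xC : `|x| <= 2 * C%:R.
  by rewrite -ler_sqr ?nnegrE ?mulr_ge0 // real_normK ?num_real //; nra.
have yC : `|y| <= 2 * C%:R.
  by rewrite -ler_sqr ?nnegrE ?mulr_ge0 // real_normK ?num_real //; nra.
have k1 : `|z.1 - w.1| <= (2 * C + 2)%N%:Z.
  rewrite -(ler_int R) intr_norm intrB -pmulrn natrD natrM.
  have -> : z.1%:~R - w.1%:~R = x - (coord1 phi p - z.1%:~R) + (coord1 phi p' - w.1%:~R).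
    by rewrite /x; ring.
  apply: le_trans (ler_normD _ _) _; have := ler_normB x (coord1 phi p - z.1%:~R); lra.
have k2 : `|z.2 - w.2| <= (2 * C + 2)%N%:Z.
  rewrite -(ler_int R) intr_norm intrB -pmulrn natrD natrM.
  have -> : z.2%:~R - w.2%:~R = y - (coord2 phi p - z.2%:~R) + (coord2 phi p' - w.2%:~R).
    by rewrite /y; ring.
  apply: le_trans (ler_normD _ _) _; have := ler_normB y (coord2 phi p - z.2%:~R); lra.
rewrite -lez_nat (dlen_ochart HS) // /cdist; lia.
Qed.

Lemma dist_le_dlen p p' u v : realization p -> realization p' ->
  supp p u -> supp p' v -> dist p p' <= (2 * (dlen u v + 2))%N%:R.
Proof.
move=> rp rp' pu pv; have [Sys [phi [HS och c1 c2 ->]]] := dist_ochart_ex rp rp'.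
have pi := schart_inj (proj1 och).
have [z zu _] := carried_ex c1 pu; have [w wv _] := carried_ex c2 pv.
rewrite -zu in pu *; rewrite -wv in pv *.
have [h1 h2] := coord_near pi c1 rp pu; have [h3 h4] := coord_near pi c2 rp' pv.
rewrite /flat_dist.
set x := coord1 phi p - coord1 phi p'; set y := coord2 phi p - coord2 phi p'.
set d := dlen _ _; have dE : d%:Z = cdist z w by exact: (dlen_ochart HS z w och).
have k1 : `|z.1 - w.1| <= d%:Z by move: dE; rewrite /cdist; lia.
have k2 : `|z.2 - w.2| <= d%:Z by move: dE; rewrite /cdist; lia.
move: k1; rewrite -(ler_int R) intr_norm intrB -pmulrn => k1.
move: k2; rewrite -(ler_int R) intr_norm intrB -pmulrn => k2.
have xd : `|x| <= d%:R + 2.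
  have -> : x = (z.1%:~R - w.1%:~R) + (coord1 phi p - z.1%:~R) - (coord1 phi p' - w.1%:~R).
    by rewrite /x; ring.
  apply: le_trans (ler_normB _ _) _.
  have := ler_normD (z.1%:~R - w.1%:~R) (coord1 phi p - z.1%:~R); lra.
have yd : `|y| <= d%:R + 2.
  have -> : y = (z.2%:~R - w.2%:~R) + (coord2 phi p - z.2%:~R) - (coord2 phi p' - w.2%:~R).
    by rewrite /y; ring.
  apply: le_trans (ler_normB _ _) _.
  have := ler_normD (z.2%:~R - w.2%:~R) (coord2 phi p - z.2%:~R); lra.
have d0 : 0 <= d%:R :> R by rewrite ler0n.
have -> : (2 * (d + 2))%N%:R = Num.sqrt ((2 * (d%:R + 2)) ^+ 2) :> R.
  by rewrite sqrtr_sqr ger0_norm ?natrM ?natrD // mulr_ge0 // addr_ge0.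
apply: ler_wsqrtr; move: xd yd; rewrite !ler_norml => /andP[? ?] /andP[? ?]; nra.
Qed.

End Distance.

Lemma clin_cadj2 z e n : e \in pdirs -> ~~ cadj (clin z e n) (clin z e n.+2).
Proof. by rewrite !inE => /or3P[]/eqP ->; rewrite /cadj /=; lia. Qed.

Lemma pdirs_eisen e : e \in pdirs -> eisen e.1 e.2 = 1.
Proof. by rewrite !inE => /or3P[]/eqP ->. Qed.

Lemma cadj_eisen z w : cadj z w -> z != w -> eisen (z.1 - w.1) (z.2 - w.2) = 1.
Proof.
rewrite cadjC cadj_dirs => + /negbTE E; rewrite E /= -[z.1 - w.1]/((z - w).1).
by rewrite -[z.2 - w.2]/((z - w).2) !inE => /or4P[|||/or3P[]]/eqP ->.
Qed.

(** * Rays *)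

Section Rays.
Variables (R : realType) (q : nat) (Delta : A2_building q).
Local Notation V := (vertex Delta).
Implicit Types (p : V -> R) (A B C : set (V -> R)) (u v x y : V)
  (phi psi : cox_vertex -> V) (w : nat -> V).

Lemma supp_vertex x v : supp (vertex_pt R x) v <-> v = x.
Proof.
rewrite /supp /vertex_pt /=; split=> [|->]; last by rewrite eqxx oner_neq0.
by have [->|_] := eqVneq v x; rewrite ?mulr0n ?eqxx.
Qed.

Lemma vertex_real x : realization (vertex_pt R x).
Proof.
split=> [v||]; first by rewrite /vertex_pt ler0n.
  rewrite (_ : supp _ = [set x]); first exact: simplex1.
  by apply/seteqP; split=> v /supp_vertex.
rewrite (@fsum_seq _ _ _ [:: x]) //.
  by rewrite big_seq1 /vertex_pt eqxx.
by move=> v; rewrite inE /vertex_pt => /negbTE ->.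
Qed.

Lemma vertex_pt_inj x y : vertex_pt R x = vertex_pt R y -> x = y.
Proof. by move=> E; apply/supp_vertex; rewrite -E; apply/supp_vertex. Qed.

Lemma vertex_carried phi z : carried phi (vertex_pt R (phi z)).
Proof.
exists [set z]; first exact: cox_simplex1.
by rewrite image_set1; apply/seteqP; split=> v /supp_vertex.
Qed.

Lemma vertex_coord phi z : injective phi ->
  coord1 phi (vertex_pt R (phi z)) = z.1%:~R /\ coord2 phi (vertex_pt R (phi z)) = z.2%:~R.
Proof.
move=> pi; rewrite /coord1 /coord2.
have pl v : vertex_pt R (phi z) v != 0 -> v \in [:: phi z] by move/supp_vertex ->; rewrite inE.
have kl : {in [:: phi z], forall v, phi ((fun=> z) v) = v} by move=> v; rewrite inE => /eqP.
rewrite !(coord_seq _ pi (_ : uniq [:: phi z]) kl pl) // !big_seq1 /vertex_pt eqxx.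
by rewrite !mul1r.
Qed.

Lemma dist_adj u v : simplex [set u; v] -> u <> v -> dist (vertex_pt R u) (vertex_pt R v) = 1.
Proof.
move=> suv ne; have [Sys HS] := bld_apartments Delta.
have [phi [c [_ [[ch _] /cox_simplexP[_ cc] _ cE _]]]] := ochart_ex HS suv suv.
have : [set u; v] u by left.
have : [set u; v] v by right.
rewrite -cE => -[b cb bE] [a ca aE]; rewrite -aE -bE; have pi := schart_inj ch.
rewrite (dist_chart HS ch (vertex_carried _ _) (vertex_carried _ _) (vertex_real _) (vertex_real _)).
rewrite /flat_dist.
have [-> ->] := vertex_coord a pi; have [-> ->] := vertex_coord b pi.
have ab : a != b by apply/eqP => E; apply: ne; rewrite -aE -bE E.
rewrite -!intrB -!rmorphXn -intrM -intrD -intrB /= -[_ - _]/(eisen _ _).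
by rewrite cadj_eisen ?sqrtr1 //; exact: cc.
Qed.

(** The unit speed path through [w 0], [w 1], ...: at time n + f it has barycentric coordinates 1 -
    f and f on the nth edge. *)
Definition rpt w (t : R) : V -> R := let n := Num.truncn t in let f := t - n%:R in
  fun v => (v == w n)%:R * (1 - f) + (v == w n.+1)%:R * f.

Definition ray_of w : set (V -> R) := rpt w @` [set t | 0 <= t].

Lemma rpt_hat w n (f : R) : 0 <= f < 1 -> rpt w (n%:R + f) =
  fun v => (v == w n)%:R * (1 - f) + (v == w n.+1)%:R * f.
Proof.
move=> /andP[f0 f1]; rewrite /rpt (@truncn_def _ _ n); first by rewrite addrAC subrr add0r.
by rewrite lerDl f0 -[in ltRHS]natr1 ltrD2l.
Qed.

Lemma rpt_split (t : R) : 0 <= t -> exists n f, 0 <= f < 1 /\ t = n%:R + f.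
Proof.
move=> t0; have /andP[h1 h2] := truncn_itv t0.
exists (Num.truncn t), (t - (Num.truncn t)%:R); split; last by rewrite subrKC.
by rewrite subr_ge0 h1 ltrBlDr addrC natr1.
Qed.

Lemma rpt_vertex w n : rpt w n%:R = vertex_pt R (w n).
Proof.
rewrite -[n%:R]addr0 rpt_hat ?lexx ?ltr01 //; apply/funext => v.
by rewrite /vertex_pt subr0 mulr1 mulr0 addr0.
Qed.

Section Ray.
Variable w : nat -> V.
Hypothesis sw : sray w.

Lemma sray_neqS n : (w n == w n.+1) = false.
Proof. by apply/eqP => /(sray_inj sw)/eqP; rewrite eqn_leq ltnn andbF. Qed.

Lemma rpt_supp n (f : R) v : 0 <= f < 1 ->
  supp (rpt w (n%:R + f)) v <-> v = w n \/ (f <> 0 /\ v = w n.+1).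
Proof.
move=> f01; have /andP[f0 f1] := f01; rewrite /supp /= (rpt_hat _ _ f01).
have nf : 1 - f != 0 by rewrite gt_eqF // subr_gt0.
have [->|nv] := eqVneq v (w n).
  by rewrite sray_neqS mul1r mul0r addr0; split=> // _; left.
rewrite mul0r add0r; have [->|nv'] := eqVneq v (w n.+1).
  rewrite mul1r; split=> [/eqP|[/eqP|[/eqP]]] //; first by right.
  by rewrite eq_sym sray_neqS.
by rewrite mul0r eqxx; split=> // -[/eqP|[_ /eqP]]; rewrite ?(negbTE nv) ?(negbTE nv').
Qed.

Lemma rpt_real (t : R) : 0 <= t -> realization (rpt w t).
Proof.
move=> /rpt_split[n [f [f01 ->]]]; have /andP[f0 f1] := f01; split.
- move=> v; rewrite rpt_hat // addr_ge0 // mulr_ge0 ?ler0n //.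
  by rewrite subr_ge0 ltW.
- have s2 : simplex [set w n; w n.+1] by have [/(_ n)[]] := sw.
  apply: simplex_sub s2 _ _; first by move=> v /(rpt_supp _ _ f01)[->|[_ ->]]; [left|right].
  by exists (w n); apply/(rpt_supp _ _ f01); left.
- rewrite (@fsum_seq _ _ _ [:: w n; w n.+1]).
  + rewrite big_cons big_seq1 rpt_hat // !eqxx [w n.+1 == _]eq_sym sray_neqS /=.
    by rewrite !mul1r !mul0r addr0 add0r subrK.
  + by rewrite /= inE sray_neqS.
  + move=> v; rewrite !inE negb_or => /andP[/negbTE v1 /negbTE v2].
    by rewrite rpt_hat // v1 v2 !mul0r addr0.
Qed.

Lemma rpt_coord phi z z' n (f : R) : injective phi -> 0 <= f < 1 -> phi z = w n ->
  (f <> 0 -> phi z' = w n.+1) ->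
  coord1 phi (rpt w (n%:R + f)) = (1 - f) * z.1%:~R + f * z'.1%:~R /\
  coord2 phi (rpt w (n%:R + f)) = (1 - f) * z.2%:~R + f * z'.2%:~R.
Proof.
move=> pi f01 zE z'E; have [f0|/eqP nf0] := eqVneq f 0.
  rewrite f0 addr0 rpt_vertex -zE subr0 !mul1r !mul0r !addr0.
  exact: vertex_coord.
have {}z'E := z'E nf0; pose l := [:: w n; w n.+1].
have ul : uniq l by rewrite /= inE sray_neqS.
have pl v : rpt w (n%:R + f) v != 0 -> v \in l.
  by move/(rpt_supp n v f01) => [->|[_ ->]]; rewrite !inE eqxx ?orbT.
pose kap v := if v == w n then z else z'.
have kl : {in l, forall v, phi (kap v) = v}.
  move=> v; rewrite !inE /kap; have [->//|_ /= /eqP ->] := eqVneq v (w n).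
  by [].
rewrite /coord1 /coord2 !(coord_seq _ pi ul kl pl) /l !big_cons !big_nil !addr0.
rewrite rpt_hat // /kap !eqxx [w n.+1 == _]eq_sym sray_neqS.
by rewrite !mul1r !mul0r addr0 add0r.
Qed.

Lemma dist_rpt_le (s t : R) : 0 <= s -> s <= t -> dist (rpt w s) (rpt w t) = t - s.
Proof.
move=> s0 st; have t0 := le_trans s0 st.
have [Sys [phi [HS och [c cc cE] [d dd dE] ->]]] := dist_ochart_ex (rpt_real s0) (rpt_real t0).
have pi := schart_inj (proj1 och).
have [n [f [f01 sE]]] := rpt_split s0; have [m [g [g01 tE]]] := rpt_split t0.
have /andP[f0 f1] := f01; have /andP[g0 g1] := g01.
(* [w k] is the last vertex supporting the point at time t; the chart contains it and [w n], hence
   the path between them, as a lattice line. *)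
pose k := if g == 0 then m else m.+1.
have tk : t <= k%:R.
  rewrite tE /k; case: eqVneq => [->|_]; first by rewrite addr0.
  by rewrite -natr1 lerD2l ltW.
have nk : (n <= k)%N by rewrite -(ler_nat R); lra.
have nk1 : f <> 0 -> (n < k)%N.
  by move=> /eqP nf; have : 0 < f by [rewrite lt_def nf f0]; rewrite -(ltr_nat R); lra.
have nm : (n <= m)%N by rewrite -ltnS -(ltr_nat R) -[m.+1%:R]natr1; lra.
have [z zE] : exists z, phi z = w n.
  have : supp (rpt w s) (w n) by rewrite sE; apply/(rpt_supp _ _ f01); left.
  by rewrite -cE => -[z _ zE]; exists z.
have [z' z'E] : exists z, phi z = w k.
  have : supp (rpt w t) (w k).
    rewrite tE; apply/(rpt_supp _ _ g01); rewrite /k; case: eqVneq => [_|/eqP ng]; first by left.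
    by right.
  by rewrite -dE => -[z' _ z'E]; exists z'.
have nkk : (n <= k <= k)%N by rewrite nk /=.
have [e ep wl] := spath_chart HS och (sray_spath k sw) nkk zE z'E.
have mk : (m <= k)%N by rewrite /k; case: ifP.
have [|A1 A2] := @rpt_coord phi z (clin z e 1) n f pi f01 zE.
  by move=> nf; rewrite wl ?leqnSn ?nk1 // subSn // subnn.
have [||B1 B2] := @rpt_coord phi (clin z e (m - n)) (clin z e (m.+1 - n)) m g pi g01.
  by rewrite wl // nm.
  by move=> /eqP ng; rewrite wl // (leqW nm) /k (negbTE ng) leqnn.
rewrite /flat_dist sE tE A1 A2 B1 B2 /=.
set x := (X in X ^+ 2 + _ - _); set y := (X in _ + X ^+ 2 - _).
have N1 : (m - n)%:R = m%:R - n%:R :> R by rewrite natrB.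
have N2 : (m.+1 - n)%:R = m%:R + 1 - n%:R :> R by rewrite natrB ?natr1 // leqW.
have xE : x = (s - t) * e.1%:~R.
  rewrite /x sE tE !intrD !intrM -!pmulrn N1 N2; ring.
have yE : y = (s - t) * e.2%:~R.
  rewrite /y sE tE !intrD !intrM -!pmulrn N1 N2; ring.
have -> : x ^+ 2 + y ^+ 2 - x * y = (t - s) ^+ 2 * (eisen e.1 e.2)%:~R.
  by rewrite xE yE /eisen !(intrB, intrD, intrM, rmorphXn) /=; ring.
rewrite pdirs_eisen // mulr1 sqrtr_sqr ger0_norm ?subr_ge0 // -sE -tE //.
Qed.

Lemma dist_rpt (s t : R) : 0 <= s -> 0 <= t -> dist (rpt w s) (rpt w t) = `|s - t|.
Proof.
move=> s0 t0; have [st|ts] := leP s t.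
  by rewrite dist_rpt_le // distrC ger0_norm // subr_ge0.
by rewrite (distC (rpt_real s0) (rpt_real t0)) dist_rpt_le // ?(ltW ts) // ger0_norm // subr_ge0 ltW.
Qed.

Lemma ray_of_ray_from : ray_from (vertex_pt R (w 0%N)) (ray_of w).
Proof.
exists (rpt w); split=> //; [exact: rpt_real|exact: (rpt_vertex w 0)|exact: dist_rpt].
Qed.

Lemma ray_of_ray : ray (ray_of w).
Proof. by exists (vertex_pt R (w 0%N)); exact: ray_of_ray_from. Qed.

Lemma ray_of_vertex n : ray_of w (vertex_pt R (w n)).
Proof. by exists n%:R; [rewrite /= ler0n|exact: rpt_vertex]. Qed.

Lemma ray_of_supp p : ray_of w p -> exists n, supp p (w n).
Proof.
move=> [t /rpt_split[n [f [f01 ->]]] <-]; exists n.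
by apply/(rpt_supp _ _ f01); left.
Qed.

Lemma ray_of_supp_inv p v : ray_of w p -> supp p v -> exists n, v = w n.
Proof.
move=> [t /rpt_split[n [f [f01 ->]]] <-] /(rpt_supp _ _ f01)[->|[_ ->]].
  by exists n.
by exists n.+1.
Qed.

Lemma ray_of_edge p n : realization p -> supp p `<=` [set w n; w n.+1] -> ray_of w p.
Proof.
move=> rp sp; have [p0 _ _] := rp.
have ul : uniq [:: w n; w n.+1] by rewrite /= inE sray_neqS.
have pl v : p v != 0 -> v \in [:: w n; w n.+1].
  by move=> /sp[->|->]; rewrite !inE eqxx ?orbT.
have := mass_seq ul pl rp; rewrite big_cons big_seq1 => m1.
have pE : p = fun v => (v == w n)%:R * (1 - p (w n.+1)) + (v == w n.+1)%:R * p (w n.+1).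
  apply/funext => v; have [->|nv] := eqVneq v (w n).
    by rewrite sray_neqS mul1r mul0r addr0 -m1 addrK.
  have [->|nv'] := eqVneq v (w n.+1); first by rewrite mul0r mul1r add0r.
  rewrite !mul0r addr0; apply: contrapT => /eqP /pl.
  by rewrite !inE (negbTE nv) (negbTE nv').
have [p1|np1] := eqVneq (p (w n.+1)) 1.
  rewrite pE p1 subrr (_ : (fun _ => _) = vertex_pt R (w n.+1)); first exact: ray_of_vertex.
  by apply/funext => v; rewrite mulr0 add0r mulr1.
exists (n%:R + p (w n.+1)); first by rewrite /= addr_ge0 ?ler0n.
rewrite rpt_hat -?pE // p0 /= lt_neqAle np1 /= -m1 lerDr p0 //.
Qed.

Lemma ray_of_segment n : segment R (w n) (w n.+1) `<=` ray_of w.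
Proof. by move=> p [rp sp]; exact: ray_of_edge rp sp. Qed.

End Ray.

Lemma ray_sub A p : ray A -> A p -> realization p.
Proof. by move=> [x [rho [r1 _ _ ->]]] [t t0 <-]; exact: r1. Qed.

(** Half of a bounded Hausdorff distance, measured by directed lengths between supporting vertices;
    transitivity of parallelism then rests on the triangle inequality of [dlen]. *)
Definition close_by K A B := forall a, A a -> exists2 b, B b & exists u v,
  [/\ supp a u, supp b v & (dlen u v <= K)%N].

Lemma parallel_near A B : ray A -> ray B -> parallel A B ->
  exists K, close_by K A B /\ close_by K B A.
Proof.
move=> rA rB [C [h1 h2]].
have [M CM] : exists M : nat, C <= M%:R.
  by exists (Num.truncn C).+1; apply/ltW/truncnS_gt.
have sne (p : V -> R) : realization p -> exists u, supp p u.
  by move=> [_ ss _]; have [_ /(_ _ ss)[_ [u pu]] _] := bld_complex Delta; exists u.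
exists (6 * M + 6)%N; split.
  move=> a Aa; have [b Bb ab] := h1 _ Aa; exists b => //.
  have ra := ray_sub rA Aa; have rb := ray_sub rB Bb.
  have [u au] := sne _ ra; have [v bv] := sne _ rb; exists u, v; split=> //.
  exact: dlen_le_dist au bv (le_trans ab CM).
move=> b Bb; have [a Aa ab] := h2 _ Bb; exists a => //.
have ra := ray_sub rA Aa; have rb := ray_sub rB Bb.
have [u au] := sne _ ra; have [v bv] := sne _ rb; exists v, u; split=> //.
by apply: dlen_le_dist bv au _ => //; rewrite (distC rb ra); exact: le_trans ab CM.
Qed.

Lemma near_parallel K A B : ray A -> ray B -> close_by K A B -> close_by K B A -> parallel A B.
Proof.
move=> rA rB h1 h2; exists ((2 * (K + 2))%N%:R); split.
  move=> a Aa; have [b Bb [u [v [au bv uv]]]] := h1 _ Aa; exists b => //.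
  apply: le_trans (dist_le_dlen (ray_sub rA Aa) (ray_sub rB Bb) au bv) _.
  by rewrite ler_nat; lia.
move=> b Bb; have [a Aa [u [v [bu av uv]]]] := h2 _ Bb; exists a => //.
rewrite (distC (ray_sub rA Aa) (ray_sub rB Bb)).
apply: le_trans (dist_le_dlen (ray_sub rB Bb) (ray_sub rA Aa) bu av) _.
by rewrite ler_nat; lia.
Qed.

Lemma dlen_simplex s u v : simplex s -> s u -> s v -> (dlen u v <= 2)%N.
Proof.
move=> ss su sv; have [Sys HS] := bld_apartments Delta.
have [phi [c [_ [och /cox_simplexP[_ cc] _ cE _]]]] := ochart_ex HS ss ss.
move: su sv; rewrite -cE => -[a ca <-] [b cb <-].
rewrite -lez_nat (dlen_ochart HS) // /cdist; have := cc _ _ ca cb; rewrite /cadj; lia.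
Qed.

(** The extra 2 bridges two vertices supporting the same point of [B]. *)
Lemma near_trans K L A B C : ray B -> close_by K A B -> close_by L B C -> close_by (K + 2 + L) A C.
Proof.
move=> rB h1 h2 a Aa; have [b Bb [u [v [au bv uv]]]] := h1 _ Aa.
have [c Cc [u' [v' [bu' cv' uv']]]] := h2 _ Bb; exists c => //; exists u, v'; split=> //.
have [_ sb _] := ray_sub rB Bb; have := dlen_simplex sb bv bu'.
by have := dlen_tri u v v'; have := dlen_tri v u' v'; lia.
Qed.

Lemma near_le K L A B : (K <= L)%N -> close_by K A B -> close_by L A B.
Proof.
move=> KL h a /h[b Bb [u [v [au bv uv]]]]; exists b => //; exists u, v; split=> //.
exact: leq_trans KL.
Qed.

Lemma parallel_trans A B C : ray A -> ray B -> ray C ->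
  parallel A B -> parallel B C -> parallel A C.
Proof.
move=> rA rB rC /(parallel_near rA rB)[K [h1 h2]] /(parallel_near rB rC)[L [h3 h4]].
apply: (@near_parallel (maxn (K + 2 + L) (L + 2 + K))) => //.
  by apply: near_le (near_trans rB h1 h3); exact: leq_maxl.
by apply: near_le (near_trans rB h4 h2); exact: leq_maxr.
Qed.

Lemma parallelC A B : ray A -> ray B -> parallel A B -> parallel B A.
Proof.
by move=> rA rB /(parallel_near rA rB)[K [h1 h2]]; exact: near_parallel h2 h1.
Qed.

Lemma near_ray_of w w' K : sray w -> sray w' ->
  (forall i, (dlen (w i) (w' i) <= K)%N) -> close_by K (ray_of w) (ray_of w').
Proof.
move=> sw sw' h a /(ray_of_supp sw)[n an]; exists (vertex_pt R (w' n)).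
  exact: ray_of_vertex.
by exists (w n), (w' n); split=> //; apply/supp_vertex.
Qed.

Lemma parallel_ray_of w w' K : sray w -> sray w' ->
  (forall i, (dlen (w i) (w' i) <= K)%N) -> parallel (ray_of w) (ray_of w').
Proof.
move=> sw sw' h; apply: (@near_parallel (2 * K)).
- exact: ray_of_ray.
- exact: ray_of_ray.
- by apply: (@near_le K); [lia|exact: near_ray_of].
- apply: near_ray_of => // i; apply: leq_trans (dlen_rev _ _) _.
  by rewrite leq_mul2l /=.
Qed.

End Rays.

Lemma cox_simplex_seq c : cox_simplex c -> exists l : seq cox_vertex, forall z, c z <-> z \in l.
Proof.
move=> [_ [c' [z cE] sub]]; exists [seq u <- [:: z; z + (1, 0); z + (0, 1); z + (1, 1)] | `[< c u >]].
move=> u; rewrite mem_filter; split; last by move=> /andP[/asboolP].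
move=> cu; apply/andP; split; first exact/asboolP.
by have := sub _ cu; case: cE => -> [[->|->]|->]; rewrite !inE eqxx ?orbT.
Qed.

Lemma caut_line z e : e \in pdirs ->
  exists2 g, caut g & forall i : nat, g (i%:Z, 0) = clin z e i.
Proof.
move=> ep; have [r cr rE] : exists2 r, caut r & forall i : nat,
    r (i%:Z, 0) = (i%:Z * e.1, i%:Z * e.2).
  move: ep; rewrite !inE => /or3P[]/eqP ->.
  - exists id; first by exists id; split=> //; split; exact: cmorph_id.
    by move=> i; apply: pair_int_eq => /=; lia.
  - exists crot; first exact: caut_crot.
    by move=> i; apply: pair_int_eq => /=; lia.
  - exists (crot \o crot); first exact: caut_comp caut_crot caut_crot.
    by move=> i; apply: pair_int_eq => /=; lia.
exists (ctrans z \o r); first exact: caut_comp (caut_ctrans z) cr.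
by move=> i /=; rewrite rE; apply: pair_int_eq => /=; lia.
Qed.

(** Fix a point off a line l0. Every other point lies on the line joining the fixed point to one of
    the finitely many points of l0. *)
Lemma plane_finite (P L : Type) (inc : P -> L -> Prop) n :
  projective_plane inc n -> finite_set [set: P].
Proof.
move=> [jn mt [p pi pq] cd].
have fl l : finite_set [set x | inc x l] by exists n.+1; exact: cd l.
pose i0 : 'I_4 := ord0; pose i1 : 'I_4 := inord 1; pose i2 : 'I_4 := inord 2.
have [e0 [e1 e2]] : nat_of_ord i0 = 0%N /\ nat_of_ord i1 = 1%N /\ nat_of_ord i2 = 2%N.
  by rewrite /= !inordK.
have p12 : p i1 <> p i2 by move/pi/(congr1 val); rewrite /= e1 e2.
have [l0 [[h1 h2] _]] := jn _ _ p12.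
have n0 : ~ inc (p i0) l0.
  move=> h0; apply: (pq l0 i0 i1 i2) => //.
  by rewrite /= !inE -!val_eqE /= e1 e2.
have /choice[Lm LmE] : forall m, exists l, p i0 <> m -> inc (p i0) l /\ inc m l.
  move=> m; have [E|ne] := pselect (p i0 = m); first by exists l0.
  by have [l [hl _]] := jn _ _ ne; exists l.
apply: (@sub_finite_set _ _ ([set p i0] `|`
    \bigcup_(m in [set x | inc x l0]) [set x | inc x (Lm m)])).
  move=> y _; have [->|ne] := pselect (y = p i0); [by left|right].
  have [l [[l1 l2] _]] := jn _ _ (not_eq_sym ne).
  have ll0 : l <> l0 by move=> E; apply: n0; rewrite -E.
  have [m [[m1 m2] _]] := mt _ _ ll0; exists m => //=.
  have nm : p i0 <> m by move=> E; apply: n0; rewrite E.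
  have [k1 k2] := LmE _ nm; have [l' [_ lu]] := jn _ _ nm.
  by rewrite -(lu (Lm m)) // (lu l).
rewrite finite_setU; split; first exact: finite_set1.
exact: bigcup_finite.
Qed.

Lemma ultra_finite (I : Type) (T : eqType) (U : set_system I) (f : I -> T) (l : seq T) :
  UltraFilter U -> U [set n | f n \in l] -> exists v, U [set n | f n = v].
Proof.
move=> UU; elim: l => [|a l IH] Ul.
  by have [n] := @filter_ex _ U _ _ Ul; rewrite /= in_nil.
have [|na] := in_ultra_setVsetC [set n | f n = a] UU; first by exists a.
apply: IH; apply: filterS (filterI Ul na) => n [/=].
by rewrite inE => /orP[/eqP ->|].
Qed.

(** * Walls *)

Section LimitApartment.
Variables (q : nat) (Delta : A2_building q).
Local Notation V := (vertex Delta).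
Implicit Types (u v x y : V) (phi psi : cox_vertex -> V) (w : nat -> V).
Variable Sys : set (set (set V)).
Hypothesis HS : apartment_system (@simplex q Delta) Sys.

Definition local_chart phi := forall l : seq cox_vertex,
  exists2 psi, schart Sys psi & {in l, forall z, psi z = phi z}.

Definition local_system : set (set (set V)) :=
  [set A | exists2 phi, is_chart A phi & local_chart phi].

(** Each axiom involves finitely many vertices at a time, so it passes from charts of [Sys] to maps
    agreeing with such charts on every finite set. *)
Lemma local_system_apartment : apartment_system (@simplex q Delta) local_system.
Proof.
split.
- move=> A [phi ch lc]; split; last by exists phi.
  move=> _ /(chartP _ ch)[c cc <-]; have [l lE] := cox_simplex_seq cc.
  have [psi cpsi E] := lc l.
  rewrite (_ : phi @` c = psi @` c); first exact: schart_simplex HS _ _ cpsi cc.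
  by apply: eq_imagel => z /lE zl; rewrite E.
- move=> s t ss st; have [_ H1 _] := HS; have [A [SA As At]] := H1 _ _ ss st.
  exists A; split=> //; have [H0 _ _] := HS; have [_ [phi ch]] := H0 _ SA.
  by exists phi => // l; exists phi => //; exists A.
- move=> A A' s t [phi ch lc] [phi' ch' lc'].
  move=> /(chartP _ ch)[c1 cc1 E1] /(chartP _ ch)[c2 cc2 E2].
  move=> /(chartP _ ch')[d1 cd1 F1] /(chartP _ ch')[d2 cd2 F2].
  have [l1 l1E] := cox_simplex_seq cc1; have [l2 l2E] := cox_simplex_seq cc2.
  have [m1 m1E] := cox_simplex_seq cd1; have [m2 m2E] := cox_simplex_seq cd2.
  have [psi cpsi E] := lc (l1 ++ l2); have [psi' cpsi' F] := lc' (m1 ++ m2).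
  have Ec z : (c1 `|` c2) z -> psi z = phi z.
    by move=> [/l1E|/l2E] zl; apply: E; rewrite mem_cat zl ?orbT.
  have Fd z : (d1 `|` d2) z -> psi' z = phi' z.
    by move=> [/m1E|/m2E] zl; apply: F; rewrite mem_cat zl ?orbT.
  have [||g cg gE] := schart_compat HS cpsi cpsi' cc1 cc2 cd1 cd2.
  + transitivity s; [rewrite -E1|rewrite -F1]; apply: eq_imagel => z zc.
      by apply: Ec; left.
    by rewrite Fd //; left.
  + transitivity t; [rewrite -E2|rewrite -F2]; apply: eq_imagel => z zc.
      by apply: Ec; right.
    by rewrite Fd //; right.
  exists phi, (phi' \o g); split=> //; first exact: chart_comp ch' cg.
  move=> z stz.
  have cz : (c1 `|` c2) z.
    by case: stz; rewrite -?E1 -?E2 => -[u cu /(proj1 ch) <-]; [left|right].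
  have dz : (d1 `|` d2) (g z).
    have -> : (d1 `|` d2) (g z) = (psi' @` (d1 `|` d2)) (psi' (g z)).
      apply/propext; split=> [h|[u du /(schart_inj cpsi') <-//]]; by exists (g z).
    rewrite gE // Ec // image_setU.
    have -> : psi' @` d1 = s by rewrite -F1; apply: eq_imagel => u du; apply: Fd; left.
    have -> : psi' @` d2 = t by rewrite -F2; apply: eq_imagel => u du; apply: Fd; right.
    exact: stz.
  by rewrite /= -Fd // gE // Ec.
Qed.

End LimitApartment.

Arguments ray_of R {q Delta} w.

Lemma zero_one_Z3 : (1 : 'Z_3) <> 0.
Proof. by []. Qed.

Section WallCharts.
Variables (q : nat) (Delta : A2_building q).
Local Notation V := (vertex Delta).
Implicit Types (u v x y : V) (phi psi : cox_vertex -> V) (w : nat -> V).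

Lemma out_edges_finite x : finite_set [set y | directed_edge x y].
Proof.
have /plane_finite fin := bld_link x.
apply: (@sub_finite_set _ _ (sval @` [set: {y | edge_of (@simplex q Delta) (@tau q Delta) x y}])).
  by move=> y xy; exists (exist _ y xy).
exact: finite_image.
Qed.

Lemma dwalk_finite n x : finite_set [set y | dwalk n x y].
Proof.
elim: n x => [|n IH] x /=.
  by apply: (@sub_finite_set _ _ [set x]); [move=> y /= ->|exact: finite_set1].
apply: (@sub_finite_set _ _ (\bigcup_(u in [set u | directed_edge x u]) [set y | dwalk n u y])).
  by move=> y [u xu uy]; exists u.
by apply: bigcup_finite => //; exact: out_edges_finite.
Qed.

Lemma ball_finite N x : finite_set [set y | (dlen x y <= N)%N].
Proof.
apply: (@sub_finite_set _ _ (\bigcup_(n in `I_N.+1) [set y | dwalk n x y])).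
  by move=> y /= yN; exists (dlen x y); [rewrite /= ltnS|exact: dlen_walk].
by apply: bigcup_finite => [|n _]; [exact: finite_II|exact: dwalk_finite].
Qed.

(** A bound independent of the chart, so that the values at [z] of charts sharing an origin stay in
    a finite ball. The two summands account for the two orientations. *)
Lemma chart_ball Sys phi z : apartment_system (@simplex q Delta) Sys -> schart Sys phi ->
  (dlen (phi 0%R) (phi z) <= `|cdist 0%R z| + `|cdist 0%R (cneg z)|)%N.
Proof.
move=> HS ch; have [och|och] := schart_orient HS ch.
  by have := dlen_ochart HS 0 z och; lia.
have := dlen_ochart HS 0 (cneg z) och; rewrite /=.
have -> : cneg (cneg z) = z by apply: pair_int_eq; rewrite /= opprK.
rewrite (_ : cneg 0 = 0) //; lia.
Qed.

(* Charts through longer and longer initial parts of the ray converge along *)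
(* an ultrafilter, as balls are finite.                                     *)
Lemma sray_wall w : sray w -> exists Sys phi,
  [/\ apartment_system (@simplex q Delta) Sys, schart Sys phi &
      forall i : nat, phi (i%:Z, 0) = w i].
Proof.
move=> sw; have [Sys HS] := bld_apartments Delta.
have /choice[f fP] : forall n, exists phi, schart Sys phi /\
    forall i, (i <= n)%N -> phi (i%:Z, 0) = w i.
  move=> n; have [phi [c [d [och _ _ cE dE]]]] := ochart_ex HS (simplex1 (w 0%N)) (simplex1 (w n)).
  have : [set w 0%N] (w 0%N) by []; rewrite -cE => -[z _ zE].
  have : [set w n] (w n) by []; rewrite -dE => -[z' _ z'E].
  have nn : (0 <= n <= n)%N by rewrite leqnn.
  have [e ep wl] := spath_chart HS och (sray_spath n sw) nn zE z'E.
  have [g cg gE] := caut_line z ep; exists (phi \o g); split.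
    exact: schart_comp (proj1 och) cg.
  by move=> i ni; rewrite /= gE wl // subn0.
have [U [UU Uoo]] := @ultraFilterLemma nat \oo _.
have /choice[phi phiP] : forall z, exists v, U [set n | f n z = v].
  move=> z; have fin := ball_finite (`|cdist 0%R z| + `|cdist 0%R (cneg z)|) (w 0%N).
  apply: (ultra_finite (l := fset_set [set y | (dlen (w 0%N) y <=
      `|cdist 0%R z| + `|cdist 0%R (cneg z)|)%N])) => //.
  apply: filterE => n /=; rewrite in_fset_set // inE /=; have [ch E] := fP n.
  by rewrite -(E 0%N) //; exact: chart_ball HS ch.
have UF : Filter U by exact: filter_filter.
have loc (l : seq cox_vertex) (N : nat) : exists n, (N <= n)%N /\ {in l, forall z, f n z = phi z}.
  have : U [set n | (N <= n)%N /\ {in l, forall z, f n z = phi z}].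
    elim: l => [|z l IH].
      by apply: filterS (Uoo _ (nbhs_infty_ge N)) => n /= Nn; split.
    apply: filterS (filterI (phiP z) IH) => n /= [E [Nn El]]; split=> // u.
    by rewrite inE => /orP[/eqP ->|/El].
  by move=> /(@filter_ex _ U _)[n h]; exists n.
have phi_inj : injective phi.
  move=> z z' E; have [n [_ H]] := loc [:: z; z'] 0%N.
  by apply: (schart_inj (proj1 (fP n))); rewrite !H ?inE ?eqxx ?orbT.
exists (local_system Sys), phi; split.
- exact: local_system_apartment.
- exists [set phi @` s | s in cox_simplex]; last by split.
  exists phi; first by split.
  by move=> l; have [n [_ H]] := loc l 0%N; exists (f n) => //; have [] := fP n.
- move=> i; have [n [ni H]] := loc [:: (i%:Z, 0)] i.
  by rewrite -H ?inE //; have [_ E] := fP n; exact: E.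
Qed.

End WallCharts.

(** * The minimal boundary *)

Section MinimalBoundary.
Variables (R : realType) (q : nat) (Delta : A2_building q).
Local Notation V := (vertex Delta).
Implicit Types (u v x y : V) (phi psi : cox_vertex -> V) (w : nat -> V)
  (p : V -> R) (B : set (V -> R)) (xi : minimal_boundary R Delta).

Definition directs w xi :=
  sray w /\ forall B, mb_class xi B <-> ray B /\ parallel (ray_of R w) B.

Lemma sector_wall1_ray_of phi w : sray w -> injective phi ->
  (forall i : nat, phi (i%:Z, 0) = w i) -> sector_wall1 phi = ray_of R w.
Proof.
move=> sw pi wE; apply/seteqP; split=> p.
  move=> [rp [s [/cox_simplexP[[z0 sz0] cs] sD ps]]].
  have [m mP] : exists m : nat, s `<=` [set (m%:Z, 0); (m.+1%:Z, 0)].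
    have [h2 h1] := sD _ sz0; have [n nE] : exists n : nat, z0 = (n%:Z, 0).
      by exists `|z0.1|%N; apply: pair_int_eq; rewrite //= gez0_abs.
    have [[n1 sn1]|nn] := pselect (exists k : nat, s (k%:Z, 0) /\ n = k.+1).
      exists n1 => z sz; have [k2 k1] := sD _ sz.
      have := cs _ _ sz0 sz; have := cs _ _ (proj1 sn1) sz.
      rewrite nE (proj2 sn1) /cadj /= => a1 a2.
      have [e|e] : z.1 = n1%:Z \/ z.1 = n1.+1%:Z by lia.
        by left; apply: pair_int_eq.
      by right; apply: pair_int_eq.
    exists n => z sz; have [k2 k1] := sD _ sz.
    have := cs _ _ sz0 sz; rewrite nE /cadj /= => a1.
    have [e|[e|e]] : z.1 = n%:Z \/ z.1 = n.+1%:Z \/ z.1 + 1 = n%:Z by lia.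
    - by left; apply: pair_int_eq.
    - by right; apply: pair_int_eq.
    - case: nn; exists `|z.1|%N; split.
        by rewrite (_ : (_, _) = z) //; apply: pair_int_eq; rewrite /= ?gez0_abs.
      by apply/eqP; rewrite -eqz_nat -addn1 PoszD gez0_abs // e.
  apply: (ray_of_edge sw (n := m) rp); rewrite ps => _ [z /mP[->|->] <-].
    by left; exact: wE.
  by right; exact: wE.
move=> [t t0 <-]; split; first exact: rpt_real.
have [n [f [f01 ->]]] := rpt_split t0.
have [f0|/eqP nf] := eqVneq f 0.
  exists [set (n%:Z, 0)]; split; first exact: cox_simplex1.
    by move=> z ->.
  rewrite image_set1; apply/seteqP; split=> v.
    by move=> /(rpt_supp sw _ _ f01)[->|[]//]; rewrite /= wE.
  by move=> ->; apply/(rpt_supp sw _ _ f01); left.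
exists [set (n%:Z, 0); (n.+1%:Z, 0)]; split.
- by apply: cox_simplex2; rewrite /cadj /=; lia.
- by move=> z [] ->.
rewrite image_setU !image_set1; apply/seteqP; split=> v.
  by move=> /(rpt_supp sw _ _ f01)[->|[_ ->]]; [left|right]; rewrite /= wE.
by move=> [] ->; apply/(rpt_supp sw _ _ f01); rewrite wE; [left|right].
Qed.

(** A boundary point must come from the wall of a sector; [sray_wall] supplies one, and its first
    edge raises the type by 1, which is type 0 at infinity. *)
Lemma sray_directs w : sray w -> exists xi, directs w xi.
Proof.
move=> sw; have [Sys [phi [HS ch wE]]] := sray_wall sw.
pose X := [set B | ray B /\ parallel (ray_of R w) B].
have rw := ray_of_ray R sw.
have WX : X (ray_of R w).
  by split=> //; apply: (parallel_ray_of R (K := 0) sw sw) => i; rewrite dlen0.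
have X0 : infinity_vertex 0 X.
  split; first by exists (ray_of R w).
  exists (w 0%N), (w 1%N), (ray_of R w); split; split=> //.
  - exact: ray_of_ray_from.
  - have [A SA cA] := ch; exists A, phi; split=> //; first by exists Sys.
    by left; rewrite (sector_wall1_ray_of sw (proj1 cA) wE).
  - by move/eqP; rewrite sray_neqS.
  - by case: sw => /(_ 0%N)[].
  - exact: ray_of_segment.
  - by exists 1; [case: sw => /(_ 0%N)[]|rewrite subrr].
by exists (MinimalBoundary (introT (asboolP _) X0)).
Qed.

Lemma carrier_vertex phi D z : D z -> carrier R phi D (vertex_pt R (phi z)).
Proof.
move=> Dz; split; first exact: vertex_real.
exists [set z]; split; [exact: cox_simplex1|by move=> _ ->|].
by rewrite image_set1; apply/seteqP; split=> v /supp_vertex.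
Qed.

(* At an interior vertex of a wall the ray would have two points at distance *)
(* 1 from its origin; hence the origin is the tip of the sector, and the      *)
(* type of the first edge orients the wall.                                   *)
Lemma wall_sray Sys phi (e : cox_vertex) (D : set cox_vertex) x y :
  apartment_system (@simplex q Delta) Sys -> schart Sys phi ->
  e \in [:: (1, 0); (1, 1)] ->
  (forall z, D z <-> exists n, z = clin 0 e n) ->
  ray_from (vertex_pt R x) (carrier R phi D) ->
  x <> y -> simplex [set x; y] -> segment R x y `<=` carrier R phi D ->
  tau y = tau x + 1 ->
  exists w, [/\ sray w, close_by 0 (carrier R phi D) (ray_of R w) &
                close_by 0 (ray_of R w) (carrier R phi D)].
Proof.
move=> HS ch eE DE [rho [r1 r2 r3 WE]] ne sxy segW txy.
have pi := schart_inj ch; pose w n := phi (clin 0 e n).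
have eadj n : cadj (clin 0 e n) (clin 0 e n.+1).
  by move: eE; rewrite !inE => /orP[]/eqP ->; rewrite /cadj /=; lia.
have eadj2 n : ~~ cadj (clin 0 e n) (clin 0 e n.+2).
  by move: eE; rewrite !inE => /orP[]/eqP ->; rewrite /cadj /=; lia.
have cinj m n : clin 0 e m = clin 0 e n -> m = n.
  by move: eE; rewrite !inE => /orP[]/eqP -> => /(congr1 fst) /=; lia.
have cadjE m n : cadj (clin 0 e m) (clin 0 e n) -> m <> n -> m = n.+1 \/ n = m.+1.
  by move: eE; rewrite !inE => /orP[]/eqP ->; rewrite /cadj /=; lia.
have Wv v : carrier R phi D (vertex_pt R v) -> exists n, v = w n.
  move=> [_ [s [_ sD sE]]]; have : supp (vertex_pt R v) v by apply/supp_vertex.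
  by rewrite sE => -[z /sD/DE[n ->] <-]; exists n.
have wW n : carrier R phi D (vertex_pt R (w n)).
  by apply: carrier_vertex; apply/DE; exists n.
have [i xE] : exists i, x = w i.
  by apply/Wv/segW; split; [exact: vertex_real|move=> v /supp_vertex ->; left].
have [j yE] : exists j, y = w j.
  by apply/Wv/segW; split; [exact: vertex_real|move=> v /supp_vertex ->; right].
have swS n : simplex [set w n; w n.+1] by exact: schart_simplex2 HS _ _ _ ch (eadj n).
have wne m n : m <> n -> w m <> w n by move=> mn /pi/cinj.
have i0 : i = 0%N.
  case: i xE => // i xE.
  have t1 v : carrier R phi D (vertex_pt R v) -> simplex [set x; v] -> x <> v ->
      rho 1 = vertex_pt R v.
    rewrite {1}WE => -[t t0 tE] sxv xv; have := r3 0 t (lexx 0) t0.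
    by rewrite r2 tE dist_adj // sub0r normrN ger0_norm // => ->.
  have h1 := t1 _ (wW i.+2); have h2 := t1 _ (wW i).
  have E : vertex_pt R (w i.+2) = vertex_pt R (w i).
    have s2 : simplex [set x; w i] by rewrite xE; exact/simplex2C.
    have s1 : simplex [set x; w i.+2] by rewrite xE.
    have n1 : x <> w i.+2 by rewrite xE; apply: wne; lia.
    have n2 : x <> w i by rewrite xE; apply: wne; lia.
    by rewrite -(h1 s1 n1) (h2 s2 n2).
  by move/vertex_pt_inj: E => /wne; case; lia.
subst i; have j1 : j = 1%N.
  have := schart_full HS ch (z := clin 0 e 0) (w := clin 0 e j).
  rewrite -[phi _]/(w 0%N) -[phi (clin 0 e j)]/(w j) -xE -yE => /(_ sxy)/cadjE.
  by case=> //; move=> j0; apply: ne; rewrite xE yE -j0.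
have [s _ sE] := schart_type HS ch.
have tS n : tau (w n.+1) = tau (w n) + 1.
  have t0 : tau (w 1%N) = tau (w 0%N) + 1 by subst j; rewrite -xE -yE.
  move: t0; rewrite /w !(sE (clin _ _ _)); rewrite -!addrA => /addrI.
  move: eE; rewrite !inE => /orP[]/eqP -> /=;
    rewrite ?(mulr0, mulr1, add0r, mulr0z, addr0, mul1r) ?mulr1z => E.
    by congr (_ + _); rewrite -E -[n.+1]addn1 PoszD mulrzDr.
  congr (_ + _); rewrite -E -[n.+1]addn1 PoszD !mulrzDr !addrA; congr (_ + _).
  by rewrite addrAC.
have sw : sray w.
  split=> n; first by split.
  move=> h; have/negP := eadj2 n; apply; apply: (schart_full HS ch).
  exact/simplex2C/(simplex3_31 h).
exists w; split=> // p.
  move=> [rp [s' [/cox_simplexP[[z sz] _] sD ps]]].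
  have /DE[n zE] := sD _ sz; exists (vertex_pt R (w n)); first exact: ray_of_vertex.
  exists (w n), (w n); rewrite dlen0; split=> //; last exact/supp_vertex.
  by rewrite ps; exists z; rewrite // zE.
move=> /(ray_of_supp sw)[n pn]; exists (vertex_pt R (w n)) => //.
by exists (w n), (w n); rewrite dlen0; split=> //; exact/supp_vertex.
Qed.

(** Type 0 means that the first edge of the defining wall raises the type by 1, so [wall_sray]
    applies. Both walls of a sector occur: edges along (1, 1) raise the type by 1 when the chart has
    the negative orientation. *)
Lemma directs_ex xi : exists w, directs w xi.
Proof.
have /asboolP[[A rA XE] [x [y [W [[XW rW [A' [phi [[Sys HS SA] cA WE]]]] [ne sxy segW [i ti i1]]]]]]] := mb_vertex xi.
have txy : tau y = tau x + 1.
  by rewrite ti; congr (_ + _); apply/eqP; rewrite -subr_eq0 -i1.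
have ch : schart Sys phi by exists A'.
have [w [sw n1 n2]] : exists w, [/\ sray w, close_by 0 W (ray_of R w) & close_by 0 (ray_of R w) W].
  case: WE => WE; rewrite WE in rW segW *.
    apply: (wall_sray (e := (1, 0)) HS ch _ _ rW ne sxy segW txy) => // z.
    split=> [[z2 z1]|[n ->]]; last by rewrite /= ?mulr0 ?mulr1 ?add0r.
    by exists `|z.1|%N; apply: pair_int_eq; rewrite /= add0r gez0_abs ?mulr1 ?mulr0.
  apply: (wall_sray (e := (1, 1)) HS ch _ _ rW ne sxy segW txy) => // z.
  split=> [[z2 z1]|[n ->]]; last by rewrite /= ?mulr0 ?mulr1 ?add0r.
  by exists `|z.1|%N; apply: pair_int_eq; rewrite /= add0r gez0_abs ?mulr1 ?mulr0.
have rWr : ray W by exists (vertex_pt R x).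
have rw := ray_of_ray R sw.
have Ww : parallel W (ray_of R w) by exact: near_parallel n1 n2.
have AW : parallel A W by move: XW; rewrite XE => -[].
exists w; split=> // B; rewrite XE; split=> -[rB hB]; split=> //.
  apply: (parallel_trans rw rA rB) hB; apply: parallelC => //.
  exact: parallel_trans AW Ww.
exact: (parallel_trans rA rw rB (parallel_trans rA rWr rw AW Ww) hB).
Qed.

End MinimalBoundary.

(** Equality case of the triangle inequality: the squared norm of (a, b) - t e is a combination of
    the given norms, and it vanishes. *)
Lemma eisen_line (R : realFieldType) (a b e1 e2 t : R) : e1 ^+ 2 + e2 ^+ 2 - e1 * e2 = 1 ->
  eisen a b = t ^+ 2 -> eisen (a - e1) (b - e2) = (t - 1) ^+ 2 ->
  a = t * e1 /\ b = t * e2.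
Proof.
move=> h1 h2 h3.
have : eisen (a - t * e1) (b - t * e2) = 0.
  have -> : eisen (a - t * e1) (b - t * e2) = eisen a b
     + t ^+ 2 * (e1 ^+ 2 + e2 ^+ 2 - e1 * e2)
     + t * (eisen (a - e1) (b - e2) - eisen a b - (e1 ^+ 2 + e2 ^+ 2 - e1 * e2)).
    by rewrite /eisen; ring.
  by rewrite h1 h2 h3; ring.
have pos (x y : R) : eisen x y = 0 -> x = 0 /\ y = 0.
  rewrite /eisen => E; have y0 : y ^+ 2 = 0 by apply/eqP; rewrite eq_le sqr_ge0 andbT; nra.
  have x0 : x ^+ 2 = 0 by apply/eqP; rewrite eq_le sqr_ge0 andbT; nra.
  by split; apply/eqP; rewrite -sqrf_eq0; apply/eqP.
by move=> /pos[/eqP + /eqP]; rewrite !subr_eq0 => /eqP -> /eqP ->.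
Qed.

(** * Horofunctions and the sets Omega *)

Section Omegas.
Variables (R : realType) (q : nat) (Delta : A2_building q).
Local Notation V := (vertex Delta).
Implicit Types (u v x y : V) (phi psi : cox_vertex -> V) (w : nat -> V)
  (p : V -> R) (B : set (V -> R)) (xi : minimal_boundary R Delta).

Lemma horo_dlen b u v : horo b -> b v <= b u + (dlen u v)%:Z.
Proof.
move=> [hb _]; suff H n : forall x, dwalk n x v -> b v <= b x + n%:Z by apply/H/dlen_walk.
elim: n => [|n IH] x /=; first by move=> ->; lia.
by move=> [y /hb xy /IH]; lia.
Qed.

(** By [horo_straight], a descent on a straight line is preceded by a descent; so once [b] has risen
    it keeps rising. *)
Lemma horo_line b Sys phi z e n : apartment_system (@simplex q Delta) Sys ->
  ochart Sys phi -> e \in pdirs -> horo b ->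
  b (phi (clin z e 1)) = b (phi z) + 1 -> b (phi (clin z e n)) = b (phi z) + n%:Z.
Proof.
move=> HS och ep hb h1; pose Y n := phi (clin z e n).
have YE m : directed_edge (Y m) (Y m.+1).
  by apply/(ochart_edge HS _ _ och); rewrite -addn1 clinD; exact: clin_step.
have Y0 : Y 0%N = phi z by rewrite /Y clin0.
suff H m : b (Y m) = b (phi z) + m%:Z /\ b (Y m.+1) = b (Y m) + 1 by case: (H n).
elim: m => [|m [IH1 IH2]]; first by rewrite Y0 addr0.
split; first lia.
case: (proj1 hb _ _ (YE m.+1)) => // h.
have ns : ~ simplex [set Y m; Y m.+1; Y m.+2].
  move=> s; have/negP := clin_cadj2 z m ep; apply; apply: (schart_full HS (proj1 och)).
  exact/simplex2C/(simplex3_31 s).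
have := horo_straight hb (YE m) (YE m.+1) ns h; lia.
Qed.

(* If y is not below x, the horofunction increases along the line from x     *)
(* through y; but the ray in xi through y would force it to stay bounded.    *)
Lemma Omega_descends w xi b x y : directs w xi -> blim w b -> directed_edge x y ->
  Omega R x y xi -> b y = b x - 2.
Proof.
move=> [sw dw] bw xy [B XB [rB segB]]; have hb := blim_horo sw bw.
case: (proj1 hb _ _ xy) => // b1; exfalso.
have [rayB /parallel_near] := (dw B).1 XB.
move=> /(_ (ray_of_ray R sw) rayB)[K [_ nK]].
have [rho [r1 r2 r3 BE]] := rB; have [sxy txy] := xy.
have nxy : x <> y by move=> E; move: b1; rewrite E; lia.
have rho1 : rho 1 = vertex_pt R y.
  have : B (vertex_pt R y) by apply: segB; split; [exact: vertex_real|move=> v /supp_vertex ->; right].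
  rewrite BE => -[t t0 tE]; have := r3 0 t (lexx 0) t0.
  by rewrite r2 tE dist_adj // sub0r normrN ger0_norm // => ->.
(* The point of the ray at time m lies on the line from x through y in a chart, so a vertex of its
   support is within 3 of the vertex Y reached there. That vertex is at directed length at most 2K
   from some [w j], where [b] is at most 0; hence b Y, which is b x + m, is at most 2K + 3. *)
suff bound (m : nat) : (0 < m)%N -> b x + m%:Z <= (2 * K + 3)%N%:Z.
  by have := bound (`|b x| + 2 * K + 4)%N; lia.
move=> m0; pose p := rho m%:R.
have m0R : 0 <= m%:R :> R by rewrite ler0n.
have rp : realization p by apply: r1.
have [_ sp _] := rp; have [Sys HS] := bld_apartments Delta.
have [phi [c [d [och cc dd cE dE]]]] := ochart_ex HS sxy sp.
have ch := proj1 och; have pi := schart_inj ch.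
have : [set x; y] x by left.
have : [set x; y] y by right.
rewrite -cE => -[z1 _ z1E] [z _ zE].
have s01 : cstep z z1 by apply/(ochart_edge HS _ _ och); rewrite zE z1E.
pose e := z1 - z; have ep : e \in pdirs by exact: s01.
have z1l : z1 = clin z e 1 by apply: pair_int_eq; rewrite /= mul1r subrKC.
have cp : carried phi p by exists d.
have dx : dist p (vertex_pt R (phi z)) = m%:R.
  by rewrite zE -r2 r3 // subr0 ger0_norm.
have dy : dist p (vertex_pt R (phi z1)) = m%:R - 1.
  by rewrite z1E -rho1 r3 // ger0_norm // subr_ge0 ler1n.
have [ca1 ca2] := vertex_coord R z pi; have [cb1 cb2] := vertex_coord R z1 pi.
have e0 (s t : R) : 0 <= eisen s t by rewrite /eisen; nra.
have q1 : eisen (coord1 phi p - z.1%:~R) (coord2 phi p - z.2%:~R) = m%:R ^+ 2.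
  rewrite -dx (dist_chart HS ch cp (vertex_carried _ _ _) rp (vertex_real _ _)).
  by rewrite /flat_dist ca1 ca2 -[X in Num.sqrt X]/(eisen _ _) sqr_sqrtr.
have q2 : eisen (coord1 phi p - z.1%:~R - e.1%:~R) (coord2 phi p - z.2%:~R - e.2%:~R)
    = (m%:R - 1) ^+ 2.
  rewrite -dy (dist_chart HS ch cp (vertex_carried _ _ _) rp (vertex_real _ _)).
  rewrite /flat_dist cb1 cb2 -[X in Num.sqrt X]/(eisen _ _) sqr_sqrtr //.
  by rewrite z1l /= !mul1r !intrD !opprD !addrA.
have q3 : e.1%:~R ^+ 2 + e.2%:~R ^+ 2 - e.1%:~R * e.2%:~R = 1 :> R.
  by move: ep; rewrite !inE => /or3P[]/eqP -> /=; rewrite ?(rmorphN1, intr1); ring.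
have [x1 x2] := eisen_line q3 q1 q2.
have Bp : B p by rewrite BE; exists m%:R.
have [a Aa [u [v [pu av uv]]]] := nK _ Bp.
have [zu zuE _] := carried_ex cp pu; rewrite -zuE in pu uv *.
have [n1 n2] := coord_near pi cp rp pu.
pose Y := phi (clin z e m).
have d3 : (dlen (phi zu) Y <= 3)%N.
  have k1 : `|(clin z e m).1 - zu.1| <= 1.
    rewrite -(ler_int R) intr_norm /= intrB intrD intrM -pmulrn.
    by rewrite -x1 subrKC.
  have k2 : `|(clin z e m).2 - zu.2| <= 1.
    rewrite -(ler_int R) intr_norm /= intrB intrD intrM -pmulrn.
    by rewrite -x2 subrKC.
  by rewrite -lez_nat (dlen_ochart HS) // /cdist; lia.
have bY : b Y = b x + m%:Z.
  rewrite -zE /Y; apply: (horo_line m HS och ep hb); rewrite -z1l z1E zE; exact: b1.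
have [j vE] := ray_of_supp_inv sw Aa av.
have := blim_along j sw bw; rewrite -vE => bv.
have := horo_dlen v Y hb; have := dlen_tri v (phi zu) Y; have := dlen_rev (phi zu) v; lia.
Qed.

(** Transported to [x], the path [w] still descends; its first edge is the only descending one,
    hence ends at [y]. *)
Lemma descends_Omega w xi b x y : directs w xi -> blim w b -> directed_edge x y ->
  b y = b x - 2 -> Omega R x y xi.
Proof.
move=> [sw dw] bw xy h; have hb := blim_horo sw bw.
have [w' [sw' w'0 [c cP] [K KP]]] := transport_walk sw (dlen_walk (w 0%N) x).
have bw' := cP _ bw.
have yE : y = w' 1%N.
  apply: (horo_uniq hb xy) h _; first by rewrite -w'0; apply sw'.
  by have := blim_along 0 sw' bw'; have := blim_along 1 sw' bw'; rewrite w'0; lia.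
exists (ray_of R w'); first by apply/dw; split; [exact: ray_of_ray|exact: parallel_ray_of KP].
split; first by rewrite -w'0; exact: ray_of_ray_from.
by rewrite yE -w'0; exact: ray_of_segment.
Qed.

Lemma Omega_horo xi : exists2 b, horo b &
  forall x y, directed_edge x y -> Omega R x y xi <-> b y = b x - 2.
Proof.
have [w dw] := directs_ex xi; have sw := proj1 dw; have [b bw] := blim_ex sw.
exists b; first exact: blim_horo bw.
by move=> x y xy; split; [exact: Omega_descends bw xy|exact: descends_Omega bw xy].
Qed.

Lemma Omega_ex xi x : exists2 y, directed_edge x y & Omega R x y xi.
Proof.
have [b hb bO] := Omega_horo xi; have [_ /(_ x)[y [xy by2] _]] := hb.
by exists y => //; apply/bO.
Qed.

Lemma Omega_uniq xi x y y' : directed_edge x y -> directed_edge x y' ->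
  Omega R x y xi -> Omega R x y' xi -> y = y'.
Proof.
have [b hb bO] := Omega_horo xi => xy xy' /(bO _ _ xy) h /(bO _ _ xy') h'.
exact: horo_uniq hb xy xy' h h'.
Qed.

Lemma Omega_triangle xi x y z : directed_edge x y -> directed_edge z x ->
  simplex [set x; y; z] ->
  [\/ [/\ Omega R x y xi, ~ Omega R y z xi & ~ Omega R z x xi],
      [/\ ~ Omega R x y xi, Omega R y z xi & ~ Omega R z x xi] |
      [/\ ~ Omega R x y xi, ~ Omega R y z xi & Omega R z x xi]].
Proof.
have [b hb bO] := Omega_horo xi => xy zx s; have yz := tri_edge xy zx s.
have [[h1 h2 h3]|[h1 h2 h3]|[h1 h2 h3]] := horo_triangle hb xy zx s;
  [constructor 1|constructor 2|constructor 3]; split.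
all: by [apply/(bO _ _ xy); lia|apply/(bO _ _ yz); lia|apply/(bO _ _ zx); lia
        |move/(bO _ _ xy); lia|move/(bO _ _ yz); lia|move/(bO _ _ zx); lia].
Qed.

Lemma Omega_straight xi x y y' : directed_edge x y -> directed_edge y y' ->
  Omega R y y' xi -> Omega R x y xi <-> ~ simplex [set x; y; y'].
Proof.
have [b hb bO] := Omega_horo xi => xy yy' /(bO _ _ yy') h; split.
  by move=> /(bO _ _ xy) h'; exact: horo_next_straight hb xy yy' h' h.
by move=> ns; apply/(bO _ _ xy); exact: horo_straight hb xy yy' ns h.
Qed.

Lemma Omega_sray w : sray w -> exists xi, forall i, Omega R (w i) (w i.+1) xi.
Proof.
move=> sw; have [xi dw] := @sray_directs R _ _ _ sw; exists xi => i.
have [b bw] := blim_ex sw; apply: (descends_Omega dw bw); first by apply sw.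
rewrite !(blim_along _ sw bw); lia.
Qed.

End Omegas.

(** * Continuous functions on the minimal boundary *)

Section Characters.
Variables (R : realType) (q : nat) (Delta : A2_building q).
Local Notation V := (vertex Delta).
Local Notation CZ := (CZ R Delta).
Implicit Types (u v x y z : V) (w : nat -> V) (xi eta : minimal_boundary R Delta) (f h : CZ).

(** The default value is 0 when [f] is not continuous, so [CZ_ofE] asks for local constancy. *)
Definition CZ_of (f : minimal_boundary R Delta -> int) : CZ := insubd (0 : CZ) f.

Lemma CZ_ofE (f : minimal_boundary R Delta -> int) xi :
  (forall xi, \forall eta \near xi, f eta = f xi) -> CZ_of f xi = f xi.
Proof.
move=> /continuousZP cf; rewrite -[CZ_of f xi]/(val (CZ_of f) xi).
by rewrite /CZ_of val_insubd cf.
Qed.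

Definition evalCZ xi f : int := f xi.

Lemma evalCZ_zmod_morphism xi : zmod_morphism (evalCZ xi).
Proof. by []. Qed.

HB.instance Definition _ xi :=
  GRing.isZmodMorphism.Build CZ int (evalCZ xi) (evalCZ_zmod_morphism xi).

Lemma CZ_ext f h : (forall xi, evalCZ xi f = evalCZ xi h) -> f = h.
Proof. by move=> E; apply/val_inj/funext => xi; exact: E. Qed.

Definition out_edges x : seq V := fset_set [set y | directed_edge x y].

Lemma out_edges_uniq x : uniq (out_edges x).
Proof. exact: fset_uniq. Qed.

Lemma mem_out_edges x y : (y \in out_edges x) <-> directed_edge x y.
Proof. by rewrite in_fset_set ?inE //; exact: out_edges_finite. Qed.

Definition chi_fun x y xi : int := (`[< Omega R x y xi >] : nat)%:Z.

(** Omega (x, y) is also closed, since the other sets Omega (x, y') cover its complement. *)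
Lemma chi_cont x y xi : directed_edge x y ->
  \forall eta \near xi, chi_fun x y eta = chi_fun x y xi.
Proof.
move=> xy; have [y' xy' Oy'] := Omega_ex xi x.
have : nbhs xi (Omega R x y') by apply: open_nbhs_nbhs; split=> //; exact: open_Omega.
apply: filterS => eta Oe; rewrite /chi_fun.
suff -> : Omega R x y eta = Omega R x y xi by [].
apply/propext; split=> O.
  by rewrite (Omega_uniq xy xy' O Oe).
by rewrite (Omega_uniq xy xy' O Oy').
Qed.

Definition chi x y : CZ := CZ_of (chi_fun x y).

Lemma chiE x y xi : directed_edge x y -> evalCZ xi (chi x y) = chi_fun x y xi.
Proof. by move=> xy; apply: CZ_ofE => eta; exact: chi_cont. Qed.

Lemma CZ_cont_near f xi : \forall eta \near xi, f eta = f xi.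
Proof. by have /continuousZP := CZ_cont f; apply. Qed.

Lemma chi_sum (P : pred V) x xi y : directed_edge x y -> Omega R x y xi ->
  \sum_(y' <- out_edges x | P y') chi_fun x y' xi = (P y : nat)%:Z.
Proof.
move=> xy Oy; have ym : y \in out_edges x by apply/mem_out_edges.
have z y' : y' \in out_edges x -> y' != y -> chi_fun x y' xi = 0.
  move=> /mem_out_edges xy' ne; rewrite /chi_fun asboolF // => O.
  by move/eqP: ne; apply; exact: Omega_uniq O Oy.
rewrite big_mkcond (bigD1_seq y) ?out_edges_uniq //= big1_seq ?addr0.
  by case: (P y) => //; rewrite /chi_fun asboolT.
by move=> y' /andP[ne ym']; case: (P y') => //; exact: z.
Qed.

Lemma sum_chi x : \sum_(y <- out_edges x) chi x y = CZ_one R Delta.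
Proof.
apply: CZ_ext => xi; rewrite raddf_sum /= big_seq.
under eq_bigr => y /mem_out_edges xy do rewrite (chiE xi xy).
rewrite -big_seq; have [y xy Oy] := Omega_ex xi x.
by rewrite (chi_sum predT xy Oy) /evalCZ.
Qed.

Lemma chi_refine_eval x y xi : directed_edge x y ->
  chi_fun x y xi = \sum_(y' <- out_edges y | ~~ `[< simplex [set x; y; y'] >]) chi_fun y y' xi.
Proof.
move=> xy; have [y' yy' Oy'] := Omega_ex xi y.
rewrite (chi_sum (fun y' => ~~ `[< simplex [set x; y; y'] >]) yy' Oy') /chi_fun.
congr (Posz (nat_of_bool _)); have H := Omega_straight xy yy' Oy'.
apply/idP/idP => [/asboolP/H ns|/asboolP ns].
  by apply/asboolP.
exact/asboolP/H.
Qed.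

Lemma chi_refine x y : directed_edge x y ->
  chi x y = \sum_(y' <- out_edges y | ~~ `[< simplex [set x; y; y'] >]) chi y y'.
Proof.
move=> xy; apply: CZ_ext => xi; rewrite chiE // chi_refine_eval // raddf_sum /=.
rewrite big_seq_cond [RHS]big_seq_cond; apply: eq_bigr => y' /andP[/mem_out_edges yy' _].
by rewrite chiE.
Qed.

Lemma chi_triangle x y z : directed_edge x y -> directed_edge z x ->
  simplex [set x; y; z] -> chi x y + chi y z + chi z x = CZ_one R Delta.
Proof.
move=> xy zx s; have yz := tri_edge xy zx s; apply: CZ_ext => xi.
rewrite !raddfD /= !chiE // /chi_fun.
by case: (Omega_triangle xi xy zx s) => -[h1 h2 h3];
  do ?[rewrite (asboolT h1)|rewrite (asboolF h1)];
  do ?[rewrite (asboolT h2)|rewrite (asboolF h2)];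
  do ?[rewrite (asboolT h3)|rewrite (asboolF h3)].
Qed.

Lemma Omega_nested w i xi : sray w ->
  Omega R (w i.+1) (w i.+2) xi -> Omega R (w i) (w i.+1) xi.
Proof. by move=> [e ns] O; apply/(Omega_straight (e i) (e i.+1) O). Qed.

(** Off the ray, compare descents in the two triangles between [w] and its flanking sequence. The
    index shift absorbs the case where [y] is [w 1]. *)
Lemma Omega_transport w y : sray w -> directed_edge (w 0%N) y ->
  exists w', [/\ sray w', w' 0%N = y & forall xi i,
    Omega R (w i.+1) (w i.+2) xi -> Omega R (w' i) (w' i.+1) xi].
Proof.
move=> sw ey; have [->|ne] := pselect (y = w 1%N).
  by exists (fun i => w (1 + i)%N); split=> //; exact: sray_shift.
have [w' w'0 w'P] := line_sequence sw ey ne.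
exists w'; split=> //; first exact: flanks_sray sw w'P.
move=> xi i /(Omega_nested sw) O; have [[e1 e2 e3 s1 s2] ni] := w'P i.
have ew := (proj1 sw) i.
have notO : ~ Omega R (w' i.+1) (w i) xi.
  by case: (Omega_triangle xi ew e3 s2) => -[].
case: (Omega_triangle xi e1 e3 s1) => -[] // O'.
by case: ni; exact: Omega_uniq O' O.
Qed.

Lemma Omega_transport_walk w n x : sray w -> dwalk n (w 0%N) x ->
  exists w' k, [/\ sray w', w' 0%N = x & forall xi i,
    Omega R (w (i + k)%N) (w (i + k).+1) xi -> Omega R (w' i) (w' i.+1) xi].
Proof.
elim: n w => [|n IH] w sw /=.
  by move=> <-; exists w, 0%N; split=> // xi i; rewrite addn0.
move=> [y e yx]; have [w1 [sw1 w10 h1]] := Omega_transport sw e.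
rewrite -w10 in yx; have [w2 [k [sw2 w20 h2]]] := IH _ sw1 yx.
exists w2, k.+1; split=> // xi i; rewrite addnS => O.
exact/h2/h1.
Qed.

(** By [cvg_mb] it suffices to enter each Omega (x, y) containing [xi]. Transporting [w] to [x]
    makes Omega (x, y) the first set along the new path, and it contains a set of the old one. *)
Lemma Omega_nbhs w xi A : sray w -> (forall i, Omega R (w i) (w i.+1) xi) ->
  nbhs xi A -> exists i, Omega R (w i) (w i.+1) `<=` A.
Proof.
move=> sw Ow nA; pose F : set_system (minimal_boundary R Delta) :=
  [set B | exists i, Omega R (w i) (w i.+1) `<=` B].
have nested i k eta : Omega R (w (i + k)%N) (w (i + k).+1) eta ->
    Omega R (w i) (w i.+1) eta.
  elim: k => [|k IH]; rewrite ?addn0 // addnS => O.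
  exact/IH/(Omega_nested sw).
have FF : Filter F.
  split; first by exists 0%N.
    move=> B C [i iB] [j jC]; exists (i + j)%N => eta O; split.
      by apply/iB; exact: nested O.
    by apply/jC; rewrite addnC in O; exact: nested O.
  by move=> B C BC [i iB]; exists i; exact: subset_trans iB BC.
suff : F --> xi by move=> /(_ A nA).
apply: cvg_mb => x y xy Oxy.
have [w' [k [sw' w'0 h]]] := Omega_transport_walk sw (dlen_walk (w 0%N) x).
have yE : y = w' 1%N.
  rewrite -w'0 in xy Oxy; apply: (Omega_uniq xy _ Oxy); first by apply sw'.
  by apply: h; exact: Ow.
by exists k => eta O; rewrite yE -w'0; apply: h.
Qed.

Definition in_chi_span f := forall S : set CZ, S 0 ->
  (forall f h, S f -> S h -> S (f - h)) ->
  (forall x y, directed_edge x y -> S (chi x y)) -> S f.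

Lemma chi_span0 : in_chi_span 0.
Proof. by move=> S. Qed.

Lemma chi_spanB f h : in_chi_span f -> in_chi_span h -> in_chi_span (f - h).
Proof. by move=> sf sh S S0 SB Sc; apply: (SB); [exact: sf|exact: sh]. Qed.

Lemma chi_spanN f : in_chi_span f -> in_chi_span (- f).
Proof. by move=> sf; rewrite -sub0r; exact: chi_spanB chi_span0 sf. Qed.

Lemma chi_spanD f h : in_chi_span f -> in_chi_span h -> in_chi_span (f + h).
Proof. by move=> sf /chi_spanN sh; rewrite -[h]opprK; exact: chi_spanB. Qed.

Lemma chi_span_mulrz f (k : int) : in_chi_span f -> in_chi_span (f *~ k).
Proof.
move=> sf; have P (n : nat) : in_chi_span (f *+ n).
  by elim: n => [|n IH]; [exact: chi_span0|rewrite mulrS; exact: chi_spanD sf IH].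
by case: k => n; [exact: P|rewrite NegzE mulrNz; exact: chi_spanN (P n.+1)].
Qed.

Lemma chi_span_sum (I : Type) (r : seq I) (P : pred I) (F : I -> CZ) :
  (forall i, P i -> in_chi_span (F i)) -> in_chi_span (\sum_(i <- r | P i) F i).
Proof.
by move=> FP; exact: (big_ind in_chi_span chi_span0 chi_spanD FP).
Qed.

Definition restrict f x y : CZ := CZ_of (fun xi => f xi * chi_fun x y xi).

Lemma restrictE f x y xi : directed_edge x y ->
  evalCZ xi (restrict f x y) = f xi * chi_fun x y xi.
Proof.
move=> xy; apply: CZ_ofE => eta.
by apply: filterS2 (CZ_cont_near f eta) (chi_cont eta xy) => ? -> ->.
Qed.

Lemma restrict_sum f x : f = \sum_(y <- out_edges x) restrict f x y.
Proof.
apply: CZ_ext => xi; rewrite raddf_sum /= big_seq.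
under eq_bigr => y /mem_out_edges xy do rewrite restrictE //.
rewrite -big_seq -mulr_sumr; have [y xy Oy] := Omega_ex xi x.
by rewrite (chi_sum predT xy Oy) mulr1.
Qed.

Lemma restrict_refine f x y : directed_edge x y -> restrict f x y =
  \sum_(y' <- out_edges y | ~~ `[< simplex [set x; y; y'] >]) restrict f y y'.
Proof.
move=> xy; apply: CZ_ext => xi; rewrite restrictE // chi_refine_eval // raddf_sum /=.
rewrite mulr_sumr big_seq_cond [RHS]big_seq_cond.
by apply: eq_bigr => y' /andP[/mem_out_edges yy' _]; rewrite restrictE.
Qed.

Lemma sum_not_span (I : eqType) (r : seq I) (P : pred I) (F : I -> CZ) :
  ~ in_chi_span (\sum_(i <- r | P i) F i) ->
  exists i, [/\ i \in r, P i & ~ in_chi_span (F i)].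
Proof.
move=> ns; apply: contrapT => ne; apply: ns; rewrite big_seq_cond.
apply: chi_span_sum => i /andP[ir Pi]; apply: contrapT => ns; apply: ne.
by exists i.
Qed.

(* Otherwise some restriction to an Omega set is not in the span, hence one   *)
(* to a smaller one, and so on along a ray; its end is a boundary point near  *)
(* which the function is constant.                                            *)
Lemma chi_span_all f : in_chi_span f.
Proof.
apply: contrapT => nf; have [x0 _] := bld_nonempty Delta.
pose bad (e : V * V) := directed_edge e.1 e.2 /\ ~ in_chi_span (restrict f e.1 e.2).
rewrite (restrict_sum f x0) in nf; have [y [/mem_out_edges oy _ nby]] := sum_not_span nf.
have /choice[F FP] : forall e : V * V, exists y', bad e ->
    bad (e.2, y') /\ ~ simplex [set e.1; e.2; y'].
  move=> [x1 y1]; have [[/= e1 ns]|nb] := pselect (bad (x1, y1)); last by exists x0.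
  rewrite (restrict_refine _ e1) in ns.
  have [y' [/mem_out_edges yy' /asboolP nsi ny]] := sum_not_span ns.
  by exists y'; move=> _; split.
pose E := fix g n := if n is m.+1 then ((g m).2, F (g m)) else (x0, y).
have EP n : bad (E n) by elim: n => [|n IH] //; exact: (FP _ IH).1.
pose w n := (E n).1.
have E2 n : (E n).2 = w n.+1 by [].
have sw : sray w.
  split=> n; first by have [] := EP n.
  exact: (FP _ (EP n)).2.
have [xi Oxi] := @Omega_sray R _ _ _ sw.
have [n sub] := Omega_nbhs sw Oxi (CZ_cont_near f xi).
have [e ns] := EP n; apply: ns.
rewrite (_ : restrict _ _ _ = chi (E n).1 (E n).2 *~ f xi).
  by apply: chi_span_mulrz => S _ _; exact.
apply: CZ_ext => eta; rewrite restrictE // raddfMz /= chiE // /chi_fun.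
have [isO|nO] := pselect (Omega R (E n).1 (E n).2 eta).
  by rewrite asboolT // mulr1 (sub _ isO) intz.
by rewrite asboolF // mulr0 mul0rz.
Qed.

End Characters.

(** * Incidence matrices *)

Section IncidenceAlgebra.
Variables (n q : nat) (N : 'I_n -> 'I_n -> bool).
Hypothesis q1 : (1 < q)%N.
Hypothesis n_gt0 : (0 < n)%N.
Hypothesis rowN : forall i, (\sum_j N i j)%N = q.+1.
Hypothesis meetN : forall i j, i != j -> (\sum_k N i k * N j k)%N = 1%N.

Definition incmx (F : nzRingType) : 'M[F]_n := \matrix_(i, j) (N i j)%:R.

Lemma incmx_gram (F : nzRingType) :
  incmx F *m (incmx F)^T = q%:R%:M + const_mx 1.
Proof.
apply/matrixP => i j; rewrite !mxE.
transitivity ((\sum_k N i k * N j k)%N%:R : F).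
  by rewrite natr_sum; apply: eq_bigr => k _; rewrite !mxE natrM.
have [<-|ij] := eqVneq i j.
  rewrite mulr1n natr1 -(rowN i); congr _%:R.
  by apply: eq_bigr => k _; case: (N i k).
by rewrite mulr0n add0r meetN.
Qed.

Lemma row_sqr_eq0 (v : 'rV[rat]_n) : v *m v^T = 0 -> v = 0.
Proof.
move=> /matrixP/(_ 0 0); rewrite !mxE => E; apply/rowP => i; rewrite mxE.
have : \sum_j v 0 j ^+ 2 = 0.
  by rewrite -[RHS]E; apply: eq_bigr => j _; rewrite mxE expr2.
move=> /eqP; rewrite psumr_eq0 => [/allP/(_ i)|j _]; last exact: sqr_ge0.
by rewrite mem_index_enum sqrf_eq0 => /(_ isT)/eqP.
Qed.

(** Reads A A^T = q + J as a quadratic form: |vA|^2 is q|v|^2 plus the square of the sum of [v]. *)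
Lemma incmx_norm (v : 'rV[rat]_n) :
  ((v *m incmx rat) *m (v *m incmx rat)^T) 0 0 =
  q%:R * (v *m v^T) 0 0 + (\sum_j v 0 j) ^+ 2.
Proof.
rewrite trmx_mul mulmxA -(mulmxA v) incmx_gram mulmxDr mulmxDl mul_mx_scalar.
rewrite -scalemxAl mxE [in LHS]mxE; congr (_ + _).
rewrite mxE expr2 mulr_sumr; apply: eq_bigr => j _; rewrite !mxE; congr (_ * _).
by apply: eq_bigr => k _; rewrite mxE mulr1.
Qed.

(** [incmx_norm] gives a^2 |v|^2 >= q |v|^2. Taking a = 0 makes A invertible, and a = -1 makes 1 + A
    invertible. *)
Lemma incmx_eq0 (v : 'rV[rat]_n) (a : rat) : a ^+ 2 < q%:R ->
  v *m incmx rat = a *: v -> v = 0.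
Proof.
move=> aq E; apply: row_sqr_eq0; apply/matrixP => i j; rewrite !ord1 [RHS]mxE.
have := incmx_norm v; rewrite E linearZ /= -scalemxAl -scalemxAr scalerA [LHS]mxE.
have p0 : 0 <= (v *m v^T) 0 0.
  by rewrite mxE sumr_ge0 // => k _; rewrite mxE -expr2 sqr_ge0.
move: aq p0 (sqr_ge0 (\sum_j v 0 j)); rewrite expr2.
move: (_ *m _) (\sum_j _) => P S aq p0 s0 h.
by apply/eqP; rewrite eq_le p0 andbT; nra.
Qed.

Lemma incmx_unit (F := rat) : incmx F \in unitmx.
Proof.
rewrite unitmxE unitfE; apply/negP => /det0P[v v0 E]; case/eqP: v0.
by apply: (@incmx_eq0 v 0); rewrite ?scale0r // expr0n ltr0n ltnW.
Qed.

(* A A^T = q + J and A J = (q + 1) J with A invertible, hence A^T J is a     *)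
(* multiple of J.                                                            *)
Lemma incmx_colsum : n = (q ^ 2 + q + 1)%N /\ forall j, (\sum_i N i j)%N = q.+1.
Proof.
pose A := incmx rat; pose j1 : 'cV[rat]_n := const_mx 1.
have Aj : A *m j1 = q.+1%:R *: j1.
  apply/matrixP => i k; rewrite !mxE mulr1 -(rowN i) natr_sum.
  by apply: eq_bigr => m _; rewrite !mxE mulr1.
have AAj : A *m (A^T *m j1) = (q + n)%:R *: j1.
  rewrite mulmxA incmx_gram mulmxDl mul_scalar_mx natrD scalerDl; congr (_ + _).
  apply/matrixP => i k; rewrite !mxE mulr1 -[n in RHS]card_ord -sumr_const.
  by apply: eq_bigr => m _; rewrite !mxE mulr1.
have q0 : q.+1%:R != 0 :> rat by rewrite pnatr_eq0.
pose r : rat := (q + n)%:R / q.+1%:R.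
have ATj : A^T *m j1 = r *: j1.
  apply: (can_inj (mulKmx incmx_unit)); rewrite -/A AAj -scalemxAr Aj scalerA.
  by rewrite divfK.
have cs j : (\sum_i N i j)%N%:R = r.
  have /matrixP/(_ j 0) := ATj; rewrite !mxE mulr1 => <-; rewrite natr_sum.
  by apply: eq_bigr => i _; rewrite !mxE mulr1.
have tot : (n * q.+1)%N%:R = n%:R * r.
  have -> : (n * q.+1)%N = (\sum_i \sum_j N i j)%N.
    by rewrite (eq_bigr _ (fun i _ => rowN i)) sum_nat_const card_ord.
  rewrite exchange_big /= natr_sum.
  under eq_bigr => j _ do rewrite cs.
  by rewrite sumr_const card_ord mulr_natl.
have rq : r = q.+1%:R.
  have n0 : n%:R != 0 :> rat by rewrite pnatr_eq0 -lt0n.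
  by apply: (mulfI n0); rewrite -tot natrM.
split; last by move=> j; apply/eqP; rewrite -(eqr_nat rat) cs rq.
have : (q + n)%:R = (q.+1 * q.+1)%N%:R :> rat by rewrite natrM -[X in X * _]rq divfK.
move=> /eqP; rewrite eqr_nat => /eqP; nia.
Qed.

Variables (M : zmodType) (c : 'I_n -> M).
Local Notation u := (\sum_i c i).
Hypothesis cN : forall i, c i + \sum_(j | N i j) c j = u.

(** Sum [cN] over i: each c j occurs once, and q + 1 more times by the column sums, so (q + 2) u =
    (q^2 + q + 1) u. *)
Lemma inc_total : u *+ (q ^ 2 - 1) = 0.
Proof.
have [nE cs] := incmx_colsum.
have : \sum_i (c i + \sum_(j | N i j) c j) = u *+ n.
  by rewrite (eq_bigr _ (fun i _ => cN i)) sumr_const card_ord.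
rewrite big_split /= (exchange_big_dep xpredT) //=.
have -> : \sum_j \sum_(i | N i j) c j = u *+ q.+1.
  rewrite -sumrMnl; apply: eq_bigr => j _; rewrite sumr_const -(cs j).
  by congr (_ *+ _); rewrite -sum1_card big_mkcond /=; apply: eq_bigr => i _; rewrite unfold_in; case: (N i j).
rewrite -mulrS => E; have {E}: u *+ q.+2 = u *+ (q ^ 2 + q + 1) by rewrite -nE.
move=> /eqP; rewrite eq_sym -subr_eq0 -mulrnBr; last nia.
by rewrite (_ : _ - _ = q ^ 2 - 1)%N => [/eqP|]; last nia.
Qed.

(** Multiplying the system by the adjugate of 1 + A makes each det (1 + A) c i a multiple of u,
    which is killed by q^2 - 1. *)
Lemma inc_torsion : exists2 D : nat, (0 < D)%N & forall i, c i *+ D = 0.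
Proof.
pose B : 'M[int]_n := 1%:M + incmx int.
have detB : \det B != 0.
  have -> : (\det B != 0) = (\det (map_mx (intr : int -> rat) B) != 0).
    by rewrite det_map_mx intr_eq0.
  apply/negP => /det0P[v v0 E]; case/eqP: v0.
  apply: (@incmx_eq0 v (-1)); first by rewrite sqrrN expr1n ltr1n.
  have mB : map_mx (intr : int -> rat) B = 1%:M + incmx rat.
    rewrite map_mxD map_mx1; congr (_ + _).
    by apply/matrixP => i j; rewrite !mxE; case: (N i j).
  by move: E; rewrite mB mulmxDr mulmx1 scaleN1r => /eqP; rewrite addrC addr_eq0 => /eqP.
have cB i : \sum_j c j *~ B i j = u.
  rewrite -(cN i) [in RHS]big_mkcond /= -[X in X + _](big_pred1_eq +%R i c) big_mkcond /=.
  rewrite -big_split /=; apply: eq_bigr => j _; rewrite !mxE mulrzDr.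
  by rewrite eq_sym; case: eqP; case: (N i j); rewrite ?mulr1z ?mulr0z.
have cdet k : c k *~ \det B = u *~ (\sum_i (\adj B) k i).
  have -> : c k *~ \det B = \sum_j c j *~ (\adj B *m B) k j.
    rewrite mul_adj_mx (bigD1 k) //= big1 ?addr0 => [|j jk]; rewrite mxE ?eqxx ?mulr1n //.
    by rewrite eq_sym (negbTE jk) mulr0n mulr0z.
  under eq_bigr => j _ do rewrite mxE mulrz_sumr.
  rewrite exchange_big /= mulrz_sumr; apply: eq_bigr => i _.
  rewrite -(cB i) mulrz_suml; apply: eq_bigr => j _.
  by rewrite -mulrzA mulrC.
exists (`|\det B| * (q ^ 2 - 1))%N.
  by rewrite muln_gt0 absz_gt0 detB subn_gt0 -{1}(exp1n 2) ltn_exp2r.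
move=> i; rewrite mulrnA; have -> : c i *+ `|\det B|%N = c i *~ \det B *~ sgz (\det B).
  by rewrite -mulrzA mulrC -abszEsg.
by rewrite cdet -mulrzA pmulrn mulrzAC -pmulrn inc_total mul0rz.
Qed.

End IncidenceAlgebra.

(** * Counting points, orders and torsion groups *)

Lemma plane_order_gt1 (P L : Type) (inc : P -> L -> Prop) n :
  projective_plane inc n -> (1 < n)%N.
Proof.
move=> [jn mt [p pi pq] cd].
pose i0 : 'I_4 := ord0; pose i1 : 'I_4 := inord 1.
pose i2 : 'I_4 := inord 2; pose i3 : 'I_4 := inord 3.
have [e0 [e1 [e2 e3]]] : nat_of_ord i0 = 0%N /\ nat_of_ord i1 = 1%N /\
    nat_of_ord i2 = 2%N /\ nat_of_ord i3 = 3%N by rewrite /= !inordK.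
have ne (i j : 'I_4) : nat_of_ord i <> j -> p i <> p j by move=> ij /pi E; apply: ij; rewrite E.
have p01 : p i0 <> p i1 by apply: ne; rewrite e0 e1.
have p23 : p i2 <> p i3 by apply: ne; rewrite e2 e3.
have [l [[l0 l1] _]] := jn _ _ p01; have [m [[m2 m3] _]] := jn _ _ p23.
have un (a b c : 'I_4) : nat_of_ord a != b -> nat_of_ord b != c -> nat_of_ord a != c ->
    uniq [:: a; b; c] by rewrite /= !inE !negb_or -!val_eqE /= => -> -> ->.
have lm : l <> m.
  by move=> E; apply: (pq l i0 i1 i2); [apply: un; rewrite ?e0 ?e1 ?e2|rewrite {3}E].
(* The line through p0 and p1 meets the line through p2 and p3 in a third point, so it has at least
   three. *)
have [x [[xl xm] _]] := mt _ _ lm.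
have x0 : x <> p i0.
  by move=> E; rewrite E in xm; apply: (pq m i0 i2 i3); [apply: un; rewrite ?e0 ?e2 ?e3|].
have x1 : x <> p i1.
  by move=> E; rewrite E in xm; apply: (pq m i1 i2 i3); [apply: un; rewrite ?e1 ?e2 ?e3|].
pose A : set {classic P} := [set x | inc x l].
have Aq : A #= `I_n.+1 := cd l.
have fA : finite_set A by exists n.+1.
rewrite -ltnS -(card_fset_set Aq).
pose s : seq {classic P} := [:: x : P; p i0; p i1].
have us : uniq s.
  rewrite /s /= !inE negb_or !andbT; apply/andP; split; last exact/eqP.
  by apply/andP; split; apply/eqP.
apply: (uniq_leq_size us) => y ys; rewrite in_fset_set //; apply: mem_set.
by move: ys; rewrite !inE => /or3P[]/eqP ->.
Qed.

Lemma card_seq (T : choiceType) (S : set T) (l : seq T) n : uniq l ->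
  (forall v, S v <-> v \in l) -> S #= `I_n -> size l = n.
Proof.
move=> ul lE Sn; have fS : finite_set S by exists n.
rewrite -(card_fset_set Sn); apply: perm_size; apply: uniq_perm => // v.
rewrite in_fset_set //; apply/idP/idP => [/lE/mem_set//|/set_mem/lE//].
Qed.

Lemma has_order_bound (M : zmodType) (a : M) k : (0 < k)%N -> a *+ k = 0 ->
  exists2 m, has_order a m & (m <= k)%N.
Proof.
move=> k0 ak; have ex : exists m, (0 < m)%N && (a *+ m == 0).
  by exists k; rewrite k0 ak eqxx.
have [m /andP[m0 /eqP am] mP] := ex_minnP ex; exists m; last by apply: mP; rewrite k0 ak eqxx.
split=> // j /andP[j0 jm] aj; have := mP j; rewrite j0 aj eqxx => /(_ isT).
by rewrite leqNgt jm.
Qed.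

Lemma torsion_span_finite (M : zmodType) n (c : 'I_n -> M) D : (0 < D)%N ->
  (forall i, c i *+ D = 0) ->
  (forall m, exists k : 'I_n -> int, m = \sum_i c i *~ k i) -> finite_set [set: M].
Proof.
case: D => // D _ cD span.
apply: (@sub_finite_set _ _ ((fun k : {ffun 'I_n -> 'I_D.+1} => \sum_i c i *+ k i) @` setT)).
  move=> m _; have [k ->] := span m.
  exists [ffun i => inord `|(k i %% D.+1%:Z)%Z|%N] => //; apply: eq_bigr => i _.
  rewrite ffunE inordK; last first.
    by rewrite -ltz_nat gez0_abs ?modz_ge0 // ltz_pmod.
  rewrite [in RHS](divz_eq (k i) D.+1) mulrzDr mulrC mulrzA -pmulrn cD mul0rz add0r.
  by rewrite pmulrn gez0_abs // modz_ge0.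
exact: finite_image.
Qed.

(** * Coinvariants *)

Section Coinvariants.
Variables (R : realType) (q : nat) (Delta : A2_building q) (G : groupType).
Variable Gamma : A2_group Delta G.
Local Notation V := (vertex Delta).
Local Notation act := (gact Gamma).
Local Notation cl := (@coinv_class R q Delta G Gamma).
Local Notation chi := (@chi R q Delta).
Implicit Types (x y z : V) (g : G).

Lemma coinv_class_zmod_morphism : zmod_morphism cl.
Proof. by move=> f h; rewrite /coinv_class; exact: raddfB. Qed.

HB.instance Definition _ :=
  GRing.isZmodMorphism.Build (CZ R Delta) (coinvariants R Gamma) cl coinv_class_zmod_morphism.

Lemma coinv_class_act g (f : CZ R Delta) : cl (act_CZ Gamma g f) = cl f.
Proof.
apply/eqP; rewrite /coinv_class -Quotient.idealrBE; apply/asboolP => S _.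
exact.
Qed.

Lemma coinv_class_surj (m : coinvariants R Gamma) : exists f, m = cl f.
Proof. by exists (repr m); rewrite /coinv_class reprK. Qed.

Lemma chi_act g x y : directed_edge x y -> cl (chi (act g x) (act g y)) = cl (chi x y).
Proof.
move=> xy; rewrite -[RHS](coinv_class_act g); congr (cl _); apply: CZ_ext => xi.
have gxy := directed_edge_act Gamma g xy.
rewrite (chiE xi gxy) -[RHS]/(evalCZ (act_mb Gamma g^-1%g xi) (chi x y)) (chiE _ xy) /chi_fun.
congr (Posz (nat_of_bool _)); apply/asboolP/asboolP => h.
  by have := act_mb_Omega Gamma g^-1%g h; rewrite !gactK.
have := act_mb_Omega Gamma g h.
by have := act_mbK Gamma g^-1%g xi; rewrite invgK => ->.
Qed.

Section Base.
Variable o : V.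
Let E := out_edges o.
Let n := size E.
Definition nbr (i : 'I_n) : V := tnth (in_tuple E) i.
Definition gen_class (i : 'I_n) := cl (chi o (nbr i)).
Local Notation u := (cl (CZ_one R Delta)).

Lemma nbr_edge i : directed_edge o (nbr i).
Proof. by apply/mem_out_edges; exact: mem_tnth. Qed.

Lemma nbr_ex y : directed_edge o y -> exists i, y = nbr i.
Proof. by move=> /mem_out_edges yE; have /tnthP[i ->] : y \in in_tuple E by []; exists i. Qed.

Lemma nbr_inj : injective nbr.
Proof.
move=> i j; rewrite /nbr !(tnth_nth o) /= => /eqP.
by rewrite nth_uniq ?out_edges_uniq // => /eqP/val_inj.
Qed.

Lemma sum_nbr (I : nmodType) (F : V -> I) (P : pred V) :
  \sum_(i | P (nbr i)) F (nbr i) = \sum_(y <- E | P y) F y.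
Proof. by rewrite [RHS]big_tnth. Qed.

Lemma sum_gen_class : \sum_i gen_class i = u.
Proof.
rewrite (sum_nbr (fun y => cl (chi o y)) xpredT) -raddf_sum /=; congr (cl _).
exact: sum_chi.
Qed.

(** The group element that moves the edge from [o] to [nbr i] so that it ends at [o]; its new origin
    [pre i] is a line of the link of [o], while the [nbr j] are the points. *)
Definition to_base (i : 'I_n) : G := xget 1%g [set g | act g (nbr i) = o].

Lemma to_baseE i : act (to_base i) (nbr i) = o.
Proof.
rewrite /to_base; case: xgetP => // h.
by have [g gE] := gact_trans Gamma (nbr i) o; case: (h g).
Qed.

Definition pre (i : 'I_n) : V := act (to_base i) o.

Lemma pre_edge i : directed_edge (pre i) o.
Proof. by have := directed_edge_act Gamma (to_base i) (nbr_edge i); rewrite to_baseE. Qed.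

Lemma pre_inj : injective pre.
Proof.
move=> i j ij; apply: nbr_inj.
have : act ((to_base j)^-1 * to_base i)%g o = o by rewrite gactM -/(pre i) ij gactK.
move/gact_free => E1; have E' : to_base i = to_base j.
  by rewrite -[LHS]mul1g -(mulgV (to_base j)) -mulgA E1 mulg1.
by rewrite -(gactK Gamma (to_base i) (nbr i)) to_baseE E' -(to_baseE j) gactK.
Qed.

Definition inc_nbr (i j : 'I_n) : bool := `[< simplex [set pre i; o; nbr j] >].

(* The edge from pre i to o is in the orbit of the edge from o to nbr i.     *)
Lemma gen_class_refine i : gen_class i + \sum_(j | inc_nbr i j) gen_class j = \sum_j gen_class j.
Proof.
rewrite [RHS](bigID (inc_nbr i)) /= addrC; congr (_ + _).
rewrite /gen_class -(chi_act (to_base i) (nbr_edge i)) to_baseE -/(pre i).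
rewrite (chi_refine R (pre_edge i)) raddf_sum /=.
by rewrite (sum_nbr (fun y => cl (chi o y)) (fun y => ~~ `[< simplex [set pre i; o; y] >])).
Qed.

Lemma sum_nat_nbr (P : pred V) : (\sum_i P (nbr i))%N = size (seq.filter P E).
Proof.
rewrite size_filter -sum1_count [RHS]big_mkcond [RHS]big_tnth.
by apply: eq_bigr => i _; rewrite /nbr; case: (P _).
Qed.

Lemma inc_nbr_row i : (\sum_j inc_nbr i j)%N = q.+1.
Proof.
rewrite (sum_nat_nbr (fun y => `[< simplex [set pre i; o; y] >])).
apply: (card_seq (S := [set y | directed_edge o y /\ simplex [set pre i; o; y]])).
- by rewrite filter_uniq // out_edges_uniq.
- move=> y; rewrite mem_filter; split=> [[/mem_out_edges -> ?]|/andP[/asboolP ? /mem_out_edges]//].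
  by rewrite andbT; apply/asboolP.
have [_ _ _ /(_ (exist _ (pre i) (pre_edge i))) cd] := bld_link o.
move: cd; set A := [set p | _] => cd; apply: card_eq_trans cd; rewrite (_ : [set y | _] = sval @` A).
  by apply: inj_card_eq => a b _ _; exact: sval_eq.
apply/seteqP; split=> [y [oy s]|_ [[y oy] /= s <-]].
  by exists (exist _ y oy) => //=; exact: simplex3C.
by split=> //; exact/simplex3C/simplex3C.
Qed.

Lemma inc_nbr_meet i j : i != j -> (\sum_k inc_nbr i k * inc_nbr j k)%N = 1%N.
Proof.
move=> ij; have nij : pre i <> pre j by move=> /pre_inj/eqP; exact/negP.
pose P y := `[< simplex [set pre i; o; y] >] && `[< simplex [set pre j; o; y] >].
transitivity (\sum_k P (nbr k))%N.
  by apply: eq_bigr => k _; rewrite /P /inc_nbr; case: asbool; case: asbool.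
rewrite sum_nat_nbr.
have [_ /(_ (exist _ (pre i) (pre_edge i)) (exist _ (pre j) (pre_edge j))) mt _ _] := bld_link o.
have [|[y oy] [[/= s1 s2] yu]] := mt; first by move=> /(congr1 sval).
transitivity (size [:: y]) => //; apply: perm_size; apply: uniq_perm => //.
  by rewrite filter_uniq // out_edges_uniq.
move=> t; rewrite mem_filter inE /P; apply/idP/idP.
  move=> /andP[/andP[/asboolP h1 /asboolP h2] /mem_out_edges ot].
  have := yu (exist _ t ot) (conj (simplex3C h1) (simplex3C h2)).
  by move=> /(congr1 sval) /= ->.
move=> /eqP ->; apply/andP; split; last exact/mem_out_edges.
by apply/andP; split; apply/asboolP; exact/simplex3C/simplex3C.
Qed.

Lemma nbr_gt0 : (0 < n)%N.
Proof.
have [_ _ [p _ _] _] := bld_link o; have /mem_out_edges := svalP (p ord0).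
by rewrite /n -has_predT => h; apply/hasP; exists (sval (p ord0)).
Qed.

Lemma order_gt1 : (1 < q)%N.
Proof. exact: plane_order_gt1 (bld_link o). Qed.

Lemma nbr_count : n = (q ^ 2 + q + 1)%N.
Proof. by have [] := incmx_colsum order_gt1 nbr_gt0 inc_nbr_row inc_nbr_meet. Qed.

Lemma one_torsion : u *+ (q ^ 2 - 1) = 0.
Proof.
rewrite -sum_gen_class; apply: (inc_total order_gt1 nbr_gt0 inc_nbr_row inc_nbr_meet).
exact: gen_class_refine.
Qed.

(** The functions [chi] generate by [chi_span_all], and transitivity on vertices moves each edge to
    one leaving [o]. *)
Lemma gen_class_span (m : coinvariants R Gamma) : exists k : 'I_n -> int, m = \sum_i gen_class i *~ k i.
Proof.
have [f ->] := coinv_class_surj m.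
apply: (chi_span_all f (S := [set f | exists k : 'I_n -> int, cl f = \sum_i gen_class i *~ k i])).
- by exists (fun=> 0); rewrite raddf0 big1.
- move=> f1 f2 [k1 E1] [k2 E2]; exists (fun i => k1 i - k2 i).
  by rewrite raddfB /= E1 E2 -sumrB; apply: eq_bigr => i _; rewrite mulrzBr.
- move=> x y xy; have [g gx] := gact_trans Gamma x o.
  have gxy := directed_edge_act Gamma g xy; rewrite gx in gxy.
  have [i yE] := nbr_ex gxy; exists (fun j => (j == i : nat)%:Z).
  rewrite (bigD1 i) //= eqxx big1 ?addr0 => [|j /negbTE ->] //.
  by rewrite /gen_class -yE -gx chi_act.
Qed.

Lemma coinvariants_finite : finite_set [set: coinvariants R Gamma].
Proof.
have [D D0 cD] := inc_torsion order_gt1 nbr_gt0 inc_nbr_row inc_nbr_meet gen_class_refine.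
exact: torsion_span_finite D0 cD gen_class_span.
Qed.

(** * Triangle presentations and Singer groups *)

Section Presentation.
Variables (P : Type) (T : P -> P -> P -> Prop) (gen : P -> G).
Hypothesis presT : presents T gen.
Hypothesis presB : presents_building Gamma T gen o.
Let letter (x : P) := cl (chi o (act (gen x) o)).

Lemma gen_edge a (x : P) : directed_edge (act a o) (act (a * gen x)%g o).
Proof. by have [H _] := presB; apply/H; exists a, x. Qed.

Lemma gen_edge1 (x : P) : directed_edge o (act (gen x) o).
Proof. by have := gen_edge 1%g x; rewrite gact1 mul1g. Qed.

Lemma letter_act a (x : P) : cl (chi (act a o) (act (a * gen x)%g o)) = letter x.
Proof. by rewrite gactM chi_act //; exact: gen_edge1. Qed.

(** As x y z = 1 in the group, the third edge of the chamber at [o] returns to [o], and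
    [chi_triangle] applies; [letter_act] moves its edges to [o]. *)
Lemma relation_triangle (x y z : P) : T x y z -> letter x + letter y + letter z = u.
Proof.
move=> txyz; have [_ /(_ [:: (x, true); (y, true); (z, true)] [::])[_ W]] := presT.
have := W (word_eq_rel txyz); rewrite /word_val !big_cons !big_nil /= mulg1 mulgA => xyz.
have [_ HC] := presB.
have [sc _] : chamber [set act 1%g o; act (1 * gen x)%g o; act (1 * gen x * gen y)%g o].
  by apply/HC; exists 1%g, x, y, z.
have e2 := gen_edge (gen x * gen y)%g z; rewrite xyz gact1 in e2.
rewrite gact1 !mul1g in sc.
have <- := congr1 cl (chi_triangle R (gen_edge1 x) e2 sc).
rewrite !raddfD /= letter_act; congr (_ + _ + _).
by rewrite -(letter_act (gen x * gen y)%g) xyz gact1.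
Qed.

Lemma relation_ex : exists x y z : P, T x y z.
Proof.
have oy := nbr_edge (Ordinal nbr_gt0).
have [z [zo s]] := edge_triangle oy; have yz := tri_edge oy zo s.
have ne (a b : V) : directed_edge a b -> a <> b.
  move=> [_ t] E'; move: t; rewrite E' => /eqP; rewrite -subr_eq0 opprD addrA subrr sub0r.
  by rewrite oppr_eq0 => /eqP/zero_one_Z3.
have [Sys HS] := bld_apartments Delta.
have [_ HC] := presB.
have := simplex3_chamber HS s (ne _ _ oy) (ne _ _ yz) (not_eq_sym (ne _ _ zo)).
by move=> /HC[a [x1 [y1 [z1 [t _]]]]]; exists x1, y1, z1.
Qed.

(** The orbit covers all edges leaving [o], and there are exactly q^2 + q + 1 of these
    ([nbr_count]), so it lists each once. *)
Lemma sum_cycle (sP : P -> P) (p : P) :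
  (forall p' : P, exists k, (k < q ^ 2 + q + 1)%N /\ iter k sP p = p') ->
  \sum_(k <- iota 0 (q ^ 2 + q + 1)) letter (iter k sP p) = u.
Proof.
move=> cyc; pose l := [seq act (gen (iter k sP p)) o | k <- iota 0 (q ^ 2 + q + 1)].
have subl : {subset E <= l}.
  move=> y /mem_out_edges oy; have [H _] := presB; have /H[a [x [oE yE]]] := oy.
  have a1 : a = 1%g by apply: gact_free; exact: esym oE.
  have [k [kn kx]] := cyc x; apply/mapP; exists k; first by rewrite mem_iota.
  by rewrite kx yE a1 mul1g.
have sl : (size l <= size E)%N by rewrite size_map size_iota -/n nbr_count.
have ul : uniq l.
  exact: leq_size_uniq (out_edges_uniq o) subl sl.
have pE : perm_eq E l.
  apply: uniq_perm => //; first exact: out_edges_uniq.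
  by have [//] := uniq_min_size (out_edges_uniq o) subl sl.
rewrite -[RHS]sum_gen_class (sum_nbr (fun y => cl (chi o y)) xpredT) (perm_big _ pE) /=.
by rewrite big_map.
Qed.

(* Summing the relation of one triangle over the Singer group gives          *)
(* 3 [1] = (q^2 + q + 1) [1]; subtract (q^2 - 1) [1] = 0.                    *)
Lemma singer_torsion (sP : P -> P) :
  (forall p p' : P, exists k, (k < q ^ 2 + q + 1)%N /\ iter k sP p = p') ->
  (forall x y z : P, T x y z -> T (sP x) (sP y) (sP z)) -> u *+ (q - 1) = 0.
Proof.
move=> cyc inv; have [x [y [z t]]] := relation_ex.
have tk k : T (iter k sP x) (iter k sP y) (iter k sP z).
  by elim: k => [|k IH] //=; exact: inv.
have : \sum_(k <- iota 0 (q ^ 2 + q + 1)) (letter (iter k sP x) + letter (iter k sP y)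
    + letter (iter k sP z)) = u *+ (q ^ 2 + q + 1).
  under eq_bigr => k _ do rewrite (relation_triangle (tk k)).
  by rewrite big_const_seq count_predT size_iota iter_addr addr0.
rewrite !big_split /= !sum_cycle // => E3.
have q1 := order_gt1.
have : u *+ (q ^ 2 + q + 1) = u *+ (q ^ 2 - 1) + u *+ (q - 1) + u *+ 3.
  by rewrite -!mulrnDr; congr (_ *+ _); nia.
rewrite -E3 one_torsion add0r (_ : u + u + u = u *+ 3); last by rewrite !mulrS addr0 addrA.
by move=> /eqP; rewrite eq_sym -subr_eq0 addrK => /eqP.
Qed.

End Presentation.
End Base.
End Coinvariants.

Theorem corollary5p1 (R : realType) (q : nat) (Delta : A2_building q)
    (G : groupType) (Gamma : A2_group Delta G) :
  [/\ finite_set [set: coinvariants R Gamma],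
      (exists2 n : nat, has_order (coinv_class Gamma (CZ_one R Delta)) n &
                        (n <= q ^ 2 - 1)%N) &
      (has_S_invariant_presentation Gamma ->
        coinv_class Gamma (CZ_one R Delta) *+ (q - 1) = 0)].
Proof.
have [x0 _] := bld_nonempty Delta; have q1 := order_gt1 x0.
split; first exact: (coinvariants_finite R Gamma x0).
  by apply: has_order_bound (one_torsion R Gamma x0); nia.
move=> [F [lam [T [_ _ [sP [sL [[_ [_ _ cyc _]] inv]]] [gen [x1 [presT presB]]]]]]].
apply: (singer_torsion R presT presB (sP := sP)) => [p p'|x y z /inv//].
by have [k [kP _]] := cyc p p'; exists k.
Qed.
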